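(* Let $y\in\{0,1\}^n$, let $x_1,\dots,x_n\in\mathbb{R}^p$ be the rows of $X\in\mathbb{R}^{n\times p}$, $m_0\in\mathbb{R}^p$, and $\Sigma_0\in\mathbb{R}^{p\times p}$ symmetric positive definite. Let $\kappa=y-\tfrac12\mathbf{1}_n$, let $\Pi(\cdot\mid X,y)$ be the posterior on $\mathbb{R}^p$ of Bayesian logistic regression with prior $N(m_0,\Sigma_0)$, and let $P_{\mathrm{PG}}$ be the Markov transition kernel on $\mathbb{R}^p$ of the Pólya–Gamma Gibbs chain $\{\beta^{(t)}\}_{t\ge0}$. Let $V(\beta)=\|\beta\|^2$. Then the chain is hyper-$V$ uniformly ergodic. In particular, for every $r>1$, with $\gamma_r=1-1/r$, $$K=\|\Sigma_0\|^2\,\|X^\top\kappa+\Sigma_0^{-1}m_0\|^2+\mathrm{tr}(\Sigma_0),\qquad \epsilon_r=\prod_{i=1}^n\left[\cosh\!\left(\|x_i\|\sqrt{rK}/2\right)\right]^{-1},$$ one has for all $\beta\in\mathbb{R}^p$ and all integers $t\ge1$, $$\|P_{\mathrm{PG}}^{t}(\beta,\cdot)-\Pi(\cdot\mid X,y)\|_{\mathrm{TV}}\le\rho_t(\gamma_r,\epsilon_r),\qquad \|P_{\mathrm{PG}}^{t+1}(\beta,\cdot)-\Pi(\cdot\mid X,y)\|_{1+V}\le 2(1+K)\,\rho_t(\gamma_r,\epsilon_r).$$ Moreover, if $W_{\ell_2}$ denotes the Wasserstein distance induced by the $\ell_2$-metric on $\mathbb{R}^p$, then $$W_{\ell_2}\big(P_{\mathrm{PG}}^{t+1}(\beta,\cdot),\Pi(\cdot\mid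 X,y)\big)\le 2(1+K)\,\rho_t(\gamma_r,\epsilon_r)\qquad\text{for all }\beta\in\mathbb{R}^p,\ t\ge1.$$
   Context: Posterior: $\Pi(\cdot\mid X,y)$ has Lebesgue density proportional to $\prod_{i=1}^n \frac{\exp(y_i x_i^\top\beta)}{1+\exp(x_i^\top\beta)}$ times the $N(m_0,\Sigma_0)$ density. Pólya–Gamma distribution: for $b>0$, $c\in\mathbb{R}$, $\mathrm{PG}(b,c)$ is the law on $(0,\infty)$ of $\frac{1}{2\pi^2}\sum_{k=1}^\infty \frac{g_k}{(k-1/2)^2+c^2/(4\pi^2)}$ with $g_k$ i.i.d. $\mathrm{Gamma}(b,1)$. Chain: given $\beta^{(t)}$, sample independently $\omega_i^{(t+1)}\sim\mathrm{PG}(1,x_i^\top\beta^{(t)})$, $i=1,\dots,n$; then sample $\beta^{(t+1)}\mid\omega^{(t+1)}\sim N(m_{\omega^{(t+1)}},\Sigma_{\omega^{(t+1)}})$, where, with $\Omega=\mathrm{diag}(\omega_1,\dots,\omega_n)$, $\Sigma_\omega=(X^\top\Omega X+\Sigma_0^{-1})^{-1}$ and $m_\omega=\Sigma_\omega(X^\top\kappa+\Sigma_0^{-1}m_0)$. $P_{\mathrm{PG}}$ is the transition kernel of $\beta^{(t)}\mapsto\beta^{(t+1)}$. Norms: $\|\cdot\|$ is the Euclidean norm on vectors and the operator (spectral) norm on matrices. $P^t$ is the $t$-step kernel, $Pf(\beta)=\int f\,dP(\beta,\cdot)$. $\|P^t(\beta,\cdot)-\Pi\|_{\mathrm{TV}}=\sup_{f:\mathbb{R}^p\to[0,1]\text{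 Borel}}|P^tf(\beta)-\int f\,d\Pi|$, and for $W\ge0$, $\|P^t(\beta,\cdot)-\Pi\|_{W}=\sup_{|f|\le W,\ f\text{ Borel}}|P^tf(\beta)-\int f\,d\Pi|$. $W_{\ell_2}(\mu,\Pi)=\inf_\Gamma\int\|u-v\|\,\Gamma(du,dv)$ over couplings $\Gamma$ of $\mu,\Pi$. Hyper-$V$ uniform ergodicity of a kernel $P$ with invariant probability measure $\Pi$: there are $\alpha\in(0,1)$ and $K'>0$ such that for all $\beta$ and all integers $t\ge1$, $\|P^{2t}(\beta,\cdot)-\Pi\|_{\mathrm{TV}}\le(1-\alpha)^t$ and $\|P^{2t+1}(\beta,\cdot)-\Pi\|_{1+V}\le2(1+K')(1-\alpha)^t$. For $\gamma\in(0,1)$ and $\alpha\in(0,1]$ (with $\wedge,\vee$ the minimum and maximum), $$\lambda_{\pm}(\gamma,\alpha) = \frac{1-\gamma\wedge\alpha \pm \sqrt{(1-\gamma\wedge\alpha)^2 + 4(\gamma\wedge\alpha)(1-\alpha\vee\gamma)}}{2},$$ $$\rho_t(\gamma,\alpha) = \frac{(1-\lambda_-(\gamma,\alpha))\,\lambda_+(\gamma,\alpha)^t - (1-\lambda_+(\gamma,\alpha))\,\lambda_-(\gamma,\alpha)^t}{\lambda_+(\gamma,\alpha)-\lambda_-(\gamma,\alpha)}.$$ *)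

(* Defs.v *)
From HB Require Import structures.
From mathcomp Require Import all_boot all_order all_algebra.
From mathcomp Require Import all_classical all_reals all_analysis.

Set Implicit Arguments.
Unset Strict Implicit.
Unset Printing Implicit Defensive.

Import Order.TTheory GRing.Theory Num.Theory.
Import numFieldNormedType.Exports.

Local Open Scope classical_set_scope.
Local Open Scope ring_scope.

Section borel_matrix.
Context {R : realType} {m n : nat}.

Definition borel_mx : set (set 'M[R]_(m, n)) := <<s (@open 'M[R]_(m, n)) >>.

Let borel_mx0 : borel_mx set0.
Proof. exact: sigma_algebra0. Qed.

Let borel_mxC A : borel_mx A -> borel_mx (~` A).
Proof. by move=> mA; rewrite -setTD; exact: sigma_algebraCD. Qed.

Let borel_mx_bigcup (F : (set 'M[R]_(m, n))^nat) :
  (forall i, borel_mx (F i)) -> borel_mx (\bigcup_i F i).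
Proof. exact: sigma_algebra_bigcup. Qed.

HB.instance Definition _ := @isMeasurable.Build (sigma_display (@open 'M[R]_(m, n)))
  'M[R]_(m, n) borel_mx borel_mx0 borel_mxC borel_mx_bigcup.

End borel_matrix.

Section measurable_matrix.
Context {R : realType}.

Lemma measurable_mx_coord m n (i : 'I_m) (j : 'I_n) :
  measurable_fun [set: 'M[R]_(m, n)] (fun M : 'M[R]_(m, n) => M i j).
Proof.
apply: (measurability _ (measurable_realfun.RGenOpens.measurableE R)).
move=> _ [_ [a [b ->]] <-]; rewrite setTI; apply: sub_sigma_algebra.
apply: open_comp => [M _|]; last exact: interval_open.
exact: coord_continuous.
Qed.

Lemma measurable_mxP d (T : measurableType d) m n (f : T -> 'M[R]_(m, n)) :
  (forall i j, measurable_fun [set: T] (fun x => f x i j)) ->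
  measurable_fun [set: T] f.
Proof.
move=> mf; apply: (measurability (@open 'M[R]_(m, n))) => // _ [U oU <-].
rewrite setTI.
pose B (qk : 'M[rat]_(m, n) * nat) : set 'M[R]_(m, n) :=
  ball (map_mx ratr qk.1 : 'M[R]_(m, n)) (qk.2.+1%:R^-1).
pose F qk := if `[< B qk `<=` U >] then f @^-1` B qk else set0.
have -> : f @^-1` U = \bigcup_qk F qk.
  apply/seteqP; split => [x /= Ux|x [qk _]]; last first.
    by rewrite /F; case: asboolP => // /(_ (f x)).
  have /nbhs_ballP[e /= e0 eU] : nbhs (f x) U by exact: open_nbhs_nbhs.
  have [k ke] : exists k : nat, (k.+1%:R^-1 : R) < e / 2.
    have e2 : 0 < e / 2 by rewrite divr_gt0.
    exists (Num.truncn (e / 2)^-1); rewrite invf_plt ?posrE//.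
    exact: truncnS_gt.
  have hq (y : R) : exists q : rat, `|ratr q - y| < k.+1%:R^-1.
    have /rat_in_itvoo[q] : y - k.+1%:R^-1 < y + k.+1%:R^-1.
      by rewrite ltrD2l gtrN// invr_gt0.
    rewrite in_itv/= => /andP[q1 q2]; exists q.
    by rewrite ltr_distl q1 q2.
  exists (\matrix_(i, j) projT1 (cid (hq (f x i j))), k) => //.
  rewrite /F; case: asboolP => [_|[]].
    by split=> [|i j]; rewrite ?invr_gt0 //= !mxE /ball/=; case: cid.
  move=> M [_ BM]; apply: eU; split=> // i j.
  have := BM i j; rewrite !mxE /ball/=; case: cid => q /= hq1 hq2.
  rewrite (le_lt_trans (ler_distD (ratr q) _ _))// distrC.
  by rewrite (splitr e) ltrD// (lt_trans _ ke).
apply: countable_bigcupT_measurable => [|[q k]]; first exact: countableP.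
rewrite /F; case: asboolP => // _.
have -> : f @^-1` B (q, k) =
    \bigcap_(ij in [set: 'I_m * 'I_n])
      ((fun x => f x ij.1 ij.2) @^-1` ball (ratr (q ij.1 ij.2) : R) k.+1%:R^-1).
  apply/seteqP; split => [x [_ Bx] [i j] _|x Bx]/=.
    by have := Bx i j; rewrite mxE.
  split=> [|i j]; first by rewrite invr_gt0.
  by have := Bx (i, j) Logic.I; rewrite mxE.
apply: fin_bigcap_measurable => // -[i j] _ /=.
by rewrite -[X in measurable X]setTI; apply: mf => //; exact: measurable_realfun.measurable_ball.
Qed.

End measurable_matrix.

Section lebesgue_cV.
Context {R : realType}.

Definition cons_cV p (z : measurableTypeR R * 'cV[R]_p) : 'cV[R]_p.+1 := col_mx z.1%:M z.2.

Lemma measurable_cons_cV p : measurable_fun [set: measurableTypeR R * 'cV[R]_p] (@cons_cV p).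
Proof.
apply: measurable_mxP => i j; rewrite (ord1 j).
case: (@split_ordP 1 p i) => k ->.
  rewrite (_ : (fun _ => _) = fst); first exact: measurable_fst.
  by apply/funext => z; rewrite [LHS](@col_mxEu R 1 p 1) (ord1 k) mxE eqxx mulr1n.
rewrite (_ : (fun _ => _) = (fun v : 'cV[R]_p => v k ord0) \o snd).
  exact: measurableT_comp (measurable_mx_coord _ _) measurable_snd.
by apply/funext => z; rewrite [LHS](@col_mxEd R 1 p 1).
Qed.

Lemma measurable_behead_cV p :
  measurable_fun [set: 'cV[R]_p.+1] (fun v => (v ord0 ord0 : measurableTypeR R, dsubmx (v : 'cV_(1 + p)))).
Proof.
apply: measurable_fun_pair; first exact: measurable_mx_coord.
apply: measurable_mxP => i j.
rewrite (_ : (fun _ => _) = (fun v : 'cV[R]_p.+1 => v (rshift 1 i) j)).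
  exact: measurable_mx_coord.
by apply/funext => v; rewrite mxE.
Qed.

Section lebesgue_cons.
Variables (p : nat) (mu : {sigma_finite_measure set 'cV[R]_p -> \bar R}).

Definition lebesgue_cons : set 'cV[R]_p.+1 -> \bar R :=
  pushforward (lebesgue_measure \x mu)%E (@cons_cV p).

Let lebesgue_cons0 : lebesgue_cons set0 = 0%E.
Proof. by rewrite /lebesgue_cons /pushforward preimage_set0 measure0. Qed.

Let lebesgue_cons_ge0 A : (0 <= lebesgue_cons A)%E.
Proof. by rewrite /lebesgue_cons /pushforward; exact: measure_ge0. Qed.

Let lebesgue_cons_sigma_additive : semi_sigma_additive lebesgue_cons.
Proof.
have mcons A : measurable A -> measurable (@cons_cV p @^-1` A).
  by move=> mA; rewrite -[X in measurable X]setTI; exact: measurable_cons_cV.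
move=> F mF tF mUF; rewrite /lebesgue_cons /pushforward preimage_bigcup.
apply: measure_semi_sigma_additive.
- by move=> n; exact: mcons.
- apply/trivIsetP => /= i j _ _ ij; rewrite -preimage_setI.
  by move/trivIsetP : tF => /(_ _ _ _ _ ij) ->//; rewrite preimage_set0.
- by rewrite -preimage_bigcup; exact: mcons.
Qed.

HB.instance Definition _ := isMeasure.Build _ _ _ lebesgue_cons
  lebesgue_cons0 lebesgue_cons_ge0 lebesgue_cons_sigma_additive.

Let lebesgue_cons_sigma_finite : sigma_finite setT lebesgue_cons.
Proof.
have [F FT Foo] : sigma_finite setT (lebesgue_measure \x mu)%E.
  have /sigma_finiteP[F [TF ndF Foo]] := sigma_finiteT (@lebesgue_measure R).
  have /sigma_finiteP[G [TG ndG Goo]] := sigma_finiteT mu.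
  exists (fun n => F n `*` G n).
    rewrite -setXTT TF TG predeqE => -[x y]; split; last first.
      by move=> [n _ []/= ? ?]; split; exists n.
    move=> [/= [n _ Fnx] [k _ Gky]]; exists (maxn n k) => //; split.
    - by move: x Fnx; exact/subsetPset/ndF/leq_maxl.
    - by move: y Gky; exact/subsetPset/ndG/leq_maxr.
  move=> k; have [? ?] := Foo k; have [? ?] := Goo k.
  split; first exact: measurableX.
  by rewrite product_measure1E// lte_mul_pinfty// ge0_fin_numE.
pose h (v : 'cV[R]_p.+1) := (v ord0 ord0 : measurableTypeR R, dsubmx (v : 'cV_(1 + p))).
exists (fun k => h @^-1` F k).
  by rewrite -preimage_bigcup -FT preimage_setT.
move=> k; have [mF Fk] := Foo k; split.
  by rewrite -[X in measurable X]setTI; exact: measurable_behead_cV.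
rewrite /lebesgue_cons /pushforward.
rewrite (_ : _ @^-1` _ = F k)//; apply/seteqP.
have hK z : h (cons_cV z) = z.
  case: z => x v; rewrite /h /cons_cV/= col_mxKd; congr pair.
  have e : lshift p (ord0 : 'I_1) = (ord0 : 'I_(1 + p)) by exact: val_inj.
  have := @col_mxEu R 1 p 1 x%:M v ord0 ord0.
  by rewrite [RHS]mxE eqxx mulr1n e.
by split=> z /=; rewrite hK.
Qed.

HB.instance Definition _ := @Measure_isSigmaFinite.Build _ _ _ lebesgue_cons
  lebesgue_cons_sigma_finite.

End lebesgue_cons.

(* Lebesgue measure on R^p: the p-fold product of the Lebesgue measure on R,
   see lebesgue_cV_box. *)
Fixpoint lebesgue_cV p : {sigma_finite_measure set 'cV[R]_p -> \bar R} :=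
  match p with
  | 0 => dirac (0 : 'cV[R]_0)
  | p'.+1 => lebesgue_cons (lebesgue_cV p')
  end.

End lebesgue_cV.

Lemma lebesgue_cV_box (R : realType) p (A : 'I_p -> set R) :
  (forall i, measurable (A i)) ->
  lebesgue_cV p [set v : 'cV[R]_p | forall i, A i (v i ord0)] =
  (\prod_(i < p) lebesgue_measure (A i))%E.
Proof.
elim: p A => [|p ih] A mA.
  rewrite big_ord0 /= diracE mem_set//= => -[] //.
rewrite big_ord_recl -ih//= /lebesgue_cons /pushforward.
rewrite (_ : _ @^-1` _ = A ord0 `*`
    [set v : 'cV[R]_p | forall i, A (lift ord0 i) (v i ord0)]); last first.
  have e0 x v : (cons_cV (x, v) : 'cV[R]_(1 + p)) ord0 ord0 = x.
    have e : lshift p (ord0 : 'I_1) = (ord0 : 'I_(1 + p)) by exact: val_inj.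
    have := @col_mxEu R 1 p 1 x%:M v ord0 ord0.
    by rewrite [RHS]mxE eqxx mulr1n e.
  have eS x (v : 'cV[R]_p) (i : 'I_p) : cons_cV (x, v) (lift ord0 i) ord0 = v i ord0.
    have e : rshift 1 i = lift ord0 i :> 'I_(1 + p) by exact: val_inj.
    by have := @col_mxEd R 1 p 1 x%:M v i ord0; rewrite e.
  apply/seteqP; split=> -[x v] /= => [Av|[A0 Av] i].
    by split=> [|i]; [have := Av ord0; rewrite e0|have := Av (lift ord0 i); rewrite eS].
  by case: (unliftP ord0 i) => [j|] ->; rewrite ?e0 ?eS.
have mB : measurable [set v : 'cV[R]_p | forall i, A (lift ord0 i) (v i ord0)].
  rewrite (_ : mkset _ = \bigcap_(i in [set: 'I_p])
      ((fun v : 'cV[R]_p => v i ord0) @^-1` A (lift ord0 i))); last first.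
    by apply/seteqP; split=> [v Av i _|v Av i]; [exact: Av|exact: (Av i Logic.I)].
  apply: fin_bigcap_measurable => // i _.
  by rewrite -[X in measurable X]setTI; apply: measurable_mx_coord.
rewrite product_measure1E//; exact: (mA ord0).
Qed.

Section euclidean.
Context {R : realType}.

Definition l2norm n (v : 'cV[R]_n) : R := Num.sqrt (\sum_(i < n) v i ord0 ^+ 2).

Definition opnorm m n (A : 'M[R]_(m, n)) : R :=
  sup [set l2norm (A *m v) | v in [set v : 'cV[R]_n | l2norm v <= 1]].

Definition sym_posdef n (S : 'M[R]_n) : Prop :=
  S^T = S /\ forall v : 'cV[R]_n, v != 0 -> 0 < (v^T *m S *m v) ord0 ord0.

Definition cosh (x : R) : R := (expR x + expR (- x)) / 2.

End euclidean.

Section distributions.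
Context {R : realType}.

Definition gaussian_pdf p (m : 'cV[R]_p) (S : 'M[R]_p) (x : 'cV[R]_p) : R :=
  (Num.sqrt ((2 * pi) ^+ p * \det S))^-1 *
  expR (- ((x - m)^T *m invmx S *m (x - m)) ord0 ord0 / 2).

Definition gaussian_prob p (m : 'cV[R]_p) (S : 'M[R]_p) (A : set 'cV[R]_p) : \bar R :=
  (\int[lebesgue_cV p]_(x in A) (gaussian_pdf m S x)%:E)%E.

Definition gamma_fun (b : R) : R :=
  (\int[lebesgue_measure]_(x in `]0%R, +oo[) (x `^ (b - 1) * expR (- x)))%R.

(* Gamma distribution with shape b and unit rate. *)
Definition gamma_prob (b : R) (A : set R) : \bar R :=
  (\int[lebesgue_measure]_(x in A `&` `]0%R, +oo[)
     (x `^ (b - 1) * expR (- x) / gamma_fun b)%:E)%E.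

Definition iid d (T : measurableType d) (P : probability T R)
    (g : nat -> {RV P >-> R}) (law : set R -> \bar R) : Prop :=
  (forall k A, measurable A -> P (g k @^-1` A) = law A) /\
  (forall (s : seq nat) (A : nat -> set R), uniq s ->
    (forall k, measurable (A k)) ->
    P (\bigcap_(k in [set` s]) (g k @^-1` A k)) =
    (\prod_(k <- s) P (g k @^-1` A k))%E).

Definition polya_gamma_sum (c : R) (g : nat -> R) : \bar R :=
  ((2 * pi ^+ 2)^-1%:E * \sum_(1 <= k <oo)
    (g k / ((k%:R - 2^-1) ^+ 2 + c ^+ 2 / (4 * pi ^+ 2)))%:E)%E.

(* The series is extended-real-valued; mu having total mass 1 forces it to be
   finite almost surely. *)
Definition is_polya_gamma (b c : R) (mu : probability R R) : Prop :=
  exists (d : measure_display) (T : measurableType d) (P : probability T R)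
      (g : nat -> {RV P >-> R}),
    iid g (gamma_prob b) /\
    forall A, measurable A ->
      mu A = P [set w | (EFin @` A) (polya_gamma_sum c (fun k => g k w))].

(* nu is the joint law of independent random variables with laws mu i. *)
Definition independent_joint n (mu : 'I_n -> probability R R)
    (nu : probability 'cV[R]_n R) : Prop :=
  forall A : 'I_n -> set R, (forall i, measurable (A i)) ->
    nu [set w | forall i, A i (w i ord0)] = (\prod_(i < n) mu i (A i))%E.

End distributions.

Section markov.
Context {R : realType} {d : measure_display} {T : measurableType d}.

Fixpoint kernel_iter (P : R.-pker T ~> T) (t : nat) : R.-spker T ~> T :=
  match t with
  | 0 => kdirac (@measurable_id _ T setT)
  | t'.+1 => mkcomp_noparam P (kernel_iter P t')
  end.

Definition invariant_measure (P : R.-pker T ~> T) (Pi : probability T R) : Prop :=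
  forall A, measurable A -> (\int[Pi]_x P x A)%E = Pi A.

Local Open Scope ereal_scope.

Definition tv_dist (mu nu : {measure set T -> \bar R}) : \bar R :=
  ereal_sup [set `|\int[mu]_x (f x)%:E - \int[nu]_x (f x)%:E| | f in
    [set f : T -> R | measurable_fun setT f /\ forall x, (0 <= f x <= 1)%R]].

(* Since +oo - +oo = -oo in \bar R, an f that is not integrable for one of the
   measures contributes +oo to the supremum. *)
Definition weighted_dist (W : T -> R) (mu nu : {measure set T -> \bar R}) : \bar R :=
  ereal_sup [set `|\int[mu]_x (f x)%:E - \int[nu]_x (f x)%:E| | f in
    [set f : T -> R | measurable_fun setT f /\ forall x, (`|f x| <= W x)%R]].

Definition coupling (mu nu : {measure set T -> \bar R})
    (G : probability (T * T)%type R) : Prop :=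
  forall A, measurable A -> G (A `*` setT) = mu A /\ G (setT `*` A) = nu A.

Definition wasserstein (dist : T -> T -> R) (mu nu : {measure set T -> \bar R}) :
    \bar R :=
  ereal_inf [set \int[G]_z (dist z.1 z.2)%:E | G in
    [set G : probability (T * T)%type R | coupling mu nu G]].

Definition hyper_uniformly_ergodic (P : R.-pker T ~> T) (Pi : probability T R)
    (V : T -> R) : Prop :=
  invariant_measure P Pi /\
  exists alpha K' : R, [/\ (0 < alpha < 1)%R, (0 < K')%R &
    forall (x : T) (t : nat), (1 <= t)%N ->
      tv_dist (kernel_iter P (2 * t) x) Pi <= ((1 - alpha) ^+ t)%:E /\
      weighted_dist (fun z => 1 + V z)%R (kernel_iter P (2 * t + 1) x) Pi
        <= (2 * (1 + K') * (1 - alpha) ^+ t)%:E].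

End markov.

Section rates.
Context {R : realType}.

Definition lambda_disc (gamma alpha : R) : R :=
  Num.sqrt ((1 - Num.min gamma alpha) ^+ 2
            + 4 * Num.min gamma alpha * (1 - Num.max alpha gamma)).

Definition lambda_plus (gamma alpha : R) : R :=
  (1 - Num.min gamma alpha + lambda_disc gamma alpha) / 2.

Definition lambda_minus (gamma alpha : R) : R :=
  (1 - Num.min gamma alpha - lambda_disc gamma alpha) / 2.

Definition rho (t : nat) (gamma alpha : R) : R :=
  ((1 - lambda_minus gamma alpha) * lambda_plus gamma alpha ^+ t
   - (1 - lambda_plus gamma alpha) * lambda_minus gamma alpha ^+ t)
  / (lambda_plus gamma alpha - lambda_minus gamma alpha).

End rates.

Section logistic.
Context {R : realType} {n p : nat}.
Variables (X : 'M[R]_(n, p)) (y : 'I_n -> bool) (m0 : 'cV[R]_p) (S0 : 'M[R]_p).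

(* The binary responses are booleans, coerced to 0 or 1; the rows of X
   are the transposed covariates, so that x_i^T beta is (X *m beta) i ord0. *)
Definition kappa : 'cV[R]_n := \col_i ((y i)%:R - 2^-1).

Definition likelihood (beta : 'cV[R]_p) : R :=
  \prod_(i < n) (expR ((y i)%:R * (X *m beta) i ord0)
                 / (1 + expR ((X *m beta) i ord0))).

(* Lebesgue density proportional to likelihood times prior density; Z is the
   normalizing constant. *)
Definition is_posterior (Pi : probability 'cV[R]_p R) : Prop :=
  exists2 Z : R, 0 < Z & forall A, measurable A ->
    Pi A = (\int[lebesgue_cV p]_(beta in A)
              (likelihood beta * gaussian_pdf m0 S0 beta / Z)%:E)%E.

Definition Sigma_omega (omega : 'cV[R]_n) : 'M[R]_p :=
  invmx (X^T *m diag_mx omega^T *m X + invmx S0).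

Definition m_omega (omega : 'cV[R]_n) : 'cV[R]_p :=
  Sigma_omega omega *m (X^T *m kappa + invmx S0 *m m0).

(* Law of the next state: the omega_i are drawn independently from
   PG(1, x_i^T beta), then the new state from N(m_omega, Sigma_omega). *)
Definition is_pg_kernel (P : R.-pker 'cV[R]_p ~> 'cV[R]_p) : Prop :=
  forall beta : 'cV[R]_p,
    exists (mu : 'I_n -> probability R R) (nu : probability 'cV[R]_n R),
      [/\ forall i, is_polya_gamma 1 ((X *m beta) i ord0) (mu i),
          independent_joint mu nu &
          forall A, measurable A -> P beta A =
            (\int[nu]_omega gaussian_prob (m_omega omega) (Sigma_omega omega) A)%E].

End logistic.

(* Main.v *)
From HB Require Import structures.
From mathcomp Require Import all_boot all_order all_algebra.
From mathcomp Require Import all_classical all_reals all_analysis.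
From mathcomp Require Import measurable_realfun ring lra.
Require Import Defs.

Set Implicit Arguments.
Unset Strict Implicit.
Unset Printing Implicit Defensive.

Import Order.TTheory GRing.Theory Num.Theory.
Import numFieldNormedType.Exports.

Local Open Scope classical_set_scope.
Local Open Scope ring_scope.

(** The chain is uniformly ergodic because every step brings it back, with a
probability that does not depend on the current state, to a ball on which all
transition laws share a common component.

Return to the ball. The Polya-Gamma variables are nonnegative, so the
precision X^T Omega X + S0^-1 of the Gaussian step dominates S0^-1, whatever
they are. Hence the mean of that step has norm at most
opnorm S0 * l2norm (X^T kappa + S0^-1 m0) and its covariance has trace at most
tr S0, so that the second moment of every transition law is at most K
([pg_kernel_drift]). By Markov's inequality the ball C = {V <= r K} has
probability at least gamma = 1 - 1/r after one step from any state.

Common component. PG(1, c) has density cosh(c/2) exp(-c^2 x / 2) with respect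
to PG(1, 0) ([is_polya_gamma_tilt]). Here is why: cosh(c/2) is the product of
factors 1 + theta_k such that rescaling the exponential variable g_k by
1 + theta_k turns the series of PG(1, c) into the series S of PG(1, 0), and
c^2/2 S = sum_k theta_k g_k. Under the probability weighted by the product of
the (1 + theta_k) exp(- theta_k g_k), which is cosh(c/2) exp(- c^2/2 S), the
rescaled variables (1 + theta_k) g_k are again independent exponential
variables, so S has law PG(1, c). Thus all transition laws are mixtures of the same
Gaussians, with a weight that is a product of such densities
([pg_kernel_mixture]). On C the linear predictors satisfy |x_i^T beta| <= C_i
with C_i = |x_i| sqrt(r K), so the weight is at least the product of the
exp(-C_i^2 omega_i / 2), whose integral under PG(1, 0) is the Laplace
transform 1 / cosh(C_i / 2); the product of these is the mass epsilon of the
common component ([pg_kernel_minorization]).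

Rate. For f with values in [0, 1], let u_t and v_t bound the oscillation of
P^t f over the whole space and over C. A step from any state charges C with
mass at least gamma. From a state of C the common component cancels in
differences, and of the remaining mass 1 - epsilon at least
(gamma - epsilon)^+ lies in C. This gives a two-dimensional linear recursion
([iterate_fun_range]) whose characteristic roots are lambda_+ and lambda_-,
and u_t is rho_t ([rho_osc_rate]). As rho_(t+2) is a combination of rho_(t+1)
and rho_t and rho decreases, two steps gain a factor 1 - gamma * epsilon
([rho_even_le]), which for r = 2 is hyper-V uniform ergodicity.

Other distances. P maps functions dominated by 1 + V to functions bounded by
1 + K, so one more step turns a total variation bound into a weighted one
([weighted_dist_le]). The coupling that keeps the common mass of two laws in
place and moves the positive part of their difference onto the negative part
costs at most their distance weighted by 1 + V, because
l2norm (u - v) <= (1 + V u) + (1 + V v) ([wasserstein_le_weighted]).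

Invariance. Completing the square in the joint weight of a state and its
Polya-Gamma variables shows that, given these variables, the posterior turns
into the Gaussian from which the next state is drawn
([posterior_conjugacy]); Tonelli's theorem then gives the invariance of the
posterior ([pg_kernel_invariant]). *)

(** * Densities, image measures and independent products *)

Section density.
Context d (T : measurableType d) (R : realType).
Local Open Scope ereal_scope.
Import HBNNSimple.

(** Approximating g by simple functions reduces the claim to indicators, for which it
is the hypothesis on nu. *)
Lemma integral_density (mu nu : {measure set T -> \bar R}) (f : T -> R)
    (g : T -> \bar R) :
  measurable_fun setT f -> (forall x, 0 <= f x)%R ->
  (forall A, measurable A -> nu A = \int[mu]_(x in A) (f x)%:E) ->
  measurable_fun setT g -> (forall x, 0 <= g x) ->
  \int[nu]_x g x = \int[mu]_x (g x * (f x)%:E).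
Proof.
move=> mf f0 nuE mg g0.
have mEf : measurable_fun setT (EFin \o f) by exact/measurable_EFinP.
pose h := nnsfun_approx measurableT mg.
have -> : \int[nu]_x g x = lim (\int[nu]_x (EFin \o h n) x @[n --> \oo]).
  have gE x : g x = lim ((EFin \o h n) x @[n --> \oo]).
    by apply/esym/cvg_lim => //; exact: cvg_nnsfun_approx.
  under eq_integral => x _ do rewrite gE.
  apply: monotone_convergence => //.
  - by move=> n; exact/measurable_EFinP.
  - by move=> n x Ex //=; rewrite lee_fin.
  - by move=> x Ex a b ab; rewrite lee_fin; exact/lefP/nd_nnsfun_approx.
have -> : \int[mu]_x (g x * (f x)%:E) =
    lim (\int[mu]_x ((EFin \o h n) x * (f x)%:E) @[n --> \oo]).
  have gE x : g x * (f x)%:E = lim (((EFin \o h n) x * (f x)%:E) @[n --> \oo]).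
    apply/esym/cvg_lim => //; apply: cvgeZr => //.
    exact: cvg_nnsfun_approx.
  under eq_integral => x _ do rewrite gE.
  apply: monotone_convergence => //.
  - by move=> n; apply: emeasurable_funM => //; exact/measurable_EFinP.
  - by move=> n x Ex /=; rewrite mule_ge0 ?lee_fin.
  - move=> x Ex a b ab/=; rewrite lee_wpmul2r ?lee_fin//.
    exact/lefP/nd_nnsfun_approx.
congr (lim (_ @ \oo)); apply/funext => n.
transitivity (\int[nu]_x
   (\sum_(y \in range (h n)) (y * \1_(h n @^-1` [set y]) x)%:E)).
  by apply: eq_integral => t tE; rewrite /= fimfunE -fsumEFin.
have indich m r : measurable_fun setT (fun x => (r * \1_(h m @^-1` [set r]) x)%:E).
  by apply/measurable_EFinP/measurable_funM.
rewrite ge0_integral_fsum//; last by move=> m y Ey; exact: nnfun_muleindic_ge0.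
transitivity (\int[mu]_x (\sum_(y \in range (h n))
    ((y * \1_(h n @^-1` [set y]) x)%:E * (f x)%:E))); last first.
  apply: eq_integral => x _; rewrite -ge0_mule_fsuml => [|y].
    by rewrite fsumEFin// /= fimfunE.
  exact: nnfun_muleindic_ge0.
rewrite ge0_integral_fsum//; last 2 first.
  - by move=> y; apply: emeasurable_funM.
  - by move=> m y Ey; rewrite mule_ge0 ?lee_fin ?f0// -lee_fin nnfun_muleindic_ge0.
apply: eq_fsbigr => r /[!inE] -[t _ <-{r}].
set B := h n @^-1` _.
have mB : measurable B by exact: measurable_funPTI.
have h0 : (0 <= h n t)%R by [].
under eq_integral => x _ do rewrite EFinM.
have mI : measurable_fun setT (fun x => (\1_B x)%:E : \bar R).
  by apply/measurable_EFinP.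
have I0 x : 0 <= (\1_B x)%:E :> \bar R by rewrite lee_fin.
rewrite ge0_integralZl//.
under [RHS]eq_integral => x _ do rewrite EFinM -muleA.
rewrite ge0_integralZl//; last 2 first.
- exact: emeasurable_funM.
- by move=> x _; rewrite mule_ge0 ?lee_fin.
congr (_ * _).
rewrite integral_indic// setIT nuE// integral_mkcond.
by apply: eq_integral => x _; rewrite epatch_indic muleC.
Qed.

End density.

Section density_measure.
Context d (T : measurableType d) (R : realType) (mu : {measure set T -> \bar R}).
Variables (f : T -> R) (mf : measurable_fun setT f) (f0 : forall x, 0 <= f x).
Local Open Scope ereal_scope.

(** The proofs are arguments of the definition so that the measure structure can be
attached to the function: without them nonnegativity and countable additivity fail. *)
Definition density_measure of measurable_fun setT f & (forall x, (0 <= f x)%R) :=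
  fun A => \int[mu]_(x in A) (f x)%:E.

Local Notation nu := (density_measure mf f0).

Let nu0 : nu set0 = 0. Proof. exact: integral_set0. Qed.

Let nu_ge0 A : 0 <= nu A.
Proof. by apply: integral_ge0 => x _; rewrite lee_fin. Qed.

Let nu_sigma_additive : semi_sigma_additive nu.
Proof.
move=> F mF tF mUF; rewrite /density_measure ge0_integral_bigcup//=.
- apply: is_cvg_nneseries => n _ _.
  by apply: integral_ge0 => x _; rewrite lee_fin.
- by apply/measurable_funTS/measurable_EFinP.
- by move=> x _; rewrite lee_fin.
Qed.

HB.instance Definition _ := isMeasure.Build _ _ _ nu nu0 nu_ge0 nu_sigma_additive.

End density_measure.

Section image_measure.
Context d1 d2 (T1 : measurableType d1) (T2 : measurableType d2) (R : realType).
Variables (mu : {measure set T1 -> \bar R}) (phi : T1 -> T2).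
Hypothesis mphi : measurable_fun setT phi.
Local Open Scope ereal_scope.

Definition image_measure : {measure set T2 -> \bar R} :=
  measure_function_pushforward__canonical__measure_function_Measure mu mphi.

Lemma image_measureE A : image_measure A = mu (phi @^-1` A).
Proof. by []. Qed.

Lemma ge0_integral_image_measure (f : T2 -> \bar R) :
  measurable_fun setT f -> (forall y, 0 <= f y) ->
  \int[image_measure]_y f y = \int[mu]_x f (phi x).
Proof.
by move=> mf f0; rewrite ge0_integral_pushforward// preimage_setT.
Qed.

End image_measure.

Section independence.
Context d (T : measurableType d) (R : realType) (P : probability T R).
Variables (I : eqType) (g : I -> T -> R).
Local Open Scope ereal_scope.

Definition independent_family := forall (s : seq I) (A : I -> set R), uniq s ->
  (forall k, measurable (A k)) ->
  P (\bigcap_(k in [set` s]) (g k @^-1` A k)) =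
  \prod_(k <- s) P (g k @^-1` A k).

Hypothesis mg : forall i, measurable_fun setT (g i).
Hypothesis indep : independent_family.

(** The functions of the second product replace indicators one at a time: as a function of
the set in which g j is required to lie, the induction hypothesis identifies two measures on
the line, and then f j is integrated against both. *)
Lemma independent_integral_prod_indic (s s' : seq I) (A : I -> set R) (f : I -> R -> R) :
  uniq (s ++ s') -> (forall k, measurable (A k)) ->
  (forall k, measurable_fun setT (f k)) -> (forall k x, 0 <= f k x)%R ->
  (forall k, \int[P]_w (f k (g k w))%:E < +oo) ->
  \int[P]_w (\prod_(k <- s) \1_(A k) (g k w) * \prod_(k <- s') f k (g k w))%:E =
  \prod_(k <- s) P (g k @^-1` A k) * \prod_(k <- s') \int[P]_w (f k (g k w))%:E.
Proof.
move=> + + mf f0 foo; elim: s' s A => [|j s' ih] s A.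
  rewrite cats0 => us mA; rewrite big_nil mule1 -indep//.
  under eq_integral => w _ do rewrite big_nil mulr1.
  have mB : measurable (\bigcap_(k in [set` s]) (g k @^-1` A k)).
    apply: fin_bigcap_measurable => // i _.
    by rewrite -[X in measurable X]setTI; exact: mg.
  rewrite -(setIT (\bigcap_(_ in _) _)) -integral_indic//.
  apply: eq_integral => w _; congr EFin; rewrite indicE.
  elim: s {us mB} => [|i s ih].
    by rewrite big_nil mem_set.
  rewrite big_cons ih indicE -natrM mulnb; congr (_%:R : R); congr nat_of_bool.
  apply/andP/idP => [[/set_mem Ai /set_mem As]|/set_mem As].
    rewrite mem_set// => k /=; rewrite inE => /orP[/eqP->//|ks]; exact: As.
  by split; apply/mem_set; [apply: As; rewrite /= mem_head|
    move=> k /= ks; apply: As; rewrite /= inE ks orbT].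
move=> us mA.
have us1 : uniq ((j :: s) ++ s') by move: us; rewrite -[j :: s']/([:: j] ++ s') uniq_catCA.
have us0 : uniq (s ++ s').
  by move: us1 => /= /andP[].
have js : j \notin s.
  by move: us1; rewrite /= mem_cat negb_or => /andP[/andP[]].
pose F w := (\prod_(k <- s) \1_(A k) (g k w) * \prod_(k <- s') f k (g k w))%R.
have F0 w : (0 <= F w)%R by rewrite mulr_ge0// prodr_ge0.
have mF : measurable_fun setT F.
  apply: measurable_funM; apply: measurable_prod => i _.
    have mI : measurable_fun setT (\1_(A i) : R -> R) by exact: measurable_indic.
    exact: (measurableT_comp mI (mg i)).
  exact: (measurableT_comp (mf i) (mg i)).
set c := \prod_(k <- s) P (g k @^-1` A k) * \prod_(k <- s') \int[P]_w (f k (g k w))%:E.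
have c0 : 0 <= c.
  rewrite mule_ge0// prode_ge0// => i _; apply: integral_ge0 => w _.
  by rewrite lee_fin.
have cfin : c \is a fin_num.
  rewrite fin_numM// prode_fin_num// => i _.
  - by rewrite fin_num_measure// -[X in measurable X]setTI; exact: mg.
  - by rewrite ge0_fin_numE//; apply: integral_ge0 => w _; rewrite lee_fin.
have fc0 : (0 <= fine c)%R by rewrite fine_ge0.
(* Both sides, as functions of the set B in which g j lies, are measures on the line. *)
pose m1 := image_measure (density_measure P mF F0) (mg j).
pose m2 : {measure set _ -> \bar R} := mscale (NngNum fc0) (image_measure P (mg j)).
have m12 B : measurable B -> m1 B = m2 B.
  move=> mB; rewrite /m1 /m2 /= /mscale/= fineK// /pushforward/=.
  have mgB : measurable (g j @^-1` B) by rewrite -[X in measurable X]setTI; exact: mg.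
  rewrite /density_measure integral_mkcond.
  pose A' k := if k == j then B else A k.
  have eA' k : k \in s -> A' k = A k.
    by move=> ks; rewrite /A'; case: eqP => // kj; rewrite kj (negbTE js) in ks.
  transitivity (\int[P]_w (\prod_(k <- j :: s) \1_(A' k) (g k w) *
      \prod_(k <- s') f k (g k w))%:E).
    apply: eq_integral => w _; rewrite epatch_indic/= -EFinM; congr EFin.
    rewrite big_cons {1}/A' eqxx mulrC -mulrA; congr (_ * _)%R.
    rewrite /F; congr (_ * _)%R; rewrite [LHS]big_seq [RHS]big_seq.
    by apply: eq_bigr => k ks; rewrite eA'.
  rewrite ih//; last by move=> k; rewrite /A'; case: eqP.
  rewrite big_cons {1}/A' eqxx muleC muleCA [RHS]muleC; congr (_ * _).
  rewrite muleC; congr (_ * _).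
  rewrite [LHS]big_seq [RHS]big_seq.
  by apply: eq_bigr => k ks; rewrite eA'.
rewrite big_cons muleCA -/c.
transitivity (\int[P]_w ((f j (g j w))%:E * (F w)%:E)).
  by apply: eq_integral => w _; rewrite big_cons -EFinM; congr EFin; rewrite /F mulrCA.
have mfj : measurable_fun setT (EFin \o f j) by exact/measurable_EFinP.
have f0j y : 0 <= (EFin \o f j) y by rewrite /= lee_fin.
have mfg : measurable_fun setT (EFin \o (f j \o g j)).
  by apply/measurable_EFinP; exact: (measurableT_comp (mf j) (mg j)).
have /= <- := @integral_density _ _ _ P (density_measure P mF F0) F _ mF F0
  (fun _ _ => erefl) mfg (fun w => f0j (g j w)).
have /= <- := ge0_integral_image_measure (density_measure P mF F0) (mg j) mfj f0j.
rewrite (@eq_measure_integral _ _ _ _ m2); last by move=> B mB _; exact: m12.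
rewrite /m2 ge0_integral_mscale//=; last by move=> x _; exact: f0j.
by rewrite fineK// muleC ge0_integral_image_measure.
Qed.

Lemma independent_integral_prod (s : seq I) (f : I -> R -> R) :
  uniq s ->
  (forall k, measurable_fun setT (f k)) -> (forall k x, 0 <= f k x)%R ->
  (forall k, \int[P]_w (f k (g k w))%:E < +oo) ->
  \int[P]_w (\prod_(k <- s) f k (g k w))%:E =
  \prod_(k <- s) \int[P]_w (f k (g k w))%:E.
Proof.
move=> us mf f0 foo.
have := @independent_integral_prod_indic [::] s (fun=> setT) f us
  (fun=> measurableT) mf f0 foo.
rewrite big_nil mul1e => <-.
by apply: eq_integral => w _; rewrite big_nil mul1r.
Qed.

End independence.

(** * The infinite product of the hyperbolic cosine *)

Section cosh_product.
Context {R : realType}.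
Implicit Types x v w : R.

(** The form in which monotonicity is used for all the elementary inequalities below. *)
Lemma ge0_of_derive (f df : R -> R) (b : R) :
  (forall x, is_derive x 1 f (df x)) -> (forall x, 0 <= x <= b -> 0 <= df x) ->
  0 <= f 0 -> forall x, 0 <= x <= b -> 0 <= f x.
Proof.
move=> fdf df0 f0 x /andP[x0 xb]; apply: (le_trans f0).
have fc : continuous f.
  by move=> z; apply/differentiable_continuous/derivable1_diffP; apply: ex_derive.
apply: (@ger0_derive1_ndecr _ f 0 b) => //.
- move=> z; rewrite in_itv/= => /andP[z0 zb].
  by rewrite derive1E (derive_val (is_derive := fdf z)) df0// !ltW.
- exact: continuous_subspaceT.
Qed.

Definition sinh x : R := (expR x - expR (- x)) / 2.

Lemma is_derive_expRN x : is_derive x 1 (fun z => expR (- z)) (- expR (- x)).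
Proof.
have h : is_derive x 1 (-%R : R -> R) (-1) by exact: is_deriveN.
have := is_derive1_comp (is_derive_expR (- x)) h.
by move=> ?; apply: is_derive_eq; rewrite mulrN1.
Qed.

Lemma is_derive_sinh x : is_derive x 1 sinh (cosh x).
Proof.
have h := is_derive_expRN x.
have -> : sinh = (2^-1 \*: (expR - (fun z => expR (- z)))) :> (R -> R).
  by apply/funext => z; rewrite /sinh !fctE/= mulrC.
apply: is_derive_eq; rewrite /cosh opprK /GRing.scale/=; exact: mulrC.
Qed.

Lemma is_derive_cosh x : is_derive x 1 cosh (sinh x).
Proof.
have h := is_derive_expRN x.
have -> : cosh = (2^-1 \*: (expR + (fun z => expR (- z)))) :> (R -> R).
  by apply/funext => z; rewrite /cosh !fctE/= mulrC.
apply: is_derive_eq; rewrite /sinh /GRing.scale/=; exact: mulrC.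
Qed.

Lemma cosh0 : cosh 0 = 1 :> R.
Proof. by rewrite /cosh oppr0 expR0; lra. Qed.

Lemma sinh0 : sinh 0 = 0 :> R.
Proof. by rewrite /sinh oppr0 expR0; lra. Qed.

Lemma coshN x : cosh (- x) = cosh x.
Proof. by rewrite /cosh opprK addrC. Qed.

Lemma sinhN x : sinh (- x) = - sinh x.
Proof. by rewrite /sinh opprK -mulNr opprB. Qed.

Lemma cosh_ge1 x : 1 <= cosh x.
Proof.
rewrite /cosh; have := expR_ge1Dx x; have := expR_ge1Dx (- x); lra.
Qed.

Lemma cosh_gt0 x : 0 < cosh x.
Proof. exact: lt_le_trans (cosh_ge1 x). Qed.

Lemma cosh2sinh2 x : cosh x ^+ 2 = 1 + sinh x ^+ 2.
Proof.
rewrite -(expRxMexpNx_1 x) /cosh /sinh; by field.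
Qed.

Lemma cosh_double x : cosh (x *+ 2) = cosh x ^+ 2 *+ 2 - 1.
Proof.
rewrite -(expRxMexpNx_1 x) /cosh -mulNrn [x *+ 2]mulr2n [- x *+ 2]mulr2n !expRD.
by field.
Qed.

Lemma sinh_ge x : 0 <= x -> x <= sinh x.
Proof.
move=> x0; rewrite -subr_ge0.
have fdf (z : R) : is_derive z 1 (sinh - id : R -> R) (cosh z - 1).
  by have := is_derive_sinh z => h; exact: is_deriveB.
apply: (ge0_of_derive fdf (b := x)).
- by move=> z _; rewrite subr_ge0 cosh_ge1.
- by rewrite !fctE/= sinh0 subrr.
- by rewrite x0/=.
Qed.

Lemma sinh_le_mul_cosh x : 0 <= x -> sinh x <= x * cosh x.
Proof.
move=> x0; rewrite -subr_ge0.
have fdf (z : R) : is_derive z 1 (id * cosh - sinh : R -> R) (z * sinh z).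
  have h1 := is_derive_sinh z; have h2 := is_derive_cosh z.
  apply: is_derive_eq; rewrite /GRing.scale/=; ring.
have f0 : 0 <= (id * cosh - sinh : R -> R) 0.
  by rewrite !fctE/= sinh0 mul0r subrr.
apply: (ge0_of_derive fdf (b := x) _ f0); last by rewrite x0/=.
move=> z /andP[z0 _].
by rewrite mulr_ge0// (le_trans z0)// sinh_ge.
Qed.

Lemma sin_le x : 0 <= x -> sin x <= x.
Proof.
move=> x0; rewrite -subr_ge0.
have fdf (z : R) : is_derive z 1 (id - sin : R -> R) (1 - cos z) by exact: is_deriveB.
apply: (ge0_of_derive fdf (b := x)).
- by move=> z _; rewrite subr_ge0 cos_le1.
- by rewrite !fctE/= sin0 subrr.
- by rewrite x0/=.
Qed.

Lemma mul_cos_le_sin x : 0 <= x <= pi -> x * cos x <= sin x.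
Proof.
move=> xp; rewrite -subr_ge0.
have fdf (z : R) : is_derive z 1 (sin - id * cos : R -> R) (z * sin z).
  apply: is_derive_eq; rewrite /GRing.scale/=; ring.
have f0 : 0 <= (sin - id * cos : R -> R) 0.
  by rewrite !fctE/= sin0 mul0r subrr.
apply: (ge0_of_derive fdf (b := pi) _ f0) => //.
move=> z /andP[z0 zp].
by rewrite mulr_ge0// sin_ge0_pi// z0 zp.
Qed.

(** The positive zeros of the cosine, that is, the zeros of cosh divided by the imaginary
unit. *)
Definition half_odd_pi (k : nat) : R := (k%:R + 2^-1) * pi.
Local Notation a := half_odd_pi.

Lemma half_odd_pi_gt0 k : 0 < a k.
Proof. by rewrite mulr_gt0 ?pi_gt0// ltr_wpDl. Qed.

Lemma half_odd_pi_lt m k : (k < m)%N -> a k / m%:R < pi.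
Proof.
move=> km; rewrite ltr_pdivrMr ?ltr0n ?(leq_ltn_trans _ km)//.
rewrite [ltRHS]mulrC ltr_pM2r ?pi_gt0//.
have : k.+1%:R <= m%:R :> R by rewrite ler_nat.
by rewrite -natr1; lra.
Qed.

(** Up to a constant, the factorization of cosh x obtained by applying N times the
half-argument formula cosh (2 z) - cos (2 w) = 2 (cosh z - cos w) (cosh z + cos w). *)
Definition cosh_factors N x : R :=
  \prod_(k < 2 ^ N) (cosh (x / (2 ^ N)%:R) - cos (a k / (2 ^ N)%:R)).

Lemma cosh_sub_cos x v :
  (cosh (x / 2) - cos (v / 2)) * (cosh (x / 2) + cos (v / 2)) =
  (cosh x - cos v) / 2.
Proof.
have -> : cosh x = cosh ((x / 2) *+ 2) by rewrite -mulr_natr divfK.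
have -> : cos v = cos ((v / 2) *+ 2) by rewrite -mulr_natr divfK.
by rewrite cosh_double cos_mulr2n; field.
Qed.

(** The half-argument formula splits each factor in two; the second half of the factors
appears in reversed order because - cos w = cos (pi - w). *)
Lemma cosh_factorsS N x :
  cosh_factors N.+1 x = cosh_factors N x / 2 ^+ (2 ^ N).
Proof.
have n0 : (2 ^ N)%:R != 0 :> R by rewrite pnatr_eq0 expn_eq0.
have xE (z : R) : z / (2 ^ N.+1)%:R = z / (2 ^ N)%:R / 2.
  by rewrite expnS natrM invfM mulrA mulrAC.
rewrite /cosh_factors.
transitivity (\prod_(k < 2 ^ N + 2 ^ N)
    (cosh (x / (2 ^ N.+1)%:R) - cos (a k / (2 ^ N.+1)%:R))).
  by rewrite -!(big_mkord xpredT (fun k => cosh _ - cos (a k / _))) addnn -mul2n expnS.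
rewrite big_split_ord/=.
rewrite [X in _ * X](reindex_inj rev_ord_inj)/= -big_split/=.
have -> : 2 ^+ (2 ^ N) = \prod_(k < 2 ^ N) (2 : R).
  by rewrite prodr_const card_ord.
rewrite -prodf_div; apply: eq_bigr => k _.
rewrite -cosh_sub_cos -!xE; congr (_ * _).
have -> : a (2 ^ N + (2 ^ N - k.+1)) / (2 ^ N.+1)%:R = pi - a k / (2 ^ N.+1)%:R.
  rewrite addnBA; last exact: ltn_ord.
  rewrite addnn -mul2n -expnS /half_odd_pi natrB; last first.
    by rewrite (leq_trans (ltn_ord k))// leq_exp2l.
  rewrite -natr1; have : (2 ^ N.+1)%:R != 0 :> R by rewrite pnatr_eq0 expn_eq0.
  by move=> n1; field.
by rewrite cosB cospi sinpi mul0r addr0 mulN1r opprK.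
Qed.

Lemma cosh_factorsE N x : cosh x = cosh_factors N x / cosh_factors N 0.
Proof.
elim: N => [|N ih].
  rewrite /cosh_factors !big_ord1 /= expn0 !divr1.
  have -> : a 0 = pi / 2 by rewrite /half_odd_pi add0r mulrC.
  by rewrite cos_pihalf !subr0 cosh0 divr1.
rewrite ih !cosh_factorsS -mulf_div divff ?mulr1// invr_eq0 expf_neq0.
Qed.

Lemma one_sub_cos_gt0 v : 0 < v < pi -> 0 < 1 - cos v.
Proof.
move=> /andP[v0 vp]; rewrite subr_gt0 -cos0 ltr_cos// in_itv/=.
  by rewrite lexx pi_ge0.
by rewrite !ltW.
Qed.

(** A finite product formula, exact for each N, whose factors tend to those of the infinite
product; comparing them one by one avoids complex analysis. *)
Lemma cosh_prodE N x : cosh x = \prod_(k < 2 ^ N)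
  (1 + (cosh (x / (2 ^ N)%:R) - 1) / (1 - cos (a k / (2 ^ N)%:R))).
Proof.
rewrite (cosh_factorsE N) /cosh_factors -prodf_div; apply: eq_bigr => k _.
rewrite mul0r cosh0.
have h : 0 < 1 - cos (a k / (2 ^ N)%:R).
  by rewrite one_sub_cos_gt0// divr_gt0 ?half_odd_pi_gt0 ?half_odd_pi_lt// ltr0n expn_gt0.
by have := lt0r_neq0 h => h'; field.
Qed.

Lemma cosh_sub1 x : cosh x - 1 = sinh (x / 2) ^+ 2 *+ 2.
Proof.
have -> : cosh x = cosh ((x / 2) *+ 2) by rewrite -mulr_natr divfK.
by rewrite cosh_double cosh2sinh2; ring.
Qed.

Lemma one_sub_cos v : 1 - cos v = sin (v / 2) ^+ 2 *+ 2.
Proof.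
have -> : cos v = cos ((v / 2) *+ 2) by rewrite -mulr_natr divfK.
by rewrite cos_mulr2n cos2sin2; ring.
Qed.

Lemma sqr_le_sinh x : x ^+ 2 <= sinh x ^+ 2.
Proof.
wlog x0 : x / 0 <= x => [h|].
  have [/h//|/ltW x0] := leP 0 x.
  by rewrite -(sqrrN x) -(sqrrN (sinh x)) -sinhN h// oppr_ge0.
by rewrite ler_sqr ?nnegrE ?sinh_ge// (le_trans x0) ?sinh_ge.
Qed.

Lemma sinh_le_sqr x : sinh x ^+ 2 <= x ^+ 2 * cosh x ^+ 2.
Proof.
wlog x0 : x / 0 <= x => [h|].
  have [/h//|/ltW x0] := leP 0 x.
  by rewrite -(sqrrN x) -(sqrrN (sinh x)) -sinhN -[cosh x]coshN h// oppr_ge0.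
have sh0 : 0 <= sinh x by rewrite (le_trans x0) ?sinh_ge.
have ch0 : 0 <= x * cosh x by rewrite mulr_ge0// ltW// cosh_gt0.
by rewrite -exprMn ler_sqr ?nnegrE ?sinh_le_mul_cosh.
Qed.

(** By cosh x - 1 = 2 sinh^2 (x/2) and 1 - cos v = 2 sin^2 (v/2), it suffices to know
that sinh z >= z and sin z <= z. *)
Lemma cosh_factor_ge x v : 0 < v < pi ->
  1 + x ^+ 2 / v ^+ 2 <= 1 + (cosh x - 1) / (1 - cos v).
Proof.
move=> /andP[v0 vp]; rewrite lerD2l.
have h := one_sub_cos_gt0 (introT andP (conj v0 vp)).
have sv : sin (v / 2) ^+ 2 <= (v / 2) ^+ 2.
  have v2 : 0 <= v / 2 <= pi by lra.
  rewrite ler_sqr ?nnegrE ?sin_ge0_pi ?sin_le//; by case/andP: v2.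
rewrite ler_pdivlMr// mulrAC ler_pdivrMr ?exprn_gt0//.
have := sqr_le_sinh (x / 2); rewrite cosh_sub1 one_sub_cos => sx.
have v20 : 0 <= v ^+ 2 by rewrite sqr_ge0.
have x20 : 0 <= x ^+ 2 by rewrite sqr_ge0.
rewrite [(v / 2) ^+ 2]expr_div_n in sv; rewrite [(x / 2) ^+ 2]expr_div_n in sx.
set A := sin _ ^+ 2 in sv *; set B := sinh _ ^+ 2 in sx *.
nra.
Qed.

(** The opposite comparison, from sinh z <= z cosh z and z cos z <= sin z. The loss is a
factor cosh^2 (x/2), which is harmless when it is applied to x / 2^N. *)
Lemma cosh_factor_le x v : 0 < v < pi ->
  1 + (cosh x - 1) / (1 - cos v) <= cosh (x / 2) ^+ 2 * (1 + x ^+ 2 / v ^+ 2).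
Proof.
move=> /andP[v0 vp].
have h := one_sub_cos_gt0 (introT andP (conj v0 vp)).
have v2 : 0 <= v / 2 <= pi by lra.
have cv : 0 <= cos (v / 2) by apply: cos_ge0_pihalf; lra.
have sv : (v / 2) ^+ 2 * cos (v / 2) ^+ 2 <= sin (v / 2) ^+ 2.
  rewrite -exprMn ler_sqr ?nnegrE ?sin_ge0_pi ?mul_cos_le_sin// mulr_ge0//.
  by case/andP: v2.
have := sinh_le_sqr (x / 2) => sx.
have v20 : 0 < v ^+ 2 by rewrite exprn_gt0.
have cc := cosh2sinh2 (x / 2).
have cs := cos2Dsin2 (v / 2).
rewrite cosh_sub1 one_sub_cos in h *.
have s0 : 0 < sin (v / 2) ^+ 2 by move: h; rewrite pmulrn_lgt0.
have -> : sinh (x / 2) ^+ 2 *+ 2 / (sin (v / 2) ^+ 2 *+ 2) =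
    sinh (x / 2) ^+ 2 / sin (v / 2) ^+ 2.
  rewrite -[X in X / _]mulr_natr -[X in _ / X]mulr_natr -mulf_div.
  by rewrite divff ?mulr1// pnatr_eq0.
rewrite mulrDr mulr1 {1}cc -addrA lerD2l.
rewrite ler_pdivrMr//.
have sE : sinh (x / 2) ^+ 2 = sinh (x / 2) ^+ 2 * cos (v / 2) ^+ 2 +
    sinh (x / 2) ^+ 2 * sin (v / 2) ^+ 2 by rewrite -mulrDr cs mulr1.
rewrite mulrDl -lerBlDl {1}sE addrK.
apply: (@le_trans _ _ ((x / 2) ^+ 2 * cosh (x / 2) ^+ 2 * cos (v / 2) ^+ 2)).
  by rewrite ler_wpM2r// sqr_ge0.
apply: (@le_trans _ _ (cosh (x / 2) ^+ 2 * (x ^+ 2 / v ^+ 2) *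
    ((v / 2) ^+ 2 * cos (v / 2) ^+ 2))).
  rewrite le_eqVlt; apply/orP; left; apply/eqP.
  by have := lt0r_neq0 v0 => v0'; field.
by rewrite ler_wpM2l// mulr_ge0 ?sqr_ge0// divr_ge0 ?sqr_ge0.
Qed.

Definition cosh_prod (J : nat) x : R := \prod_(0 <= k < J) (1 + x ^+ 2 / a k ^+ 2).

Lemma cosh_prod_factor_ge1 x k : 1 <= 1 + x ^+ 2 / a k ^+ 2.
Proof. by rewrite lerDl divr_ge0 ?sqr_ge0. Qed.

Lemma cosh_prod_ge1 J x : 1 <= cosh_prod J x.
Proof.
rewrite /cosh_prod; elim/big_ind : _ => // [u v u1 v1|k _].
  exact: mulr_ege1.
exact: cosh_prod_factor_ge1.
Qed.

Lemma cosh_prod_ndecr x : {homo cosh_prod^~ x : m n / (m <= n)%N >-> m <= n}.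
Proof.
apply: homo_leq => [//|? ? ?|J]; first exact: le_trans.
rewrite /cosh_prod big_nat_recr//= ler_peMr ?cosh_prod_factor_ge1//.
by rewrite (le_trans _ (cosh_prod_ge1 J x)).
Qed.

Lemma sqr_div_cancel (x v w : R) : w != 0 ->
  (x / w) ^+ 2 / (v / w) ^+ 2 = x ^+ 2 / v ^+ 2.
Proof. by move=> w0; rewrite -!expr_div_n invf_div mulrA divfK. Qed.

Lemma cosh_prod_le J x : cosh_prod J x <= cosh x.
Proof.
apply: (@le_trans _ _ (cosh_prod (2 ^ J) x)).
  by apply: cosh_prod_ndecr; rewrite ltnW// ltn_expl.
rewrite (cosh_prodE J) /cosh_prod big_mkord; apply: ler_prod => k _.
rewrite (le_trans _ (cosh_prod_factor_ge1 x k))//=.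
have n0 : (0 : R) < (2 ^ J)%:R by rewrite ltr0n expn_gt0.
apply: (le_trans _ (cosh_factor_ge _ _)); last first.
  by rewrite divr_gt0 ?half_odd_pi_gt0 ?half_odd_pi_lt.
by rewrite sqr_div_cancel// lt0r_neq0.
Qed.

Lemma bernoulli_ineq (t : R) m : 0 <= t <= 1 -> 1 - m%:R * t <= (1 - t) ^+ m.
Proof.
move=> /andP[t0 t1]; elim: m => [|m ih]; first by rewrite mul0r subr0 expr0.
rewrite exprS; apply: (@le_trans _ _ ((1 - t) * (1 - m%:R * t))); last first.
  by rewrite ler_wpM2l// subr_ge0.
have := mulr_ge0 (ler0n R m) (sqr_ge0 t).
rewrite -natr1; nra.
Qed.

(** The 2^N losses cosh^2 (x / 2^(N+1)) of the factorwise comparison are absorbed by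
cosh^2 v * (1 - v^2) <= 1 and by the Bernoulli inequality. *)
Lemma cosh_prod_ge N x :
  cosh x * (1 - x ^+ 2 / (4 * (2 ^ N)%:R)) <= cosh_prod (2 ^ N) x.
Proof.
have n1 : (1 : R) <= (2 ^ N)%:R by rewrite ler1n expn_gt0.
set M : R := (2 ^ N)%:R in n1 *; have M0 : 0 < M by exact: lt_le_trans n1.
pose v := x / M / 2.
have -> : 1 - x ^+ 2 / (4 * M) = 1 - M * v ^+ 2.
  by rewrite /v; have := lt0r_neq0 M0 => M0'; field.
(* For v^2 >= 1 the left-hand side is nonpositive. *)
have [v1|v1] := leP 1 (v ^+ 2).
  rewrite (@le_trans _ _ 0)//; last by rewrite (le_trans _ (cosh_prod_ge1 _ _)).
  by rewrite pmulr_rle0 ?cosh_gt0// subr_le0 mulr_ege1.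
have cv : cosh v ^+ 2 * (1 - v ^+ 2) <= 1.
  have := sinh_le_sqr v; have := cosh2sinh2 v; nra.
have v0 := sqr_ge0 v.
apply: (@le_trans _ _ (cosh x * (1 - v ^+ 2) ^+ (2 ^ N))).
  rewrite ler_wpM2l ?(ltW (cosh_gt0 _))// bernoulli_ineq// v0 ltW//.
have -> : (1 - v ^+ 2) ^+ (2 ^ N) = \prod_(k < 2 ^ N) (1 - v ^+ 2).
  by rewrite prodr_const card_ord.
rewrite (cosh_prodE N) /cosh_prod big_mkord -big_split/=.
apply: ler_prod => k _.
have kp : 0 < a k / M < pi.
  by rewrite divr_gt0 ?half_odd_pi_gt0 ?half_odd_pi_lt.
rewrite mulr_ge0/=; last 2 first.
- rewrite addr_ge0// divr_ge0// ?subr_ge0 ?cosh_ge1//.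
- by rewrite subr_ge0 ltW.
have := cosh_factor_le (x / M) kp.
rewrite -/v sqr_div_cancel ?lt0r_neq0//.
move=> h.
apply: (@le_trans _ _ (cosh v ^+ 2 * (1 + x ^+ 2 / a k ^+ 2) * (1 - v ^+ 2))).
  by rewrite ler_wpM2r// subr_ge0 ltW.
rewrite mulrAC ler_piMl// (le_trans _ (cosh_prod_factor_ge1 x k))//.
Qed.

(** Partial products increase and stay below cosh x; along powers of two they are
within a factor 1 - O(2^-N) of it. *)
Lemma cvg_cosh_prod x : cosh_prod^~ x @ \oo --> cosh x.
Proof.
rewrite -(cvg_shiftS (cosh_prod^~ x)) /=.
apply: (@squeeze_cvgr _ _ _ _ (fun J => cosh x * (1 - x ^+ 2 / 2 * harmonic J))
   (fun=> cosh x)).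
- near=> J; rewrite cosh_prod_le andbT.
  have /andP[t1 t2] := @trunc_log_bounds 2 J.+1 isT isT.
  apply: (le_trans _ (cosh_prod_ndecr x t1)).
  apply: (le_trans _ (cosh_prod_ge _ x)).
  rewrite ler_wpM2l ?(ltW (cosh_gt0 _))// lerD2l lerN2 /harmonic/=.
  rewrite -mulrA -invfM ler_wpM2l ?sqr_ge0// lef_pV2 ?posrE ?mulr_gt0 ?ltr0n ?expn_gt0//.
  rewrite -natrM -natrM ler_nat -[4%N]/(2 * 2)%N -mulnA leq_mul2l/=.
  by rewrite -expnS ltnW.
- rewrite -[X in _ --> X]mulr1; apply: cvgMr.
  rewrite -[X in _ --> X]subr0; apply: cvgB; first exact: cvg_cst.
  rewrite -[X in _ --> X](mulr0 (x ^+ 2 / 2)); apply: cvgMr.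
  exact: cvg_harmonic.
- exact: cvg_cst.
Unshelve. all: by end_near. Qed.

End cosh_product.

(** * The space of real sequences *)

Section measurable_lim.
Context d (T : measurableType d) (R : realType).
Local Open Scope ereal_scope.

Lemma cvg_limn_esup_eq_einf (u : (\bar R)^nat) :
  limn_esup u = limn_einf u -> cvgn u.
Proof.
move=> e; apply/cvg_ex; exists (limn_esup u).
have c1 : esups u @ \oo --> limn_esup u.
  by rewrite limn_esup_lim; exact: is_cvg_esups.
have c2 : einfs u @ \oo --> limn_esup u.
  by rewrite e limn_einf_lim; exact: is_cvg_einfs.
apply: (squeeze_cvge _ c2 c1); apply: nearW => n.
apply/andP; split.
- by apply: ereal_inf_lbound; exists n => /=.
- by apply: ereal_sup_ubound; exists n => /=.
Qed.

(** The limit of a divergent sequence is a default value: the limit agrees with the upper limit on the measurable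
set where the upper and the lower limit coincide, and is constant elsewhere. *)
Lemma measurable_fun_limn (f : (T -> \bar R)^nat) :
  (forall n, measurable_fun setT (f n)) ->
  measurable_fun setT (fun x => limn (f^~ x)).
Proof.
move=> mf.
have ms : measurable_fun setT (fun x => limn_esup (f^~ x)).
  exact: measurable_fun_limn_esup.
have mi : measurable_fun setT (fun x => limn_einf (f^~ x)).
  have -> : (fun x => limn_einf (f^~ x)) =
      (fun x => - limn_esup (fun n => - f n x)).
    by apply/funext => x; rewrite -limn_einfN; congr limn_einf;
      apply/funext => n/=; rewrite oppeK.
  apply: measurableT_comp => //; apply: measurable_fun_limn_esup => n.
  exact: measurableT_comp.
pose C := [set x | limn_esup (f^~ x) = limn_einf (f^~ x)].
have mC : measurable C.
  have -> : C = [set x | limn_esup (f^~ x) <= limn_einf (f^~ x)].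
    apply/seteqP; split => x /=; first by rewrite /C /= => ->.
    by move=> h; apply/eqP; rewrite eq_le h limn_einf_sup.
  rewrite -[X in measurable X]setTI; exact: emeasurable_fun_le.
have CE x : C x <-> cvgn (f^~ x).
  split; first exact: cvg_limn_esup_eq_einf.
  by move=> c; rewrite /C/= is_cvg_limn_esupE// is_cvg_limn_einfE.
rewrite (_ : (fun x => _) = (fun x => if x \in C then limn_esup (f^~ x) else point)).
  apply: measurable_fun_ifT => //.
  apply: (measurable_fun_bool true).
  by rewrite setTI (_ : _ @^-1` _ = C)//; apply/seteqP; split=> x /=;
    [move/set_mem|move=> ?; exact/mem_set].
apply/funext => x; case: ifPn => [/set_mem/CE h|/negP h].
  by rewrite is_cvg_limn_esupE.
rewrite dvgP//= => /CE h'; apply: h; exact/mem_set.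
Qed.

End measurable_lim.

Section sequence_space.
Context (R : realType).

Definition cylinder : set (set (nat -> R)) :=
  [set A | exists N (B : nat -> set R), [/\ forall k, measurable (B k),
     forall k, (N <= k)%N -> B k = setT & A = [set u | forall k, B k (u k)]]].

(** A countable product of copies of the line, with the sigma-algebra generated by the
cylinders; it hosts the sequences of exponential variables behind a Polya-Gamma variable. *)
Definition seqR := g_sigma_algebraType cylinder.

HB.instance Definition _ := Measurable.on seqR.

Lemma cylinder_setI_closed : setI_closed cylinder.
Proof.
move=> _ _ [N [A [mA NA ->]]] [M [B [mB MB ->]]].
exists (maxn N M), (fun k => A k `&` B k); split.
- by move=> k; exact: measurableI.
- by move=> k; rewrite geq_max => /andP[Nk Mk]; rewrite NA// MB// setTI.
- apply/seteqP; split=> u /= => [[uA uB] k|h]; first by split.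
  by split=> k; have [] := h k.
Qed.

Lemma measurable_seqR_coord k : measurable_fun setT (fun u : seqR => u k).
Proof.
move=> _ B mB; rewrite setTI; apply: sub_sigma_algebra.
exists k.+1, (fun j => if j == k then B else setT); split.
- by move=> j; case: ifP.
- by move=> j; case: eqP => // ->; rewrite ltnn.
- apply/seteqP; split=> u /= => [Bu j|/(_ k)]; last by rewrite eqxx.
  by case: eqP => // ->.
Qed.

Lemma measurable_to_seqR d (T : measurableType d) (g : T -> seqR) :
  (forall k, measurable_fun setT (fun w => g w k)) -> measurable_fun setT g.
Proof.
move=> mg; apply: (@measurability _ _ _ _ setT g cylinder) => // _ [_ [N [B [mB NB ->]]] <-].
rewrite setTI (_ : _ @^-1` _ = \bigcap_k ((fun w => g w k) @^-1` B k)).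
  by apply: bigcapT_measurable => k; rewrite -[X in measurable X]setTI; exact: mg.
by apply/seteqP; split=> w /= h k => [_|]; exact: h.
Qed.

Lemma seqR_measure_unique (m1 m2 : {measure set seqR -> \bar R}) :
  (m1 setT < +oo)%E -> (forall A, cylinder A -> m1 A = m2 A) ->
  forall A, measurable A -> m1 A = m2 A.
Proof.
move=> m1oo m12 A mA.
have cT : cylinder setT.
  exists 0%N, (fun=> setT); split => //.
  by apply/seteqP; split=> u.
apply: (@measure_unique _ R seqR cylinder (fun=> setT)) => //.
- exact: cylinder_setI_closed.
- exact: bigcup_const.
Qed.

Lemma measurable_polya_gamma_sum (c : R) :
  measurable_fun setT (fun u : seqR => polya_gamma_sum c u).
Proof.
rewrite /polya_gamma_sum; apply: measurable_funeM.
apply: measurable_fun_limn => n.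
apply: emeasurable_sum => k; apply/measurable_EFinP.
apply: measurable_funM; last exact: measurable_cst.
exact: measurable_seqR_coord.
Qed.

End sequence_space.

(** * Tilting the exponential law *)

Section scaling.
Context {R : realType}.
Local Open Scope ereal_scope.
Local Notation mu := (@lebesgue_measure R).

Let measurable_scale (a : R) :
  measurable_fun setT (fun x : measurableTypeR R => (a * x)%R : measurableTypeR R).
Proof. exact: measurable_funM. Qed.

Lemma lebesgue_measure_scale (a : R) (A : set R) : (0 < a)%R -> measurable A ->
  mu A = a%:E * mu ((fun x => a * x)%R @^-1` A).
Proof.
move=> a0 mA.
pose m : {measure set (measurableTypeR R) -> \bar R} :=
  mscale (NngNum (ltW a0)) (image_measure mu (measurable_scale a)).
apply: (@lebesgue_measure_unique _ m) => // _ [[u v]] _ <-.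
rewrite /m/= /mscale/= /pushforward.
have -> : (fun x => (a * x)%R) @^-1` `]u, v]%classic = `](u / a)%R, (v / a)%R]%classic.
  apply/seteqP; split=> x /=; rewrite !in_itv/= => /andP[].
    by rewrite ltr_pdivrMr// ler_pdivlMr// ![(x * a)%R]mulrC => -> ->.
  by rewrite ltr_pdivrMr// ler_pdivlMr// ![(x * a)%R]mulrC => -> ->.
rewrite !lebesgue_measure_itv/= !lte_fin ltr_pM2r ?invr_gt0//.
case: ifPn => _; last by rewrite mule0.
by rewrite -!EFinB -EFinM -mulrBl mulrC divfK// gt_eqF.
Qed.

Lemma ge0_integral_scale (a : R) (f : R -> \bar R) : (0 < a)%R ->
  measurable_fun setT f -> (forall x, 0 <= f x) ->
  \int[mu]_x f x = a%:E * \int[mu]_x f (a * x)%R.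
Proof.
move=> a0 mf f0.
pose m : {measure set (measurableTypeR R) -> \bar R} :=
  mscale (NngNum (ltW a0)) (image_measure mu (measurable_scale a)).
rewrite (@eq_measure_integral _ _ _ _ m); last first.
  move=> A mA _; rewrite /m/= /mscale/=; exact: lebesgue_measure_scale.
rewrite /m ge0_integral_mscale//=; congr (_ * _).
exact: (ge0_integral_image_measure mu (measurable_scale a)).
Qed.

End scaling.

Section gamma_tilt.
Context {R : realType}.
Local Open Scope ereal_scope.
Local Notation mu := (@lebesgue_measure R).

(** The Gamma density of shape 1 with the power x^0 removed; the normalizing constant stays
an integral because tilting preserves it. *)
Definition gamma1_pdf (x : R) : R := (\1_(`]0, +oo[ : set R) x * (expR (- x) / gamma_fun 1))%R.

Lemma gamma1_pdf_ge0 x : (0 <= gamma1_pdf x)%R.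
Proof.
rewrite /gamma1_pdf mulr_ge0// divr_ge0 ?expR_ge0//.
rewrite /gamma_fun; apply: Rintegral_ge0 => z _.
by rewrite mulr_ge0 ?powR_ge0 ?expR_ge0.
Qed.

Lemma measurable_gamma1_pdf : measurable_fun setT gamma1_pdf.
Proof.
apply: measurable_funM; first exact: measurable_indic.
apply: measurable_funM => //.
by apply: measurableT_comp => //; exact: measurable_funN.
Qed.

Lemma gamma_prob1E A : measurable A ->
  gamma_prob 1 A = \int[mu]_(x in A) (gamma1_pdf x)%:E.
Proof.
move=> mA; rewrite /gamma_prob integral_mkcondr; apply: eq_integral => x _.
rewrite /patch /gamma1_pdf indicE; case: ifPn => _; last by rewrite mul0r.
by rewrite subrr powRr0 !mul1r.
Qed.

(** The substitution x -> (1 + theta) x in the density exp(-x): the weight turns it into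
(1 + theta) exp(-(1 + theta) x). *)
Lemma gamma1_tilt (theta : R) (m : {measure set R -> \bar R}) (B : set R) :
  (0 <= theta)%R -> measurable B ->
  (forall A, measurable A -> m A = gamma_prob 1 A) ->
  \int[m]_x ((1 + theta) * expR (- (theta * x)) * \1_B ((1 + theta) * x))%:E = m B.
Proof.
move=> t0 mB mE.
have t1 : (0 < 1 + theta)%R by rewrite ltr_wpDr.
have mI : measurable_fun setT (\1_B : R -> R) by exact: measurable_indic.
have mlin (a : R) : measurable_fun setT (fun x : R => (a * x)%R).
  exact: measurable_funM.
pose h x := (\1_B x * gamma1_pdf x)%R.
have h0 x : (0 <= h x)%R by rewrite mulr_ge0// gamma1_pdf_ge0.
have mh : measurable_fun setT h.
  by apply: measurable_funM => //; exact: measurable_gamma1_pdf.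
have mid : measurable_fun setT (id : R -> measurableTypeR R) by [].
pose f x := ((1 + theta) * expR (- (theta * x)) * \1_B ((1 + theta) * x))%R.
have mf : measurable_fun setT f.
  apply: measurable_funM.
    apply: measurable_funM => //; apply: measurableT_comp => //.
    by apply: measurable_funN.
  exact: (measurableT_comp mI (mlin _)).
have f0 x : (0 <= f x)%R by rewrite !mulr_ge0 ?expR_ge0// ltW.
have f0e x : 0 <= (EFin \o f) x by rewrite lee_fin.
have mfe : measurable_fun setT (EFin \o f) by exact/measurable_EFinP.
have -> : \int[m]_x (f x)%:E = \int[image_measure m mid]_x (f x)%:E.
  by rewrite (ge0_integral_image_measure m mid (f := EFin \o f)).
rewrite (@integral_density _ _ _ mu (image_measure m mid) gamma1_pdf) //; last 3 first.
- exact: measurable_gamma1_pdf.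
- exact: gamma1_pdf_ge0.
- by move=> A mA; rewrite -gamma_prob1E// -mE.
transitivity (\int[mu]_x ((1 + theta)%:E * (h ((1 + theta) * x)%R)%:E)).
  apply: eq_integral => x _; rewrite -!EFinM; congr EFin.
  rewrite /f /h /gamma1_pdf.
  have -> : \1_(`]0%R, +oo[ : set R) ((1 + theta) * x)%R =
      \1_(`]0%R, +oo[ : set R) x :> R.
    rewrite !indicE; congr ((nat_of_bool _)%:R).
    by apply/idP/idP => /set_mem /=; rewrite in_itv/= andbT => xp;
      apply/mem_set; rewrite /= in_itv/= andbT; move: xp; rewrite pmulr_rgt0.
  have -> : (expR (- ((1 + theta) * x)) = expR (- (theta * x)) * expR (- x))%R.
    by rewrite -expRD; congr expR; ring.
  ring.
rewrite ge0_integralZl//; last 3 first.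
- by apply/measurable_EFinP; exact: (measurableT_comp mh (mlin _)).
- by move=> x _; rewrite lee_fin.
- by rewrite lee_fin ltW.
rewrite -(@ge0_integral_scale _ _ (EFin \o h))//; last exact/measurable_EFinP.
rewrite mE// gamma_prob1E// [RHS]integral_mkcond; apply: eq_integral => x _.
by rewrite epatch_indic /= -EFinM mulrC.
Qed.

End gamma_tilt.

Section iid_gamma.
Context {R : realType} d (T : measurableType d) (P : probability T R).
Variable g : nat -> {RV P >-> R}.
Hypothesis gi : iid g (gamma_prob 1).
Local Open Scope ereal_scope.

Let mg k : measurable_fun setT (g k : T -> R).
Proof. exact: measurable_funPT. Qed.

Lemma iid_gamma_law k A : measurable A -> P (g k @^-1` A) = gamma_prob 1 A.
Proof. exact: (gi.1 k A). Qed.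

Lemma iid_gamma_gt0 : \forall w \ae P, forall k, (0 < g k w)%R.
Proof.
have : P.-negligible (\bigcup_k (g k @^-1` `]-oo, 0%R])).
  apply: negligible_bigcup => k; apply/negligibleP.
    by rewrite -[X in measurable X]setTI; apply: mg.
  apply: (etrans (iid_gamma_law k _)) => //; rewrite /gamma_prob.
  rewrite (_ : _ `&` _ = set0) ?integral_set0//.
  apply/seteqP; split=> x //= []; rewrite !in_itv/= andbT => x0 x1.
  by have := lt_le_trans x1 x0; rewrite ltxx.
apply: negligibleS => w /=; rewrite /setC/= => /existsNP[k /negP].
by rewrite -leNgt => h; exists k => //=; rewrite in_itv/=.
Qed.

Definition seq_of (w : T) : seqR R := fun k => g k w.

Lemma measurable_seq_of : measurable_fun setT seq_of.
Proof. by apply: measurable_to_seqR => k; exact: mg. Qed.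

Lemma iid_gamma_cylinder (N : nat) (B : nat -> set R) :
  (forall k, measurable (B k)) -> (forall k, (N <= k)%N -> B k = setT) ->
  P [set w | forall k, B k (g k w)] = \prod_(0 <= k < N) gamma_prob 1 (B k).
Proof.
move=> mB NB.
have -> : [set w | forall k, B k (g k w)] =
    \bigcap_(k in [set` index_iota 0 N]) (g k @^-1` B k).
  apply/seteqP; split=> w /= h k; first by move=> _; exact: h.
  have [kN|Nk] := ltnP k N; last by rewrite NB.
  by apply: h; rewrite /= mem_index_iota.
rewrite gi.2//; last by rewrite /index_iota iota_uniq.
by apply: eq_bigr => k _; rewrite iid_gamma_law.
Qed.

Lemma gamma_prob1T : gamma_prob 1 (setT : set R) = 1.
Proof. by rewrite -(iid_gamma_law 0)// preimage_setT probability_setT. Qed.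

End iid_gamma.

Section iid_gamma_tilt.
Context {R : realType} d (T : measurableType d) (P : probability T R).
Variable g : nat -> {RV P >-> R}.
Hypothesis gi : iid g (gamma_prob 1).
Local Open Scope ereal_scope.

Let mg k : measurable_fun setT (g k : T -> R).
Proof. exact: measurable_funPT. Qed.

(** Infinitely many exponential variables are tilted at once. Both sides are finite
measures of E, so cylinders suffice; there, independence reduces the finite products to
[gamma1_tilt], the factors past the base of the cylinder integrate to 1, and dominated
convergence (with the constant p as a bound) passes to the infinite product. *)
Lemma iid_gamma_tilt d' (T' : measurableType d') (P' : probability T' R)
    (g' : nat -> {RV P' >-> R}) (theta : nat -> R) (p : R) (s : T -> R) (E : set (seqR R)) :
  iid g' (gamma_prob 1) ->
  (forall k, 0 <= theta k)%R ->
  (\prod_(0 <= k < N) (1 + theta k))%R @[N --> \oo] --> p ->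
  measurable_fun setT s ->
  (\forall w \ae P, (\sum_(0 <= k < N) theta k * g k w)%R @[N --> \oo] --> s w) ->
  measurable E ->
  \int[P]_w (p * expR (- s w) * \1_E (fun k => (1 + theta k) * g k w)%R)%:E =
  P' [set w | E (fun k => g' k w)].
Proof.
move=> g'i t0 cp ms cs mE.
have t1 k : (1 <= 1 + theta k)%R by rewrite lerDl.
have pr0 N : (0 <= \prod_(0 <= k < N) (1 + theta k))%R.
  by apply: prodr_ge0 => k _; rewrite (le_trans ler01).
have prle N : (\prod_(0 <= k < N) (1 + theta k) <= p)%R.
  rewrite -(cvg_lim _ cp)//; apply: nondecreasing_cvgn_le; last by apply/cvg_ex; exists p.
  by apply/nondecreasing_seqP => n; rewrite big_nat_recr//= ler_peMr.
have p0 : (0 <= p)%R := le_trans (pr0 0%N) (prle 0%N).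
pose L w := (p * expR (- s w))%R.
have L0 w : (0 <= L w)%R by rewrite mulr_ge0 ?expR_ge0.
have mL : measurable_fun setT L.
  apply: measurable_funM => //; apply: measurableT_comp => //.
  exact: measurable_funN.
pose H (w : T) : seqR R := fun k => ((1 + theta k) * g k w)%R.
have mH : measurable_fun setT H.
  by apply: measurable_to_seqR => k; apply: measurable_funM => //; exact: mg.
have mg' : measurable_fun setT (fun w => (fun k => g' k w) : seqR R).
  by apply: measurable_to_seqR => k; exact: measurable_funPT.
pose m1 := image_measure (density_measure P mL L0) mH.
pose m2 := image_measure P' mg'.
have m1E A : measurable A -> m1 A = \int[P]_w (L w * \1_A (H w))%:E.
  move=> mA; rewrite /m1 image_measureE /density_measure/= /density_measure.
  rewrite integral_mkcond; apply: eq_integral => w _.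
  by rewrite epatch_indic/= -EFinM.
suff m12 : m1 E = m2 E by rewrite -m1E.
apply/esym; apply: (seqR_measure_unique (m1 := m2)) => //.
  have PT : P' setT < +oo by rewrite probability_setT ltry.
  exact: PT.
move=> A cA; have mA : measurable (A : set (seqR R)) by exact: sub_sigma_algebra.
rewrite m1E//; case: cA => N [B [mB NB AE]].
pose f k x := ((1 + theta k) * expR (- (theta k * x)) * \1_(B k) ((1 + theta k) * x))%R.
have f0 k x : (0 <= f k x)%R.
  by rewrite /f !mulr_ge0 ?expR_ge0// (le_trans ler01).
have mf k : measurable_fun setT (f k).
  apply: measurable_funM.
    apply: measurable_funM => //; apply: measurableT_comp => //.
    by apply: measurable_funN; exact: measurable_funM.
  have mI : measurable_fun setT (\1_(B k) : R -> R) by exact: measurable_indic.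
  by apply: (measurableT_comp mI); exact: measurable_funM.
have If k : \int[P]_w (f k (g k w))%:E = gamma_prob 1 (B k).
  have law C : measurable C -> image_measure P (mg k) C = gamma_prob 1 C.
    exact: iid_gamma_law.
  rewrite -law// -(gamma1_tilt (t0 k) (mB k) law).
  rewrite (ge0_integral_image_measure P (mg k) (f := EFin \o f k))//.
    exact/measurable_EFinP.
  by move=> y; rewrite lee_fin.
have fE M w : (\prod_(0 <= k < M) f k (g k w) =
    (\prod_(0 <= k < M) (1 + theta k)) *
    expR (- \sum_(0 <= k < M) theta k * g k w) *
    \prod_(0 <= k < M) \1_(B k) (H w k))%R.
  by rewrite -sumrN expR_sum -!big_split.
(* The integrals are constant from rank N on. *)
have IM M : (N <= M)%N -> \int[P]_w (\prod_(0 <= k < M) f k (g k w))%:E = m2 A.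
  have m2A : m2 A = \prod_(0 <= k < N) gamma_prob 1 (B k).
    by rewrite AE; exact: (iid_gamma_cylinder g'i).
  move=> NM; rewrite (@independent_integral_prod _ _ _ P _ (fun k => g k : T -> R)).
  - rewrite m2A (big_cat_nat (n := N))//= [X in _ * X]big_nat_cond
      [X in _ * X]big1; last first.
      by move=> k /andP[/andP[Nk _] _]; rewrite If NB// (gamma_prob1T gi).
    by rewrite mule1; apply: eq_bigr => k _; rewrite If.
  - exact: mg.
  - exact: gi.2.
  - by rewrite /index_iota iota_uniq.
  - exact: mf.
  - exact: f0.
  - by move=> k; rewrite If -(iid_gamma_law gi k)// ltey_eq fin_num_measure//
      -[X in measurable X]setTI; exact: mg.
have mIA : measurable_fun setT (fun w => \1_A (H w) : R).
  have mI : measurable_fun setT (\1_A : seqR R -> R) by exact: measurable_indic.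
  exact: (measurableT_comp mI mH).
have [] := @dominated_convergence _ _ _ P setT measurableT
  (fun M w => (\prod_(0 <= k < M) f k (g k w))%:E)
  (fun w => (L w * \1_A (H w))%:E) (cst p%:E).
- move=> M; apply/measurable_EFinP; apply: measurable_prod => k _.
  exact: (measurableT_comp (mf k) (mg k)).
- by apply/measurable_EFinP; apply: measurable_funM.
- apply: filterS cs => w cw _; apply: cvg_EFin; first exact: nearW.
  under eq_fun do rewrite fE; apply: cvgM.
    apply: cvgM => //; apply: (@cvg_comp _ _ _ _ expR); last exact: continuous_expR.
    exact: cvgN.
  apply: cvg_near_cst; near=> M.
  have NM : (N <= M)%N by near: M; exists N.
  rewrite indicE; have [HA|HA] := boolP (H w \in A).
    move/set_mem: HA; rewrite AE /= => HB.
    by rewrite big1// => k _; rewrite indicE mem_set.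
  have : ~ A (H w) by move=> h; move/negP: HA; apply; exact/mem_set.
  rewrite AE /= => /existsNP[k nB].
  have kN : (k < N)%N.
    by rewrite ltnNge; apply/negP => Nk; apply: nB; rewrite NB.
  rewrite (bigD1_seq k)/= ?iota_uniq ?mem_index_iota ?(leq_trans kN)//.
  by rewrite indicE memNset// mul0r.
- exact: finite_measure_integrable_cst.
- apply: filterS (iid_gamma_gt0 gi) => w gw M _.
  rewrite gee0_abs ?lee_fin ?prodr_ge0// fE.
  have I01 : (0 <= \prod_(0 <= k < M) (\1_(B k) (H w k) : R) <= 1)%R.
    apply/andP; split; first by rewrite prodr_ge0.
    by apply: prodr_ile1 => k _; rewrite ler0n/= indicE; case: (_ \in _).
  have e1 : (expR (- \sum_(0 <= k < M) theta k * g k w) <= 1)%R.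
    by rewrite -expR0 ler_expR oppr_le0 sumr_ge0// => k _; rewrite mulr_ge0// ltW.
  rewrite -[leRHS]mulr1 ler_pM//; last by case/andP: I01.
    by rewrite mulr_ge0// expR_ge0.
    by case/andP: I01.
  by rewrite -[leRHS]mulr1 ler_pM// expR_ge0.
move=> _ _ c; apply/esym; apply: cvg_unique c _ => //.
apply: cvg_near_cst; near=> M.
by apply: IM; near: M; exists N.
Unshelve. all: by end_near. Qed.

End iid_gamma_tilt.

Lemma measurable_negative (R : realType) : measurable [set x : R | x < 0].
Proof.
rewrite (_ : mkset _ = `]-oo, 0[%classic); first exact: measurable_itv.
by apply/seteqP; split=> x /=; rewrite in_itv/=.
Qed.

(** * Tilting the Polya-Gamma laws *)

Section full_measure.
Context d (T : measurableType d) (R : realType) (P : probability T R).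

Lemma measureI_full (F A : set T) : measurable F -> measurable A ->
  P F = 1%E -> P (A `&` F) = P A.
Proof.
move=> mF mA PF.
have F0 : P (~` F) = 0%E by rewrite probability_setC// PF subee.
apply/esym; apply: (etrans (measureDI P mA mF)).
rewrite [X in (X + _)%E](_ : _ = 0%E) ?add0e//.
apply/eqP; rewrite -measure_le0 -[leRHS]F0; apply: le_measure; rewrite ?inE//.
- exact: measurableD.
- exact: measurableC.
Qed.

Lemma ae_full (F : set T) : measurable F -> P F = 1%E -> \forall w \ae P, F w.
Proof.
move=> mF PF; have F0 : P (~` F) = 0%E by rewrite probability_setC// PF subee.
by apply/negligibleP => //; exact: measurableC.
Qed.

End full_measure.

Section polya_gamma.
Context {R : realType}.

(** Rescaling the k-th variable by 1 + pg_theta c k turns the k-th term of the c-series into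
that of the 0-series; both series start at k = 1, so the variable of index 0 is left alone. *)
Definition pg_theta (c : R) (k : nat) : R :=
  if k == 0%N then 0 else c ^+ 2 / (4 * pi ^+ 2) / (k%:R - 2^-1) ^+ 2.

Lemma pg_theta_ge0 c k : 0 <= pg_theta c k.
Proof.
rewrite /pg_theta; case: ifP => // _.
by rewrite !divr_ge0 ?sqr_ge0// mulr_ge0// sqr_ge0.
Qed.

Lemma half_neq0 k : (0 < k)%N -> k%:R - 2^-1 != 0 :> R.
Proof.
move=> k0; rewrite gt_eqF// subr_gt0 (@lt_le_trans _ _ 1)//; first by lra.
by rewrite ler1n.
Qed.

Lemma pi_neq0 : pi != 0 :> R. Proof. by rewrite gt_eqF// pi_gt0. Qed.

(** With the index shifted by one, this is the infinite product of cosh at c / 2. *)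
Lemma cvg_prod_pg_theta c :
  \prod_(0 <= k < N) (1 + pg_theta c k) @[N --> \oo] --> cosh (c / 2).
Proof.
rewrite -(cvg_shiftS (fun N => \prod_(0 <= k < N) (1 + pg_theta c k))) /=.
rewrite (_ : (fun _ => _) = cosh_prod^~ (c / 2)); first exact: cvg_cosh_prod.
apply/funext => N; rewrite big_nat_recl// {1}/pg_theta eqxx addr0 mul1r.
apply: eq_bigr => k _; congr (1 + _); rewrite /pg_theta/= /half_odd_pi -natr1.
have p0 := pi_neq0; have := half_neq0 (ltn0Sn k); rewrite -natr1.
have -> : k%:R + 1 - 2^-1 = k%:R + 2^-1 :> R by lra.
set z := k%:R + 2^-1 => z0.
move: (pi : R) p0 => q q0.
by field; rewrite z0 q0.
Qed.

Lemma polya_gamma_sum_tilt (c : R) (u : nat -> R) :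
  polya_gamma_sum c (fun k => (1 + pg_theta c k) * u k) = polya_gamma_sum 0 u.
Proof.
rewrite /polya_gamma_sum; congr (_ * _)%E; congr (limn _); apply/funext => N.
apply: eq_big_nat => k /andP[k0 _]; congr EFin.
rewrite /pg_theta -[k == 0%N]negbK -lt0n k0/= expr0n/= mul0r addr0.
have := half_neq0 k0; have := pi_neq0 => p0 h.
have : (k%:R - 2^-1) ^+ 2 + c ^+ 2 / (4 * pi ^+ 2) != 0.
  have A : 0 < (k%:R - 2^-1) ^+ 2 :> R by rewrite lt0r expf_neq0//= sqr_ge0.
  have B : 0 <= c ^+ 2 / (4 * pi ^+ 2) by rewrite divr_ge0 ?sqr_ge0// mulr_ge0// sqr_ge0.
  by rewrite gt_eqF// ltr_wpDr.
move: h; set a := (k%:R - 2^-1) => h; set b := c ^+ 2 / (4 * pi ^+ 2) => h2; clearbody b.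
by field; rewrite h h2.
Qed.

Lemma polya_gamma_sum0_cvg (c : R) (u : nat -> R) : (forall k, 0 < u k) ->
  polya_gamma_sum 0 u \is a fin_num ->
  (\sum_(0 <= k < N) pg_theta c k * u k) @[N --> \oo] -->
    c ^+ 2 / 2 * fine (polya_gamma_sum 0 u).
Proof.
move=> u0; have p0 := pi_neq0.
have i0 : (0 < (2 * pi ^+ 2)^-1 :> R) by rewrite invr_gt0 mulr_gt0// exprn_gt0 ?pi_gt0.
rewrite /polya_gamma_sum.
pose a k : R := u k / ((k%:R - 2^-1) ^+ 2 + 0 ^+ 2 / (4 * pi ^+ 2)).
have a0 k : (0 <= (a k)%:E)%E.
  rewrite lee_fin divr_ge0 ?(ltW (u0 k))// addr_ge0 ?sqr_ge0// divr_ge0 ?sqr_ge0//.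
  by rewrite mulr_ge0 ?sqr_ge0.
have c1 : cvgn (fun N => \sum_(1 <= k < N) (a k)%:E)%E.
  exact: is_cvg_nneseries.
have := c1; move/cvg_ex => [l cl].
have -> : limn (fun N => \sum_(1 <= k < N) (a k)%:E)%E = l by exact: cvg_lim cl.
have l0 : (0 <= l)%E.
  by rewrite -(cvg_lim _ cl)//; apply: lime_ge => //; apply: nearW => N;
     exact: sume_ge0.
move=> lfin.
have {}lfin : l \is a fin_num.
  by move: lfin l0; case: l {cl} => [r|/=|//]//; rewrite gt0_muley ?lte_fin.
move: l lfin l0 cl {c1} => [l| |]// _ _ cl.
have {}cl : (\sum_(1 <= k < N) a k) @[N --> \oo] --> l.
  have -> : (fun N => \sum_(1 <= k < N) a k) =
      fine \o (fun N => \sum_(1 <= k < N) (a k)%:E)%E.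
    by apply/funext => N; rewrite /= sumEFin.
  exact: fine_cvg.
rewrite fineM// /=.
rewrite -(cvg_shiftS (fun N => \sum_(0 <= k < N) _)) /=.
have := cl; rewrite -(cvg_shiftS) /= => {}cl.
have -> : (fun N => \sum_(0 <= k < N.+1) pg_theta c k * u k) =
    (fun N => c ^+ 2 / (4 * pi ^+ 2) * \sum_(1 <= k < N.+1) a k).
  apply/funext => N; rewrite big_ltn// {1}/pg_theta eqxx mul0r add0r mulr_sumr.
  apply: eq_big_nat => k /andP[k0 _].
  rewrite /pg_theta -[k == 0%N]negbK -lt0n k0/= /a expr0n/= mul0r addr0.
  ring.
rewrite (_ : c ^+ 2 / 2 * _ = c ^+ 2 / (4 * pi ^+ 2) * l); last first.
  by move: (pi : R) p0 => q q0; field.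
exact: cvgMr.
Qed.

End polya_gamma.

Section polya_gamma_law.
Context {R : realType} d (T : measurableType d) (P : probability T R).
Variables (g : nat -> {RV P >-> R}) (c : R) (mu : probability R R).
Hypothesis gi : iid g (gamma_prob 1).
Hypothesis muE : forall A, measurable A ->
  mu A = P [set w | (EFin @` A) (polya_gamma_sum c (fun k => g k w))].
Local Open Scope ereal_scope.

Let S (w : T) : \bar R := polya_gamma_sum c (fun k => g k w).

Lemma measurable_polya_gamma_rv : measurable_fun setT S.
Proof.
exact: (measurableT_comp (measurable_polya_gamma_sum c) (measurable_seq_of g)).
Qed.

Let mS := measurable_polya_gamma_rv.

Lemma measurable_polya_gamma_rv_fin : measurable [set w | S w \is a fin_num].
Proof.
rewrite (_ : [set w | _] = S @^-1` (EFin @` setT)).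
  rewrite -[X in measurable X]setTI; apply: mS => //.
  by apply: measurable_image_EFin; exact: measurableT.
apply/seteqP; split=> w /=; first by move=> /fineK <-; exists (fine (S w)).
by move=> [x _ e]; rewrite -e.
Qed.

(** The law mu has total mass 1 and only sees the event where the series is finite. *)
Lemma polya_gamma_rv_fin : P [set w | S w \is a fin_num] = 1.
Proof.
rewrite -(probability_setT mu) muE//; congr (P _).
apply/seteqP; split=> w /=; last by move=> [x _ e]; rewrite /S -e.
by move=> /fineK e; exists (fine (S w)).
Qed.

Lemma polya_gamma_rv_law A : measurable A ->
  mu A = P ((fine \o S) @^-1` A).
Proof.
move=> mA; rewrite muE//.
have mfS : measurable_fun setT (fine \o S) by exact: measurableT_comp.
rewrite -[RHS](measureI_full measurable_polya_gamma_rv_fin _ polya_gamma_rv_fin); last first.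
  by rewrite -[X in measurable X]setTI; exact: mfS.
congr (P _); apply/seteqP; split=> w /=.
  by move=> [x Ax e]; rewrite /S -e.
by move=> [Aw /fineK e]; exists (fine (S w)).
Qed.

Lemma polya_gamma_rv_integral (f : R -> \bar R) :
  measurable_fun setT f -> (forall x, 0 <= f x) ->
  \int[mu]_x f x = \int[P]_w f (fine (S w)).
Proof.
move=> mf f0.
have mfS : measurable_fun setT (fine \o S) by exact: measurableT_comp.
rewrite (@eq_measure_integral _ _ _ _ (image_measure P mfS)); last first.
  by move=> A mA _; exact: polya_gamma_rv_law.
exact: ge0_integral_image_measure.
Qed.

Lemma polya_gamma_ge0 : mu [set x | (x < 0)%R] = 0.
Proof.
have mN := @measurable_negative R; rewrite polya_gamma_rv_law//.
have mfS : measurable_fun setT (fine \o S) by exact: measurableT_comp.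
apply: measure_negligible.
  by rewrite -[X in measurable X]setTI; exact: mfS.
apply: negligibleS (iid_gamma_gt0 gi) => w /=.
move=> + gw; apply/negP; rewrite -leNgt fine_ge0//.
rewrite /S /polya_gamma_sum mule_ge0 ?lee_fin ?invr_ge0 ?mulr_ge0 ?pi_ge0//.
apply: nneseries_ge0 => k _ _; rewrite lee_fin divr_ge0 ?(ltW (gw k))//.
by rewrite addr_ge0 ?sqr_ge0// divr_ge0 ?sqr_ge0// mulr_ge0 ?sqr_ge0.
Qed.

End polya_gamma_law.

Section polya_gamma_tilting.
Context {R : realType}.
Local Open Scope ereal_scope.

Lemma is_polya_gamma_ge0 (c : R) (mu : probability R R) :
  is_polya_gamma 1 c mu -> mu [set x | (x < 0)%R] = 0.
Proof.
move=> [d [T [P [g [gi muE]]]]]; exact: (polya_gamma_ge0 gi muE).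
Qed.

(** The two laws may come from unrelated probability spaces. Tilting the variables of the
first by the weight cosh (c/2) exp(- sum theta_k g_k) gives rescaled variables with the joint
law of the second family, and the rescaled c-series is the 0-series of the original
variables. *)
Lemma is_polya_gamma_tilt (c : R) (mu0 mu : probability R R) A :
  is_polya_gamma 1 0 mu0 -> is_polya_gamma 1 c mu -> measurable A ->
  mu A = \int[mu0]_(x in A) (cosh (c / 2) * expR (- (c ^+ 2 / 2 * x)))%:E.
Proof.
move=> [d [T [P [g [gi mu0E]]]]] [d' [T' [P' [g' [gi' muE]]]]] mA.
rewrite muE//.
pose S (w : T) := polya_gamma_sum 0 (fun k => g k w).
have mS : measurable_fun setT S by exact: measurable_polya_gamma_rv.
pose E := [set u : seqR R | (EFin @` A) (polya_gamma_sum c u)].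
have mE : measurable E.
  rewrite (_ : E = polya_gamma_sum c @^-1` (EFin @` A))//.
  rewrite -[X in measurable X]setTI.
  apply: (measurable_polya_gamma_sum c) => //.
  by apply: measurable_image_EFin; exact: mA.
pose s w := (c ^+ 2 / 2 * fine (S w))%R.
have ms : measurable_fun setT s.
  by apply: measurable_funM => //; exact: measurableT_comp.
have mF : measurable [set w | S w \is a fin_num].
  exact: measurable_polya_gamma_rv_fin.
have aeF := ae_full mF (polya_gamma_rv_fin mu0E).
have cs : \forall w \ae P, (\sum_(0 <= k < N) pg_theta c k * g k w)%R
    @[N --> \oo] --> s w.
  apply: filterS2 (iid_gamma_gt0 gi) aeF => w gw Sw.
  exact: polya_gamma_sum0_cvg.
rewrite -[LHS](iid_gamma_tilt gi gi' (pg_theta_ge0 c) (@cvg_prod_pg_theta _ c) ms cs mE).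
pose phi x := (cosh (c / 2) * expR (- (c ^+ 2 / 2 * x)) * \1_A x)%R.
have phi0 x : (0 <= phi x)%R.
  by rewrite /phi !mulr_ge0 ?expR_ge0// ltW// cosh_gt0.
have mphi : measurable_fun setT phi.
  apply: measurable_funM; last exact: measurable_indic.
  apply: measurable_funM => //; apply: measurableT_comp => //.
  by apply: measurable_funN; exact: measurable_funM.
transitivity (\int[mu0]_x (phi x)%:E); last first.
  rewrite [RHS]integral_mkcond; apply: eq_integral => x _.
  by rewrite epatch_indic/= -EFinM.
have phi0e x : 0 <= (EFin \o phi) x by rewrite lee_fin.
have mphie : measurable_fun setT (EFin \o phi) by exact/measurable_EFinP.
rewrite [RHS](polya_gamma_rv_integral mu0E mphie phi0e).
have EE w : E (fun k => (1 + pg_theta c k) * g k w)%R = (EFin @` A) (S w).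
  by rewrite /E/= polya_gamma_sum_tilt.
apply: ge0_ae_eq_integral => //.
- apply/measurable_EFinP; apply: measurable_funM.
    apply: measurable_funM => //; apply: measurableT_comp => //.
    exact: measurable_funN.
  have mI : measurable_fun setT (\1_E : seqR R -> R) by exact: measurable_indic.
  apply: (measurableT_comp mI); apply: measurable_to_seqR => k.
  by apply: measurable_funM => //; exact: measurable_funPT.
- apply/measurable_EFinP; apply: (measurableT_comp mphi).
  exact: measurableT_comp.
- by move=> w _; rewrite lee_fin !mulr_ge0 ?expR_ge0// ltW// cosh_gt0.
- apply: filterS aeF => w /= Sw _; rewrite /phi /s -/(S w); congr (_ * _)%:E%R.
  rewrite !indicE; congr ((nat_of_bool _)%:R).
  apply/idP/idP => [/set_mem|/set_mem Aw].
    by rewrite EE => -[x Ax e]; apply/mem_set; rewrite -e.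
  by apply/mem_set; rewrite EE; exists (fine (S w)) => //; exact: fineK.
Qed.

End polya_gamma_tilting.

(** * Measurability of matrix operations *)

(** Real inversion is discontinuous at 0; it is written as x * (x^2)^-1 so that the
measurability of the real powers applies. *)
Lemma measurable_inv (R : realType) : measurable_fun setT (@GRing.inv R).
Proof.
rewrite (_ : GRing.inv = (fun x : R => x * (x * x) `^ (-1))).
  have m2 : measurable_fun setT (fun x : R => x * x) by exact: measurable_funM.
  apply: measurable_funM => //.
  exact: (measurableT_comp (@measurable_powR R (-1)) m2).
apply/funext => x; rewrite powR_inv1 -?expr2 ?sqr_ge0//.
by have [->|x0] := eqVneq x 0; rewrite ?invr0 ?mul0r//; field.
Qed.

Section measurable_matrix_operations.
Context d (T : measurableType d) (R : realType).

Lemma measurable_entry m n (f : T -> 'M[R]_(m, n)) i j :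
  measurable_fun setT f -> measurable_fun setT (fun x => f x i j).
Proof. by move=> mf; exact: (measurableT_comp (measurable_mx_coord i j) mf). Qed.

Lemma measurable_addmx m n (f g : T -> 'M[R]_(m, n)) :
  measurable_fun setT f -> measurable_fun setT g ->
  measurable_fun setT (fun x => f x + g x).
Proof.
move=> mf mg; apply: measurable_mxP => i j.
by under eq_fun do rewrite mxE; apply: measurable_funD; exact: measurable_entry.
Qed.

Lemma measurable_submx m n (f g : T -> 'M[R]_(m, n)) :
  measurable_fun setT f -> measurable_fun setT g ->
  measurable_fun setT (fun x => f x - g x).
Proof.
move=> mf mg; apply: measurable_mxP => i j.
by under eq_fun do rewrite !mxE; apply: measurable_funB; exact: measurable_entry.
Qed.

Lemma measurable_mulmx m n k (f : T -> 'M[R]_(m, n)) (g : T -> 'M[R]_(n, k)) :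
  measurable_fun setT f -> measurable_fun setT g ->
  measurable_fun setT (fun x => f x *m g x).
Proof.
move=> mf mg; apply: measurable_mxP => i j.
under eq_fun do rewrite mxE.
apply: measurable_sum => l; apply: measurable_funM; exact: measurable_entry.
Qed.

Lemma measurable_scalemx m n (f : T -> R) (g : T -> 'M[R]_(m, n)) :
  measurable_fun setT f -> measurable_fun setT g ->
  measurable_fun setT (fun x => f x *: g x).
Proof.
move=> mf mg; apply: measurable_mxP => i j.
by under eq_fun do rewrite mxE; apply: measurable_funM => //; exact: measurable_entry.
Qed.

Lemma measurable_trmx m n (f : T -> 'M[R]_(m, n)) :
  measurable_fun setT f -> measurable_fun setT (fun x => (f x)^T).
Proof.
move=> mf; apply: measurable_mxP => i j.
by under eq_fun do rewrite mxE; exact: measurable_entry.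
Qed.

Lemma measurable_diag_mx n (f : T -> 'rV[R]_n) :
  measurable_fun setT f -> measurable_fun setT (fun x => diag_mx (f x)).
Proof.
move=> mf; apply: measurable_mxP => i j.
under eq_fun do rewrite mxE.
by case: (i == j); [exact: measurable_entry|exact: measurable_cst].
Qed.

Lemma measurable_det n (f : T -> 'M[R]_n) :
  measurable_fun setT f -> measurable_fun setT (fun x => \det (f x)).
Proof.
move=> mf; rewrite /determinant; apply: measurable_sum => s.
apply: measurable_funM => //; apply: measurable_prod => i _.
exact: measurable_entry.
Qed.

(** By the cofactor formula on the measurable set of invertible matrices. *)
Lemma measurable_invmx n (f : T -> 'M[R]_n) :
  measurable_fun setT f -> measurable_fun setT (fun x => invmx (f x)).
Proof.
move=> mf; rewrite /invmx.
have mdet := measurable_det mf.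
have madj : measurable_fun setT (fun x => \adj (f x)).
  apply: measurable_mxP => i j; under eq_fun do rewrite mxE /cofactor.
  apply: measurable_funM => //; apply: measurable_det.
  apply: measurable_mxP => k l; under eq_fun do rewrite !mxE.
  exact: measurable_entry.
apply: measurable_fun_ifT => //.
  under eq_fun do rewrite unitmxE unitfE.
  by apply: measurable_neg; exact: measurable_fun_eqr.
apply: measurable_scalemx => //.
exact: (measurableT_comp (@measurable_inv R) mdet).
Qed.

End measurable_matrix_operations.

(** * Positive definite forms and the Euclidean norm *)

Section quadratic_forms.
Context {R : realType}.

Definition qform p (Q : 'M[R]_p) (v : 'cV[R]_p) : R := (v^T *m Q *m v) ord0 ord0.

Definition bform p (Q : 'M[R]_p) (u v : 'cV[R]_p) : R := (u^T *m Q *m v) ord0 ord0.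

Lemma bformD p (Q : 'M[R]_p) u v w : bform Q (u + v) w = bform Q u w + bform Q v w.
Proof. by rewrite /bform linearD/= !mulmxDl mxE. Qed.

Lemma bformDr p (Q : 'M[R]_p) u v w : bform Q w (u + v) = bform Q w u + bform Q w v.
Proof. by rewrite /bform mulmxDr mxE. Qed.

Lemma bformZ p (Q : 'M[R]_p) a u v : bform Q (a *: u) v = a * bform Q u v.
Proof. by rewrite /bform linearZ/= -!scalemxAl mxE. Qed.

Lemma bformZr p (Q : 'M[R]_p) a u v : bform Q v (a *: u) = a * bform Q v u.
Proof. by rewrite /bform -scalemxAr mxE. Qed.

Lemma bformC p (Q : 'M[R]_p) u v : Q^T = Q -> bform Q u v = bform Q v u.
Proof.
move=> QT; rewrite /bform -[in RHS]QT.
have -> : v^T *m Q^T *m u = (u^T *m Q *m v)^T by rewrite !trmx_mul trmxK mulmxA.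
by rewrite [RHS]mxE.
Qed.

Lemma qformE p (Q : 'M[R]_p) v : qform Q v = bform Q v v.
Proof. by []. Qed.

Lemma qformD p (Q : 'M[R]_p) u v : Q^T = Q ->
  qform Q (u + v) = qform Q u + 2 * bform Q u v + qform Q v.
Proof.
move=> QT; rewrite !qformE bformD !bformDr (bformC v u QT); ring.
Qed.

Lemma qform_addmx p (Q Q' : 'M[R]_p) v : qform (Q + Q') v = qform Q v + qform Q' v.
Proof. by rewrite /qform mulmxDr mulmxDl mxE. Qed.

Lemma qform0 p (Q : 'M[R]_p) : qform Q 0 = 0.
Proof. by rewrite /qform mulmx0 mxE. Qed.

Lemma posdef_qform_ge0 p (Q : 'M[R]_p) v : sym_posdef Q -> 0 <= qform Q v.
Proof.
move=> [_ Qp]; have [->|v0] := eqVneq v 0; first by rewrite qform0.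
exact/ltW/Qp.
Qed.

(** A vector in the kernel has zero energy. *)
Lemma posdef_unit p (Q : 'M[R]_p) : sym_posdef Q -> Q \in unitmx.
Proof.
move=> [QT Qp]; rewrite -row_free_unit; apply: inj_row_free => v vQ.
apply: trmx_inj; rewrite trmx0; apply/eqP/negP => /negP v0.
by have := Qp _ v0; rewrite trmxK vQ mul0mx mxE ltxx.
Qed.

Lemma qform_invmx p (Q : 'M[R]_p) v : sym_posdef Q ->
  qform Q (invmx Q *m v) = qform (invmx Q) v.
Proof.
move=> Qp; have Qu := posdef_unit Qp; case: Qp => QT _.
rewrite /qform trmx_mul trmx_inv QT -!mulmxA; congr (fun_of_matrix _ _ _).
by rewrite (mulmxA Q) mulmxV// mul1mx.
Qed.

Lemma posdef_invmx p (Q : 'M[R]_p) : sym_posdef Q -> sym_posdef (invmx Q).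
Proof.
move=> Qp; have Qu := posdef_unit Qp; split; first by rewrite trmx_inv Qp.1.
move=> v v0; rewrite -/(qform _ _) -qform_invmx//; apply: Qp.2.
apply: contraNneq v0 => /(congr1 (mulmx Q)).
by rewrite mulmxA mulmxV// mul1mx mulmx0 => ->.
Qed.

Lemma posdef_add p (Q Q' : 'M[R]_p) : Q'^T = Q' -> (forall v, 0 <= qform Q' v) ->
  sym_posdef Q -> sym_posdef (Q' + Q).
Proof.
move=> Q'T Q'0 [QT Qp]; split; first by rewrite linearD/= Q'T QT.
by move=> v v0; rewrite -/(qform _ _) qform_addmx ltr_wpDl// Qp.
Qed.

(** The energy of u minus its Q-projection on v is nonnegative. *)
Lemma posdef_cauchy_schwarz p (Q : 'M[R]_p) u v : sym_posdef Q ->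
  bform Q u v ^+ 2 <= qform Q u * qform Q v.
Proof.
move=> Qp; have [->|v0] := eqVneq v 0.
  by rewrite /bform mulmx0 mxE expr0n/= qform0 mulr0.
have qv : 0 < qform Q v by exact: Qp.2.
have := posdef_qform_ge0 (u + (- (bform Q u v / qform Q v)) *: v) Qp.
rewrite qformD ?Qp.1// bformZr !qformE bformZ bformZr -!qformE => h.
rewrite -subr_ge0.
have -> : qform Q u * qform Q v - bform Q u v ^+ 2 = qform Q v *
   (qform Q u + 2 * (- (bform Q u v / qform Q v) * bform Q u v) +
       - (bform Q u v / qform Q v) * (- (bform Q u v / qform Q v) * qform Q v)).
  by have := lt0r_neq0 qv => qv0; field.
by rewrite mulr_ge0// ltW.
Qed.

End quadratic_forms.

Section schur.
Context {R : realType} {p : nat} (Q : 'M[R]_(1 + p)).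
Hypothesis Qp : sym_posdef Q.

Definition schur_b : 'cV[R]_p := dlsubmx Q.
Definition schur_D : 'M[R]_p := drsubmx Q.
(** The Schur complement of the lower right block. *)
Definition schur_s : R := (ulsubmx Q) ord0 ord0 - qform (invmx schur_D) schur_b.

Lemma schur_block : Q = block_mx (ulsubmx Q) schur_b^T schur_b schur_D.
Proof.
rewrite -[LHS]submxK /schur_b /schur_D; congr (block_mx _ _ _ _).
by rewrite -[in LHS]Qp.1 trmx_dlsub.
Qed.

Lemma qform_block (u : R) (w : 'cV[R]_p) :
  qform Q (col_mx u%:M w) =
  ulsubmx Q ord0 ord0 * u ^+ 2 + 2 * u * (schur_b^T *m w) ord0 ord0 + qform schur_D w.
Proof.
rewrite /qform {1}schur_block tr_col_mx mul_row_block mul_row_col.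
rewrite !mulmxDl tr_scalar_mx !mul_scalar_mx -!scalemxAl mul_mx_scalar.
rewrite (_ : w^T *m schur_b *m u%:M = u *: (schur_b^T *m w)); last first.
  rewrite mul_mx_scalar; congr (_ *: _).
  apply/matrixP => i j; rewrite !ord1 !mxE; apply: eq_bigr => k _.
  by rewrite !mxE mulrC.
rewrite -!mulmxA !mxE; ring.
Qed.

Lemma schur_posdefD : sym_posdef schur_D.
Proof.
split; first by rewrite /schur_D trmx_drsub Qp.1.
move=> v v0; have v0' : col_mx (0 : R)%:M v != 0.
  apply: contraNneq v0 => /(congr1 dsubmx); rewrite col_mxKd => ->.
  by apply/eqP/matrixP => i j; rewrite !mxE.
have := Qp.2 _ v0'; rewrite -/(qform _ _) qform_block.
by rewrite expr0n/= mulr0 mulr0 mul0r !add0r.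
Qed.

Let Du := posdef_unit schur_posdefD.

(** Minimizing over w splits the quadratic form into a form in the shifted variable w
and a square in u. It drives the induction on the dimension in the Gaussian integral. *)
Lemma schur_complete_square (u : R) (w : 'cV[R]_p) :
  qform Q (col_mx u%:M w) =
  qform schur_D (w + u *: (invmx schur_D *m schur_b)) + schur_s * u ^+ 2.
Proof.
have DT := schur_posdefD.1.
rewrite qform_block (qformD _ _ DT) bformZr !qformE bformZ bformZr -!qformE.
rewrite (qform_invmx _ schur_posdefD) /schur_s.
have -> : bform schur_D w (invmx schur_D *m schur_b) = (schur_b^T *m w) ord0 ord0.
  rewrite (bformC _ _ DT) /bform trmx_mul trmx_inv DT -mulmxA.
  by rewrite -(mulmxA _ _ (_ *m _)) (mulmxA (invmx _)) mulVmx// mul1mx.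
ring.
Qed.

Lemma schur_s_gt0 : 0 < schur_s.
Proof.
have v0 : col_mx (1 : R)%:M (- (invmx schur_D *m schur_b)) != 0.
  apply/negP => /eqP /(congr1 usubmx); rewrite col_mxKu => /matrixP/(_ ord0 ord0).
  by rewrite !mxE eqxx /= => /eqP; rewrite oner_eq0.
have := Qp.2 _ v0; rewrite -/(qform _ _) schur_complete_square scale1r addNr.
by rewrite qform0 add0r expr1n mulr1.
Qed.

(** Column operations that clear the block schur_b make the matrix triangular. *)
Lemma schur_det : \det Q = schur_s * \det schur_D.
Proof.
pose M : 'M[R]_(1 + p) := block_mx 1%:M 0 (- (invmx schur_D *m schur_b)) 1%:M.
have detM : \det M = 1 by rewrite det_lblock !det1 mulr1.
rewrite -[LHS]mulr1 -detM -det_mulmx {1}schur_block mulmx_block.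
rewrite !mulmx1 !mulmx0 !add0r !mulmxN (mulmxA schur_D) mulmxV//.
rewrite mul1mx subrr.
rewrite det_ublock; congr (_ * _); rewrite det_mx11 /schur_s !mxE.
by congr (_ - _); rewrite /qform -mulmxA !mxE.
Qed.

End schur.

Section euclidean_norm.
Context {R : realType}.

Lemma l2norm_ge0 n (v : 'cV[R]_n) : 0 <= l2norm v.
Proof. exact: sqrtr_ge0. Qed.

Lemma sqr_l2norm n (v : 'cV[R]_n) : l2norm v ^+ 2 = \sum_i v i ord0 ^+ 2.
Proof. by rewrite sqr_sqrtr// sumr_ge0// => i _; rewrite sqr_ge0. Qed.

Lemma sqr_l2normE n (v : 'cV[R]_n) : l2norm v ^+ 2 = (v^T *m v) ord0 ord0.
Proof. by rewrite sqr_l2norm mxE; apply: eq_bigr => i _; rewrite !mxE expr2. Qed.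

Lemma l2norm_eq0 n (v : 'cV[R]_n) : (l2norm v == 0) = (v == 0).
Proof.
apply/eqP/eqP => [v0|->]; last first.
  by rewrite /l2norm big1 ?sqrtr0// => i _; rewrite mxE expr0n.
apply/matrixP => i j; rewrite ord1 mxE; apply/eqP; rewrite -sqrf_eq0.
have : \sum_i v i ord0 ^+ 2 = 0 by rewrite -sqr_l2norm v0 expr0n.
move/eqP; rewrite psumr_eq0 => [/allP/(_ i)|k _]; last exact: sqr_ge0.
by rewrite mem_index_enum => /(_ isT) /implyP; apply.
Qed.

Lemma l2norm0 n : l2norm (0 : 'cV[R]_n) = 0.
Proof. by apply/eqP; rewrite l2norm_eq0. Qed.

Lemma posdef1 n : sym_posdef (1%:M : 'M[R]_n).
Proof.
split=> [|v v0]; first by rewrite trmx1.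
by rewrite mulmx1 -sqr_l2normE exprn_gt0// lt0r l2norm_eq0 v0 l2norm_ge0.
Qed.

Lemma qform1 n (v : 'cV[R]_n) : qform 1%:M v = l2norm v ^+ 2.
Proof. by rewrite /qform mulmx1 sqr_l2normE. Qed.

Lemma l2norm_cauchy_schwarz n (u v : 'cV[R]_n) :
  `|(u^T *m v) ord0 ord0| <= l2norm u * l2norm v.
Proof.
have := posdef_cauchy_schwarz u v (posdef1 n).
rewrite !qform1 /bform mulmx1 -exprMn -real_normK ?num_real//.
by rewrite ler_sqr ?nnegrE ?mulr_ge0 ?l2norm_ge0.
Qed.

Lemma l2normZ n (a : R) (v : 'cV[R]_n) : l2norm (a *: v) = `|a| * l2norm v.
Proof.
rewrite /l2norm -sqrtr_sqr -sqrtrM ?sqr_ge0// mulr_sumr; congr Num.sqrt.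
by apply: eq_bigr => i _; rewrite mxE exprMn.
Qed.

Lemma l2normN n (v : 'cV[R]_n) : l2norm (- v) = l2norm v.
Proof. by rewrite -scaleN1r l2normZ normrN1 mul1r. Qed.

Lemma ler_l2normD n (u v : 'cV[R]_n) : l2norm (u + v) <= l2norm u + l2norm v.
Proof.
rewrite -ler_sqr ?nnegrE ?addr_ge0 ?l2norm_ge0// -qform1 qformD ?trmx1// !qform1.
rewrite sqrrD lerD2r lerD2l /bform mulmx1 -[leRHS]mulr_natl ler_pM2l//.
exact: le_trans (ler_norm _) (l2norm_cauchy_schwarz u v).
Qed.

Lemma ler_l2normB n (u v : 'cV[R]_n) : l2norm (u - v) <= l2norm u + l2norm v.
Proof. by rewrite -(l2normN v) ler_l2normD. Qed.

Lemma measurable_sqrt : measurable_fun setT (@Num.sqrt R).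
Proof. by apply: continuous_measurable_fun; exact: sqrt_continuous. Qed.

Lemma measurable_l2norm n : measurable_fun setT (@l2norm R n).
Proof.
rewrite /l2norm; apply: (measurableT_comp measurable_sqrt); apply: measurable_sum => i.
by apply: measurable_funX; exact: measurable_mx_coord.
Qed.

(** The norm of the vector of row norms is a bound; without one the supremum in
the definition of the operator norm would be a default value. *)
Lemma opnorm_has_ubound m n (A : 'M[R]_(m, n)) :
  has_ubound [set l2norm (A *m v) | v in [set v : 'cV[R]_n | l2norm v <= 1]].
Proof.
exists (Num.sqrt (\sum_i l2norm (row i A)^T ^+ 2)) => _ [v /= v1 <-].
rewrite /l2norm ler_sqrt; last by apply: sumr_ge0 => i _; rewrite sqr_ge0.
apply: ler_sum => i _.
have -> : (A *m v) i ord0 = (((row i A)^T)^T *m v) ord0 ord0.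
  by rewrite trmxK -row_mul [RHS]mxE.
have := l2norm_cauchy_schwarz (row i A)^T v => h.
rewrite -real_normK ?num_real// -/(l2norm _) ler_sqr ?nnegrE ?l2norm_ge0//.
by rewrite (le_trans h)// ler_piMr ?l2norm_ge0.
Qed.

Lemma opnorm_ge0 m n (A : 'M[R]_(m, n)) : 0 <= opnorm A.
Proof.
apply: (@le_trans _ _ (l2norm (A *m 0))); first exact: l2norm_ge0.
apply: ub_le_sup; first exact: opnorm_has_ubound.
by exists 0 => //=; rewrite l2norm0.
Qed.

Lemma l2norm_mulmx_le m n (A : 'M[R]_(m, n)) v :
  l2norm (A *m v) <= opnorm A * l2norm v.
Proof.
have [->|v0] := eqVneq v 0.
  by rewrite mulmx0 !l2norm0 mulr0.
have nv : 0 < l2norm v by rewrite lt0r l2norm_eq0 v0 l2norm_ge0.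
rewrite -ler_pdivrMr//.
have -> : l2norm (A *m v) / l2norm v = l2norm (A *m ((l2norm v)^-1 *: v)).
  by rewrite -scalemxAr l2normZ ger0_norm ?invr_ge0 ?l2norm_ge0// mulrC.
apply: ub_le_sup; first exact: opnorm_has_ubound.
exists ((l2norm v)^-1 *: v) => //=.
by rewrite l2normZ ger0_norm ?invr_ge0 ?l2norm_ge0// mulVf// gt_eqF.
Qed.

Lemma qform_le_opnorm n (S : 'M[R]_n) v : qform S v <= opnorm S * l2norm v ^+ 2.
Proof.
rewrite /qform -mulmxA (le_trans (ler_norm _))//.
rewrite (le_trans (l2norm_cauchy_schwarz _ _))//.
by rewrite mulrC expr2 mulrA ler_wpM2r ?l2norm_ge0 ?l2norm_mulmx_le.
Qed.

End euclidean_norm.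

Section precision_bounds.
Context {R : realType} (p : nat) (S0 Q : 'M[R]_p).
Hypotheses (S0p : sym_posdef S0) (Qp : sym_posdef Q).
Hypothesis S0Q : forall v, qform (invmx S0) v <= qform Q v.

(** Cauchy-Schwarz for S0, applied to u and S0^-1 v: the energy of S0^-1 v under S0 is that
of v under S0^-1, which Q dominates. *)
Lemma dot_sqr_le (u v : 'cV[R]_p) :
  ((u^T *m v) ord0 ord0) ^+ 2 <= qform S0 u * qform Q v.
Proof.
have := posdef_cauchy_schwarz u (invmx S0 *m v) S0p.
rewrite qform_invmx// /bform -mulmxA mulKVmx ?posdef_unit// => h.
by rewrite (le_trans h)// ler_wpM2l ?posdef_qform_ge0.
Qed.

Lemma qform_invmx_dot (b : 'cV[R]_p) :
  qform Q (invmx Q *m b) = (b^T *m (invmx Q *m b)) ord0 ord0.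
Proof. by rewrite qform_invmx// /qform mulmxA. Qed.

(** With v = Q^-1 b, |v|^4 <= (v, S0 v) (v, Q v) and (v, Q v) = (b, v) <= |b| |v|.
This route needs neither eigenvalues nor square roots of matrices. *)
Lemma l2norm_precision_solve (b : 'cV[R]_p) :
  l2norm (invmx Q *m b) <= opnorm S0 * l2norm b.
Proof.
set v := invmx Q *m b.
have [v0|v0] := eqVneq (l2norm v) 0.
  by rewrite v0 mulr_ge0 ?opnorm_ge0 ?l2norm_ge0.
have nv : 0 < l2norm v by rewrite lt0r v0 l2norm_ge0.
have h := dot_sqr_le v v.
have qQ : qform Q v <= l2norm b * l2norm v.
  by rewrite qform_invmx_dot (le_trans (ler_norm _))// l2norm_cauchy_schwarz.
have hS := qform_le_opnorm S0 v.
have : l2norm v ^+ 2 * l2norm v ^+ 2 <=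
    (opnorm S0 * l2norm v ^+ 2) * (l2norm b * l2norm v).
  rewrite -sqr_l2normE in h.
  rewrite -expr2 (le_trans h)//; apply: ler_pM => //; exact: posdef_qform_ge0.
have -> : opnorm S0 * l2norm v ^+ 2 * (l2norm b * l2norm v) =
  (opnorm S0 * l2norm b) * (l2norm v ^+ 2 * l2norm v) by ring.
have -> : l2norm v ^+ 2 * l2norm v ^+ 2 = l2norm v * (l2norm v ^+ 2 * l2norm v) by ring.
by rewrite ler_pM2r// mulr_gt0// exprn_gt0.
Qed.

(** Entrywise on the diagonal: [dot_sqr_le] at a basis vector e and Q^-1 e reads
q^2 <= s q, where q and s are the diagonal entries of Q^-1 and S0. *)
Lemma trace_precision_le : \tr (invmx Q) <= \tr S0.
Proof.
apply: ler_sum => i _.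
pose e : 'cV[R]_p := delta_mx i ord0.
have eE (M : 'M[R]_p) : qform M e = M i i.
  rewrite /qform /e trmx_delta -rowE -colE !mxE.
  by [].
have h := dot_sqr_le e (invmx Q *m e).
rewrite qform_invmx_dot // in h.
have d : (e^T *m (invmx Q *m e)) ord0 ord0 = invmx Q i i by rewrite mulmxA -eE.
rewrite d eE in h.
have Q0 : 0 <= invmx Q i i by rewrite -eE posdef_qform_ge0//; exact: posdef_invmx.
have S00 : 0 <= S0 i i by rewrite -eE posdef_qform_ge0.
have [q0|q0] := eqVneq (invmx Q i i) 0; first by rewrite q0.
by move: h; rewrite expr2 ler_pM2r// lt0r q0.
Qed.

End precision_bounds.

(** * Gaussian densities *)

Lemma col_mx_sub_head (R : realType) p (u : R) (w : 'cV[R]_p) (m : 'cV[R]_(1 + p)) :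
  col_mx u%:M w - m = col_mx (u - usubmx m ord0 ord0)%:M (w - dsubmx m).
Proof.
rewrite -[in LHS](vsubmxK m) opp_col_mx add_col_mx; congr (col_mx _ _).
by rewrite [in LHS](mx11_scalar (usubmx m)) !scalar_mx_is_additive.
Qed.

Lemma gauss_complete_square (R : realType) p (Q : 'M[R]_(1 + p)) (u : R) (w m : 'cV[R]_p) :
  sym_posdef Q ->
  expR (- qform Q (col_mx u%:M (w - m)) / 2) =
  expR (- qform (schur_D Q) (w - (m - u *: (invmx (schur_D Q) *m schur_b Q))) / 2) *
  expR (- (schur_s Q * u ^+ 2) / 2).
Proof.
move=> Qp; rewrite (schur_complete_square Qp) -expRD; congr expR.
have -> : w - m + u *: (invmx (schur_D Q) *m schur_b Q) =
    w - (m - u *: (invmx (schur_D Q) *m schur_b Q)) by rewrite opprB addrA addrAC.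
by rewrite -mulrDl -opprD.
Qed.

Section lebesgue_cV_integral.
Context {R : realType}.
Local Open Scope ereal_scope.

Lemma ge0_integral_lebesgue_cVS p (f : 'cV[R]_p.+1 -> \bar R) :
  measurable_fun setT f -> (forall x, 0 <= f x) ->
  \int[lebesgue_cV p.+1]_x f x =
  \int[@lebesgue_measure R]_u \int[lebesgue_cV p]_w f (cons_cV (u, w)).
Proof.
move=> mf f0.
have mc := @measurable_cons_cV R p.
transitivity (\int[image_measure (lebesgue_measure \x lebesgue_cV p) mc]_x f x).
  exact: eq_measure_integral.
rewrite ge0_integral_image_measure// fubini_tonelli1//.
exact: (measurableT_comp mf mc).
Qed.

Lemma gauss_integral1 (s m : R) : (0 < s)%R ->
  \int[@lebesgue_measure R]_x (expR (- (s * (x - m) ^+ 2) / 2))%:E =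
  (Num.sqrt (2 * pi / s))%:E.
Proof.
move=> s0.
have si0 : (0 < s^-1)%R by rewrite invr_gt0.
pose sg := Num.sqrt s^-1.
have sg0 : (sg != 0)%R by rewrite gt_eqF// sqrtr_gt0.
have sg2 : (sg ^+ 2 = s^-1)%R by rewrite sqr_sqrtr// ltW.
have c0 : (0 < Num.sqrt (2 * pi / s))%R.
  by rewrite sqrtr_gt0 mulr_gt0// mulr_gt0// pi_gt0.
have e x : (expR (- (s * (x - m) ^+ 2) / 2) =
    Num.sqrt (2 * pi / s) * normal_pdf m sg x)%R.
  rewrite normal_pdfE//= /normal_peak /normal_fun sg2.
  have -> : (s^-1 * pi *+ 2 = 2 * pi / s)%R by rewrite -mulr_natl; ring.
  rewrite [RHS]mulrA divff ?gt_eqF// mul1r; congr expR.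
  have sn0 : (s != 0)%R by rewrite gt_eqF.
  by field.
under eq_integral => x _ do rewrite e EFinM.
rewrite ge0_integralZl//.
- by rewrite integral_normal_pdf mule1.
- by apply/measurable_EFinP; exact: measurable_normal_pdf.
- by move=> x _; rewrite lee_fin normal_pdf_ge0.
Qed.

Lemma measurable_qform d (T : measurableType d) p (Q : T -> 'M[R]_p) (f : T -> 'cV[R]_p) :
  measurable_fun setT Q -> measurable_fun setT f ->
  measurable_fun setT (fun x => qform (Q x) (f x)).
Proof.
move=> mQ mf; apply: measurable_entry; apply: measurable_mulmx => //.
by apply: measurable_mulmx => //; exact: measurable_trmx.
Qed.

Lemma measurable_gauss_fun d (T : measurableType d) p (Q : T -> 'M[R]_p) (f : T -> 'cV[R]_p) :
  measurable_fun setT Q -> measurable_fun setT f ->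
  measurable_fun setT (fun x => expR (- qform (Q x) (f x) / 2)).
Proof.
move=> mQ mf; apply: measurableT_comp => //; apply: measurable_funM => //.
by apply: measurable_funN; exact: measurable_qform.
Qed.

Lemma measurable_gauss_shift p (Q : 'M[R]_p) (m : 'cV[R]_p) :
  measurable_fun setT (fun x : 'cV[R]_p => (expR (- qform Q (x - m)%R / 2))%:E).
Proof.
apply/measurable_EFinP; apply: measurable_gauss_fun; first exact: measurable_cst.
by apply: measurable_submx; [exact: measurable_id|exact: measurable_cst].
Qed.

(** Induction on the dimension: integrating out the last coordinates by the induction
hypothesis leaves a one-dimensional Gaussian whose precision is the Schur complement, and the
determinants multiply accordingly. *)
Lemma gauss_integral p (Q : 'M[R]_p) : sym_posdef Q ->
  (0 < \det Q)%R /\ forall m,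
  \int[lebesgue_cV p]_x (expR (- qform Q (x - m) / 2))%:E =
  (Num.sqrt ((2 * pi) ^+ p / \det Q))%:E.
Proof.
elim: p Q => [|p ih] Q Qp.
  split; first by rewrite det_mx00.
  move=> m; rewrite /= integral_dirac//; last exact: measurable_gauss_shift.
  by rewrite diracT mul1e det_mx00 expr0 divr1 sqrtr1 /qform mxE big_ord0 oppr0
    mul0r expR0.
have Qp' : sym_posdef (Q : 'M[R]_(1 + p)) := Qp.
have [D0 ihD] := ih _ (schur_posdefD Qp').
have s0 := schur_s_gt0 Qp'.
have detQ := schur_det Qp'.
split; first by rewrite [\det _]detQ mulr_gt0.
move=> m; rewrite ge0_integral_lebesgue_cVS//; last exact: measurable_gauss_shift.
pose u0 := (usubmx (m : 'cV[R]_(1 + p))) ord0 ord0.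
pose w0 := dsubmx (m : 'cV[R]_(1 + p)).
have inner u : \int[lebesgue_cV p]_w (expR (- qform Q (cons_cV (u, w) - m) / 2))%:E
    = (Num.sqrt ((2 * pi) ^+ p / \det (schur_D (Q : 'M[R]_(1 + p)))))%:E *
      (expR (- (schur_s (Q : 'M[R]_(1 + p)) * (u - u0) ^+ 2) / 2))%:E.
  rewrite -(ihD (w0 - (u - u0) *: (invmx (schur_D (Q : 'M[R]_(1 + p))) *m
    schur_b (Q : 'M[R]_(1 + p))))%R).
  rewrite muleC -ge0_integralZl//.
  - apply: eq_integral => w _; rewrite -EFinM; congr (_%:E).
    rewrite [RHS]mulrC -gauss_complete_square//.
    have -> : (cons_cV (u, w) - m = col_mx (u - u0)%:M (w - w0))%R.
      exact: (col_mx_sub_head u w).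
    by [].
  - exact: measurable_gauss_shift.
under eq_integral => u _ do rewrite inner.
rewrite ge0_integralZl//; last first.
  apply/measurable_EFinP; apply: measurableT_comp => //.
  apply: measurable_funM => //; apply: measurable_funN; apply: measurable_funM => //.
  by apply: measurable_funX; exact: measurable_funB.
rewrite gauss_integral1// -EFinM -sqrtrM; last first.
  by rewrite divr_ge0 ?exprn_ge0 ?mulr_ge0 ?pi_ge0// ltW.
congr (Num.sqrt _)%:E; rewrite detQ exprS.
have := lt0r_neq0 s0; have := lt0r_neq0 D0 => d0 sn0.
move: (pi : R) => q; field; rewrite d0.
by [].
Qed.

End lebesgue_cV_integral.

Section gaussian.
Context {R : realType} (p : nat).
Implicit Types (m x : 'cV[R]_p) (S : 'M[R]_p).
Local Open Scope ereal_scope.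

Lemma gaussian_pdf_ge0 m S x : (0 <= gaussian_pdf m S x)%R.
Proof. by rewrite /gaussian_pdf mulr_ge0 ?expR_ge0// invr_ge0 sqrtr_ge0. Qed.

Lemma measurable_gaussian_pdf d (T : measurableType d)
    (m : T -> 'cV[R]_p) (S : T -> 'M[R]_p) (x : T -> 'cV[R]_p) :
  measurable_fun setT m -> measurable_fun setT S -> measurable_fun setT x ->
  measurable_fun setT (fun t => gaussian_pdf (m t) (S t) (x t)).
Proof.
move=> mm mS mx; rewrite /gaussian_pdf; apply: measurable_funM.
  apply: (measurableT_comp (@measurable_inv R)).
  apply: (measurableT_comp measurable_sqrt).
  by apply: measurable_funM => //; exact: measurable_det.
apply: (@measurable_gauss_fun _ _ _ _ (fun t => invmx (S t)) (fun t => x t - m t)%R).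
  exact: measurable_invmx.
exact: measurable_submx.
Qed.

Lemma measurable_gaussian_pdfx m S : measurable_fun setT (gaussian_pdf m S).
Proof.
by apply: measurable_gaussian_pdf;
  [exact: measurable_cst|exact: measurable_cst|exact: measurable_id].
Qed.

Lemma posdef_det_gt0 (S : 'M[R]_p) : sym_posdef S -> (0 < \det S)%R.
Proof. by move=> Sp; have [] := gauss_integral Sp. Qed.

Lemma gaussian_pdf_gt0 m S x : sym_posdef S -> (0 < gaussian_pdf m S x)%R.
Proof.
move=> Sp; rewrite mulr_gt0 ?expR_gt0// invr_gt0 sqrtr_gt0.
by rewrite mulr_gt0 ?posdef_det_gt0// exprn_gt0// mulr_gt0// pi_gt0.
Qed.

Lemma gaussian_pdf_mass m S : sym_posdef S ->
  \int[lebesgue_cV p]_x (gaussian_pdf m S x)%:E = 1.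
Proof.
move=> Sp; have Su := posdef_unit Sp.
have [Q0 gi] := gauss_integral (posdef_invmx Sp).
have S0 := posdef_det_gt0 Sp.
rewrite /gaussian_pdf; under eq_integral => x _ do rewrite EFinM.
have mg := measurable_gauss_shift (invmx S) m.
rewrite [LHS]ge0_integralZl//.
rewrite gi -EFinM det_inv invrK mulVf// gt_eqF// sqrtr_gt0 mulr_gt0//.
by rewrite exprn_gt0// mulr_gt0// pi_gt0.
Qed.

(** By completing the square; it makes the moment generating function a total mass. *)
Lemma gaussian_pdf_tilt m S (theta x : 'cV[R]_p) : sym_posdef S ->
  (expR ((theta^T *m x) ord0 ord0) * gaussian_pdf m S x =
  expR ((theta^T *m m) ord0 ord0 + qform S theta / 2) *
    gaussian_pdf (m + S *m theta) S x)%R.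
Proof.
move=> Sp; rewrite /gaussian_pdf mulrCA [RHS]mulrCA; congr (_ * _)%R.
rewrite -!expRD; congr expR; rewrite -/(qform _ _) -/(qform _ _).
have Su := posdef_unit Sp; have QT := (posdef_invmx Sp).1.
set z := (x - m)%R.
have -> : (x - (m + S *m theta) = z + (-1) *: (S *m theta))%R.
  by rewrite opprD addrA scaleN1r.
have -> : (theta^T *m x) ord0 ord0 = ((theta^T *m m) ord0 ord0 + (theta^T *m z) ord0 ord0)%R.
  have -> : (theta^T *m x = theta^T *m m + theta^T *m z)%R.
    by rewrite /z mulmxBr addrC subrK.
  by rewrite [LHS]mxE.
rewrite (qformD _ _ QT) bformZr !qformE bformZ bformZr -!qformE.
have -> : bform (invmx S) z (S *m theta) = (theta^T *m z) ord0 ord0.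
  by rewrite (bformC _ _ QT) /bform trmx_mul Sp.1 mulmxK.
have -> : qform (invmx S) (S *m theta) = qform S theta.
  by rewrite /qform trmx_mul Sp.1 mulmxK// mulmxA.
by field.
Qed.

Lemma gaussian_mgf m S (theta : 'cV[R]_p) : sym_posdef S ->
  \int[lebesgue_cV p]_x (expR ((theta^T *m x) ord0 ord0) * gaussian_pdf m S x)%:E =
  (expR ((theta^T *m m) ord0 ord0 + qform S theta / 2))%:E.
Proof.
move=> Sp; under eq_integral => x _ do rewrite gaussian_pdf_tilt// EFinM.
rewrite ge0_integralZl//.
- by rewrite gaussian_pdf_mass// mule1.
- by apply/measurable_EFinP; exact: measurable_gaussian_pdfx.
- by move=> x _; rewrite lee_fin gaussian_pdf_ge0.
Qed.

(** A lower bound of an exponential moment by a second moment, which makes the latter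
accessible from the moment generating function. *)
Lemma cosh_ge_sqr (v : R) : (2 + v ^+ 2 <= expR v + expR (- v))%R.
Proof.
have -> : (expR v + expR (- v) = 2 * cosh v)%R by rewrite /cosh; field.
have := cosh_sub1 v; have := sqr_le_sinh (v / 2).
have -> : ((v / 2) ^+ 2 = v ^+ 2 / 4)%R by field.
by rewrite -mulr_natr; lra.
Qed.

(** Integrating 2 + (t x_i)^2 <= exp(t x_i) + exp(-t x_i) gives
2 + t^2 I <= 2 exp(t^2 s / 2) cosh(t m_i), and the second order expansion at t = 0 gives
I <= m_i^2 + s. Writing q for t^2, the expansion is made explicit as
I (1 - q (m_i^2 + s)) <= m_i^2 + s for small q. This spares the differentiation under the integral
sign. *)
Lemma gaussian_coord_moment m S (i : 'I_p) : sym_posdef S ->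
  \int[lebesgue_cV p]_x (x i ord0 ^+ 2 * gaussian_pdf m S x)%:E <=
  (m i ord0 ^+ 2 + S i i)%:E.
Proof.
move=> Sp; set s := S i i; set mi := m i ord0.
have mpdf := measurable_gaussian_pdfx m S.
pose e (t : R) : 'cV[R]_p := t *: delta_mx i ord0.
have eE t (x : 'cV[R]_p) : ((e t)^T *m x) ord0 ord0 = (t * x i ord0)%R.
  rewrite mxE (bigD1 i)//= big1 ?addr0; last first.
    by move=> j ji; rewrite !mxE (negbTE ji)/= mulr0 mul0r.
  by rewrite !mxE !eqxx/= mulr1.
have qe t : qform S (e t) = (t ^+ 2 * s)%R.
  rewrite /qform -mulmxA eE /e -scalemxAr mxE -colE mxE.
  by rewrite mulrA -expr2.
have s0 : (0 <= s)%R.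
  by have := posdef_qform_ge0 (e 1%R) Sp; rewrite qe expr1n mul1r.
have mx2 : measurable_fun setT (fun x : 'cV[R]_p => x i ord0 ^+ 2 * gaussian_pdf m S x)%R.
  apply: measurable_funM => //; apply: measurable_funX.
  by apply: measurable_entry; exact: measurable_id.
have mEp : measurable_fun setT (fun x => (gaussian_pdf m S x)%:E).
  exact/measurable_EFinP.
have mEq : measurable_fun setT (fun x : 'cV[R]_p => (x i ord0 ^+ 2 * gaussian_pdf m S x)%:E).
  exact/measurable_EFinP.
have p0 x : 0 <= (gaussian_pdf m S x)%:E by rewrite lee_fin gaussian_pdf_ge0.
have qq0 (x : 'cV[R]_p) : 0 <= (x i ord0 ^+ 2 * gaussian_pdf m S x)%:E.
  by rewrite EFinM mule_ge0// lee_fin sqr_ge0.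
set I := (X in X <= _).
have I0 : 0 <= I.
  by apply: integral_ge0 => x _; rewrite lee_fin mulr_ge0 ?sqr_ge0 ?gaussian_pdf_ge0.
(* The integrated form of [cosh_ge_sqr] at t * x_i. *)
have key t : (t ^+ 2)%:E * I + 2%:E <=
    (expR (t ^+ 2 * s / 2) * (expR (t * mi) + expR (- (t * mi))))%:E.
  have -> : (expR (t ^+ 2 * s / 2) * (expR (t * mi) + expR (- (t * mi))))%:E =
     \int[lebesgue_cV p]_x ((expR (t * x i ord0) + expR (- (t * x i ord0)))
       * gaussian_pdf m S x)%:E.
    under eq_integral => x _ do rewrite mulrDl EFinD.
    rewrite ge0_integralD//; last 4 first.
    - by move=> x _; rewrite lee_fin mulr_ge0 ?expR_ge0 ?gaussian_pdf_ge0.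
    - apply/measurable_EFinP; apply: measurable_funM => //.
      apply: measurableT_comp => //; apply: measurable_funM => //.
      by apply: measurable_entry; exact: measurable_id.
    - by move=> x _; rewrite lee_fin mulr_ge0 ?expR_ge0 ?gaussian_pdf_ge0.
    - apply/measurable_EFinP; apply: measurable_funM => //.
      apply: measurableT_comp => //; apply: measurable_funN; apply: measurable_funM => //.
      by apply: measurable_entry; exact: measurable_id.
    have h1 := gaussian_mgf m (e t) Sp; have h2 := gaussian_mgf m (e (- t)%R) Sp.
    rewrite qe eE in h1; rewrite qe eE in h2.
    under eq_integral => x _ do rewrite -eE.
    rewrite h1; under eq_integral => x _ do rewrite -mulNr -eE.
    rewrite h2 -EFinD sqrrN; congr (_%:E).
    by rewrite !expRD mulrDr mulNr [X in (X + _)%R]mulrC [X in (_ + X)%R]mulrC.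
  have -> : 2%:E = \int[lebesgue_cV p]_x (2%:E * (gaussian_pdf m S x)%:E).
    by rewrite ge0_integralZl// gaussian_pdf_mass// mule1.
  have t0 : 0 <= (t ^+ 2)%:E by rewrite lee_fin sqr_ge0.
  have tq0 (x : 'cV[R]_p) : 0 <= (t ^+ 2)%:E * (x i ord0 ^+ 2 * gaussian_pdf m S x)%:E.
    by rewrite mule_ge0.
  have p20 x : 0 <= 2%:E * (gaussian_pdf m S x)%:E by rewrite mule_ge0.
  have mtq : measurable_fun setT
      (fun x : 'cV[R]_p => (t ^+ 2)%:E * (x i ord0 ^+ 2 * gaussian_pdf m S x)%:E).
    exact: measurable_funeM.
  have mp2 : measurable_fun setT (fun x : 'cV[R]_p => 2%:E * (gaussian_pdf m S x)%:E).
    exact: measurable_funeM.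
  rewrite /I -ge0_integralZl// -ge0_integralD//.
  apply: ge0_le_integral => //.
  - by move=> x _; rewrite adde_ge0.
  - exact: emeasurable_funD.
  - apply/measurable_EFinP; apply: measurable_funM => //.
    have mc : measurable_fun setT (fun x : 'cV[R]_p => t * x i ord0)%R.
      apply: measurable_funM => //; apply: measurable_entry; exact: measurable_id.
    apply: measurable_funD; apply: measurableT_comp => //; exact: measurable_funN.
  - move=> x _; rewrite -EFinM -EFinD lee_fin mulrA -mulrDl.
    rewrite ler_wpM2r ?gaussian_pdf_ge0// -exprMn addrC; exact: cosh_ge_sqr.
have Ifin : I \is a fin_num.
  have := key 1%R; rewrite expr1n mul1e ge0_fin_numE// => h.
  rewrite (@le_lt_trans _ _ (I + 2%:E))//; first by rewrite leeDl.
  by rewrite (le_lt_trans h)// ltry.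
rewrite -(fineK Ifin) lee_fin.
have {}key t : (t ^+ 2 * fine I + 2 <= expR (t ^+ 2 * s / 2) * (2 * cosh (t * mi)))%R.
  have := key t; rewrite -[in X in X -> _](fineK Ifin) -EFinM -EFinD lee_fin.
  by have -> : (2 * cosh (t * mi) = expR (t * mi) + expR (- (t * mi)))%R
    by rewrite /cosh; field.
set J := fine I in key *.
have J0 : (0 <= J)%R by rewrite fine_ge0.
set c := (mi ^+ 2 + s)%R.
have c0 : (0 <= c)%R by rewrite addr_ge0// sqr_ge0.
have kq (q : R) : (0 < q)%R -> (q * c <= 1)%R -> (J * (1 - q * c) <= c)%R.
  move=> q0 qc.
  have := key (Num.sqrt q); rewrite sqr_sqrtr ?(ltW q0)//.
  set v := (Num.sqrt q * mi)%R => kv.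
  have v2 : (v ^+ 2 = q * mi ^+ 2)%R by rewrite /v exprMn sqr_sqrtr// ltW.
  have e2 : (expR (q * s / 2) ^+ 2 * (1 - q * s) <= 1)%R.
    rewrite expr2 -expRD -splitr.
    have h := expR_ge1Dx (- (q * s)); rewrite expRN in h.
    by rewrite -ler_pdivlMl ?expR_gt0// mulr1.
  have cv : (cosh v ^+ 2 * (1 - q * mi ^+ 2) <= 1)%R.
    rewrite -v2; have := sinh_le_sqr v; have := cosh2sinh2 v; nra.
  have a0 : (0 <= q * s)%R by rewrite mulr_ge0// ltW.
  have b0 : (0 <= q * mi ^+ 2)%R by rewrite mulr_ge0 ?sqr_ge0// ltW.
  move: qc; rewrite /c mulrDr => qc.
  set E := expR (q * s / 2) in kv e2.
  have E0 : (0 < E)%R by exact: expR_gt0.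
  have C0 := cosh_gt0 v.
  set A := (q * s)%R in a0 qc e2 *; set B := (q * mi ^+ 2)%R in b0 qc cv *.
  set Y := (E * cosh v)%R.
  have Y0 : (0 <= Y)%R by rewrite mulr_ge0// ltW.
  have Y2 : (Y ^+ 2 * (1 - (B + A)) <= 1)%R.
    apply: (@le_trans _ _ ((E ^+ 2 * (1 - A)) * (cosh v ^+ 2 * (1 - B)))%R).
      have -> : (E ^+ 2 * (1 - A) * (cosh v ^+ 2 * (1 - B)) =
        Y ^+ 2 * (1 - (B + A)) + Y ^+ 2 * (A * B))%R by rewrite /Y; ring.
      by rewrite lerDl mulr_ge0 ?sqr_ge0// mulr_ge0.
    have A1 : (0 <= 1 - A)%R by lra.
    have B1 : (0 <= 1 - B)%R by lra.
    by rewrite -[leRHS]mulr1; apply: ler_pM => //; rewrite mulr_ge0 ?sqr_ge0.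
  have YJ : (1 + q * J / 2 <= Y)%R by rewrite /Y; move: kv; lra.
  have qJ0 : (0 <= q * J)%R by rewrite mulr_ge0// ltW.
  have Y2' : (1 + q * J <= Y ^+ 2)%R.
    apply: (@le_trans _ _ ((1 + q * J / 2) ^+ 2)%R).
      by have := sqr_ge0 (q * J / 2); nra.
    by rewrite ler_sqr ?nnegrE//; lra.
  have w0 : (0 <= 1 - (B + A))%R by lra.
  have h : ((1 + q * J) * (1 - (B + A)) <= 1)%R.
    by apply: le_trans Y2; rewrite ler_wpM2r.
  rewrite -(ler_pM2l q0) mulrA -/c.
  have -> : (q * c = B + A)%R by rewrite /c mulrDr.
  by lra.
rewrite leNgt; apply/negP => cJ.
have d0 : (0 < c * J + 1)%R by rewrite ltr_wpDl// mulr_ge0.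
have d1 : (0 < c + 1)%R by rewrite ltr_wpDl.
(* If c < J, this q is small enough to contradict [kq]. *)
pose q := (Num.min (c + 1)^-1 ((J - c) / (2 * (c * J + 1))))%R.
have q0 : (0 < q)%R.
  by rewrite lt_min invr_gt0 d1/= divr_gt0// ?mulr_gt0// subr_gt0.
have qc : (q * c <= 1)%R.
  apply: (@le_trans _ _ ((c + 1)^-1 * c)%R); first by rewrite ler_wpM2r// ge_min lexx.
  by rewrite ler_pdivrMl// mulr1 lerDl.
have := kq q q0 qc.
have q2 : (q * (2 * (c * J + 1)) <= J - c)%R.
  rewrite -ler_pdivlMr; last by rewrite mulr_gt0.
  by rewrite ge_min lexx orbT.
have : (0 <= q * c * J)%R by rewrite !mulr_ge0// ltW.
by lra.
Qed.

Lemma gaussian_sqr_moment m S : sym_posdef S ->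
  \int[lebesgue_cV p]_x (l2norm x ^+ 2 * gaussian_pdf m S x)%:E <=
  (l2norm m ^+ 2 + \tr S)%:E.
Proof.
move=> Sp.
have mpdf := measurable_gaussian_pdfx m S.
under eq_integral => x _ do rewrite sqr_l2norm mulr_suml -sumEFin.
rewrite ge0_integral_sum//; last 2 first.
- move=> i; apply/measurable_EFinP; apply: measurable_funM => //.
  by apply: measurable_funX; apply: measurable_entry; exact: measurable_id.
- by move=> i x _; rewrite lee_fin mulr_ge0 ?sqr_ge0 ?gaussian_pdf_ge0.
rewrite sqr_l2norm /mxtrace -big_split/= -sumEFin; apply: lee_sum => i _.
exact: gaussian_coord_moment.
Qed.

End gaussian.

(** The density in natural parameters: linear part S^-1 m, quadratic part S^-1.
In this form the conjugacy of the Gibbs step is read off by adding exponents. *)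
Lemma gaussian_pdf_exponential (R : realType) p (m : 'cV[R]_p) (S : 'M[R]_p) (x : 'cV[R]_p) :
  sym_posdef S ->
  gaussian_pdf m S x = gaussian_pdf m S 0 *
    expR (((invmx S *m m)^T *m x) ord0 ord0 - qform (invmx S) x / 2).
Proof.
move=> pS; have [symI _] := posdef_invmx pS.
rewrite /gaussian_pdf -mulrA -expRD; congr (_ * expR _).
rewrite -!/(qform _ _) sub0r (qformD _ _ symI).
have -> : qform (invmx S) (- m) = qform (invmx S) m.
  by rewrite -scaleN1r !qformE bformZ bformZr; ring.
have -> : bform (invmx S) x (- m) = - bform (invmx S) x m.
  by rewrite -scaleN1r bformZr mulN1r.
have -> : ((invmx S *m m)^T *m x) ord0 ord0 = bform (invmx S) x m.
  by rewrite (bformC _ _ symI) /bform trmx_mul symI.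
lra.
Qed.

(** * Integrals of bounded functions and iterates of a kernel *)

Section bounded_integrals.
Context d (T : measurableType d) (R : realType).
Implicit Types (m : {measure set T -> \bar R}) (g : T -> R).

Lemma integrable_bounded m (M : R) g (A B : R) : m setT = M%:E ->
  measurable_fun setT g -> (forall x, A <= g x <= B) -> m.-integrable setT (EFin \o g).
Proof.
move=> mM mg gAB; apply: measurable_bounded_integrable => //.
  by rewrite mM ltry.
exists (Num.max `|A| `|B|); split; first exact: num_real.
move=> c cAB x _; have /andP[gA gB] := gAB x.
apply: (le_trans _ (ltW cAB)); rewrite /= ler_norml; apply/andP; split.
  by rewrite (le_trans _ gA)// lerNl (le_trans (ler_norm _))// normrN le_max lexx.
by rewrite (le_trans gB)// (le_trans (ler_norm _))// le_max lexx orbT.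
Qed.

Lemma integrable_dominated m (W g : T -> R) : measurable_fun setT W ->
  (forall x, 0 <= W x) -> (\int[m]_x (W x)%:E < +oo)%E -> measurable_fun setT g ->
  (forall x, `|g x| <= W x) -> m.-integrable setT (EFin \o g).
Proof.
move=> mW W0 mWoo mg gW; have iW : m.-integrable setT (EFin \o W).
  apply/integrableP; split; first exact/measurable_EFinP.
  by under eq_integral => x _ do rewrite /= ger0_norm//.
apply: le_integrable iW => //; first exact/measurable_EFinP.
by move=> x _ /=; rewrite lee_fin (le_trans (gW x))// ler_norm.
Qed.

Variables (C : set T) (mC : measurable C).

(** Written with an indicator so that its integral is computed by linearity. *)
Definition step_bound (B b : R) (x : T) : R := B + (b - B) * \1_C x.

Lemma step_bound_ge (B b : R) g x : b <= B -> g x <= B -> (C x -> g x <= b) ->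
  g x <= step_bound B b x.
Proof.
move=> bB gB gb; rewrite /step_bound indicE; case: (boolP (x \in C)) => [/set_mem Cx|_].
  by rewrite mulr1 addrC subrK gb.
by rewrite mulr0 addr0.
Qed.

Lemma measurable_step_bound (B b : R) : measurable_fun setT (step_bound B b).
Proof. by apply: measurable_funD => //; apply: measurable_funM. Qed.

Lemma step_bound_bounded (B b : R) x : b <= B -> b <= step_bound B b x <= B.
Proof.
move=> bB; rewrite /step_bound indicE; case: (x \in C).
  by rewrite mulr1 addrC subrK lexx.
by rewrite mulr0 addr0 lexx bB.
Qed.

Lemma Rintegral_step_bound m (M : R) (B b : R) : m setT = M%:E -> b <= B ->
  \int[m]_x step_bound B b x = B * M + (b - B) * fine (m C).
Proof.
move=> mM bB; rewrite RintegralD//.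
- rewrite Rintegral_cst// [m _]mM RintegralZl//.
    rewrite /Rintegral integral_indic// setIT.
    by [].
  apply: (integrable_bounded (A := 0) (B := 1) mM).
    exact: measurable_indic.
  by move=> x; rewrite indicE; case: (_ \in _); rewrite /= lexx ler01.
- apply: (integrable_bounded (A := B) (B := B) mM) => // x.
  by rewrite lexx.
- apply: (integrable_bounded (A := b - B) (B := 0) mM).
    by apply: measurable_funM => //; exact: measurable_indic.
  by move=> x; rewrite indicE; case: (_ \in _); rewrite ?mulr1 ?mulr0 lexx subr_le0 bB.
Qed.

Lemma Rintegral_le_step m (M : R) g (A B b : R) : m setT = M%:E ->
  measurable_fun setT g -> (forall x, A <= g x <= B) -> b <= B ->
  (forall x, C x -> g x <= b) ->
  \int[m]_x g x <= B * M + (b - B) * fine (m C).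
Proof.
move=> mM mg gAB bB gb; rewrite -(Rintegral_step_bound mM bB).
apply: le_Rintegral => //.
- exact: (integrable_bounded mM mg gAB).
- apply: (integrable_bounded mM (measurable_step_bound B b) (A := b) (B := B)).
  by move=> x; exact: step_bound_bounded.
- move=> x _; apply: step_bound_ge => //; last exact: gb.
  by case/andP: (gAB x).
Qed.

Lemma RintegralN_bounded m (M : R) g (A B : R) : m setT = M%:E ->
  measurable_fun setT g -> (forall x, A <= g x <= B) ->
  \int[m]_x (- g x) = - \int[m]_x g x.
Proof.
move=> mM mg gAB; under eq_Rintegral do rewrite -mulN1r.
by rewrite RintegralZl ?mulN1r//; exact: (integrable_bounded mM mg gAB).
Qed.

Lemma Rintegral_ge_step m (M : R) g (A B a : R) : m setT = M%:E ->
  measurable_fun setT g -> (forall x, A <= g x <= B) -> A <= a ->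
  (forall x, C x -> a <= g x) ->
  A * M + (a - A) * fine (m C) <= \int[m]_x g x.
Proof.
move=> mM mg gAB Aa ga.
have mNg : measurable_fun setT (fun x => - g x) by exact: measurable_funN.
have gN x : - B <= - g x <= - A by rewrite !lerN2 andbC gAB.
have := Rintegral_le_step mM mNg gN (_ : - a <= - A).
rewrite lerN2 Aa => /(_ isT).
have gNa x : C x -> - g x <= - a by rewrite lerN2; exact: ga.
move=> /(_ gNa); rewrite (RintegralN_bounded mM mg gAB); lra.
Qed.

(** The function step_bound - g is nonnegative, so its ms-integral is at most its
m-integral; rearranging, the common component ms keeps the exact value of the integral and only
the residual measure m - ms is estimated by the step function. *)
Lemma Rintegral_le_minor m (ms : {measure set T -> \bar R}) (M e : R) g (A B b : R) :
  m setT = M%:E -> ms setT = e%:E ->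
  (forall h : T -> \bar R, measurable_fun setT h -> (forall x, 0 <= h x)%E ->
     (\int[ms]_x h x <= \int[m]_x h x)%E) ->
  measurable_fun setT g -> (forall x, A <= g x <= B) -> b <= B ->
  (forall x, C x -> g x <= b) ->
  \int[m]_x g x <= \int[ms]_x g x + B * (M - e) + (b - B) * (fine (m C) - fine (ms C)).
Proof.
move=> mM mse minor mg gAB bB gb.
pose h x := step_bound B b x - g x.
have h0 x : 0 <= h x.
  rewrite subr_ge0; apply: step_bound_ge => //; last exact: gb.
  by case/andP: (gAB x).
have mh : measurable_fun setT h.
  by apply: measurable_funB => //; exact: measurable_step_bound.
have sb x := step_bound_bounded x bB.
have hb x : 0 <= h x <= B - A.
  rewrite h0/= /h; have /andP[gA gB] := gAB x; have /andP[_ sB] := sb x.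
  by rewrite lerB.
have mb := measurable_step_bound B b.
have Ih (mu : {measure set T -> \bar R}) N : mu setT = N%:E ->
    \int[mu]_x h x = B * N + (b - B) * fine (mu C) - \int[mu]_x g x.
  move=> muN; rewrite RintegralB//.
  - by rewrite (Rintegral_step_bound muN).
  - by apply: (integrable_bounded muN mb (A := b) (B := B)) => x; exact: sb.
  - exact: (integrable_bounded muN mg gAB).
have : \int[ms]_x h x <= \int[m]_x h x.
  rewrite /Rintegral fine_le//.
  - apply: integrable_fin_num => //; exact: (integrable_bounded mse mh hb).
  - apply: integrable_fin_num => //; exact: (integrable_bounded mM mh hb).
  - by apply: minor; [exact/measurable_EFinP|move=> x; rewrite lee_fin].
rewrite (Ih _ _ mM) (Ih _ _ mse); lra.
Qed.

Lemma Rintegral_ge_minor m (ms : {measure set T -> \bar R}) (M e : R) g (A B a : R) :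
  m setT = M%:E -> ms setT = e%:E ->
  (forall h : T -> \bar R, measurable_fun setT h -> (forall x, 0 <= h x)%E ->
     (\int[ms]_x h x <= \int[m]_x h x)%E) ->
  measurable_fun setT g -> (forall x, A <= g x <= B) -> A <= a ->
  (forall x, C x -> a <= g x) ->
  \int[ms]_x g x + A * (M - e) + (a - A) * (fine (m C) - fine (ms C)) <= \int[m]_x g x.
Proof.
move=> mM mse minor mg gAB Aa ga.
have mNg : measurable_fun setT (fun x => - g x) by exact: measurable_funN.
have gN x : - B <= - g x <= - A by rewrite !lerN2 andbC gAB.
have := Rintegral_le_minor mM mse minor mNg gN (_ : - a <= - A).
rewrite lerN2 Aa => /(_ isT).
have gNa x : C x -> - g x <= - a by rewrite lerN2; exact: ga.
move=> /(_ gNa).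
rewrite (RintegralN_bounded mM mg gAB) (RintegralN_bounded mse mg gAB); lra.
Qed.

End bounded_integrals.

Section kernel_integrals.
Context {R : realType} {d : measure_display} {T : measurableType d}.
Variable P : R.-pker T ~> T.
Local Open Scope ereal_scope.

Lemma measurable_kernel_integral (k : R.-spker T ~> T) (f : T -> \bar R) :
  measurable_fun setT f -> (forall x, 0 <= f x) ->
  measurable_fun setT (fun x => \int[k x]_y f y).
Proof.
move=> mf f0; apply: measurable_fun_integral_kernel => //.
by move=> U mU; exact: measurable_kernel.
Qed.

Lemma integral_mkcomp_noparam (k1 k2 : R.-spker T ~> T) x (f : T -> \bar R) :
  measurable_fun setT f -> (forall x, 0 <= f x) ->
  \int[mkcomp_noparam k1 k2 x]_z f z = \int[k1 x]_y \int[k2 y]_z f z.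
Proof.
move=> mf f0.
exact: (@integral_kcomp _ _ _ _ _ _ _ k1 (kernel.kernel_snd k2 : R.-spker (T * T)%type ~> T)
  x f f0 mf).
Qed.

Lemma integral_kernel_iter0 x (f : T -> \bar R) : measurable_fun setT f ->
  \int[kernel_iter P 0 x]_y f y = f x.
Proof.
move=> mf; rewrite /= /kdirac integral_dirac//.
by rewrite diracT mul1e.
Qed.

Lemma integral_kernel_iterS t x (f : T -> \bar R) :
  measurable_fun setT f -> (forall x, 0 <= f x) ->
  \int[kernel_iter P t.+1 x]_z f z = \int[P x]_y \int[kernel_iter P t y]_z f z.
Proof. by move=> mf f0; exact: integral_mkcomp_noparam. Qed.

Lemma integral_kernel_iterSr t x (f : T -> \bar R) :
  measurable_fun setT f -> (forall x, 0 <= f x) ->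
  \int[kernel_iter P t.+1 x]_z f z = \int[kernel_iter P t x]_y \int[P y]_z f z.
Proof.
move=> mf f0; have mPf := measurable_kernel_integral P mf f0.
have Pf0 y : 0 <= \int[P y]_z f z by exact: integral_ge0.
elim: t x => [|t ih] x.
  rewrite integral_kernel_iter0// integral_kernel_iterS//.
  by apply: eq_integral => y _; rewrite integral_kernel_iter0.
rewrite integral_kernel_iterS// integral_kernel_iterS//.
by apply: eq_integral => y _; exact: ih.
Qed.

Lemma kernel_iter_setT t x : kernel_iter P t x setT = 1.
Proof.
elim: t x => [|t ih] x; first by rewrite /= /kdirac diracT.
rewrite -[LHS]mul1e -integral_cst// integral_kernel_iterS//.
transitivity (\int[P x]_y (1 : \bar R)).
  by apply: eq_integral => y _; rewrite integral_cst// mul1e ih.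
by rewrite integral_cst// mul1e prob_kernel.
Qed.

Variable Pi : probability T R.
Hypothesis PiP : invariant_measure P Pi.

Lemma integral_invariant (f : T -> \bar R) :
  measurable_fun setT f -> (forall x, 0 <= f x) ->
  \int[Pi]_x \int[P x]_y f y = \int[Pi]_x f x.
Proof.
move=> mf f0.
pose k1 : R.-spker T ~> T := kprobability (measurable_cst (Pi : pprobability T R)).
rewrite -(integral_mkcomp_noparam k1 P point mf f0).
by apply: eq_measure_integral => A mA _; exact: PiP.
Qed.

Lemma integral_invariant_iter t (f : T -> \bar R) :
  measurable_fun setT f -> (forall x, 0 <= f x) ->
  \int[Pi]_x \int[kernel_iter P t x]_y f y = \int[Pi]_x f x.
Proof.
elim: t f => [|t ih] f mf f0.
  by apply: eq_integral => x _; rewrite integral_kernel_iter0.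
have mPf := measurable_kernel_integral P mf f0.
have Pf0 y : 0 <= \int[P y]_z f z by exact: integral_ge0.
under eq_integral => x _ do rewrite integral_kernel_iterSr//.
by rewrite ih// integral_invariant.
Qed.

End kernel_integrals.

(** * The two-level contraction rate *)

Section rate_recursion.
Context {R : realType}.

(** The pair (u_t, v_t) of bounds for the oscillations over the space and over the small
set C, when C has mass at least g after any step and a mass e is common to the laws of the steps
from C. *)
Fixpoint osc_rate (t : nat) (g e : R) : R * R :=
  if t is t'.+1 then
    let: (u, v) := osc_rate t' g e in
    (g * v + (1 - g) * u,
     Num.max (g - e) 0 * v + (1 - e - Num.max (g - e) 0) * u)
  else (1, 1).

Lemma osc_rateS t g e : osc_rate t.+1 g e =
  (g * (osc_rate t g e).2 + (1 - g) * (osc_rate t g e).1,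
   Num.max (g - e) 0 * (osc_rate t g e).2 +
   (1 - e - Num.max (g - e) 0) * (osc_rate t g e).1).
Proof. by rewrite /=; case: osc_rate. Qed.

(** Eliminating v: both cases of the maximum give the same formula in terms of
min and max, whose characteristic roots are the two lambdas. *)
Lemma osc_rate_recurrence t g e : (osc_rate t.+2 g e).1 =
  (1 - Num.min g e) * (osc_rate t.+1 g e).1 +
  Num.min g e * (1 - Num.max e g) * (osc_rate t g e).1.
Proof.
rewrite !osc_rateS; case: (osc_rate t g e) => u v /=.
have [ge|eg] := leP g e.
  rewrite max_r ?subr_le0//; ring.
rewrite max_l ?subr_ge0 ?(ltW eg)//; ring.
Qed.

Section rho.
Variables (g e : R).
Hypotheses (g01 : 0 < g < 1) (e01 : 0 < e <= 1).
Let m := Num.min g e.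
Let M := Num.max e g.

Let m01 : 0 < m < 1.
Proof. by rewrite lt_min gt_min; case/andP: g01 => -> ->; case/andP: e01 => ->. Qed.

Let M01 : 0 < M <= 1.
Proof. by rewrite lt_max ge_max; case/andP: g01 => -> /ltW ->; case/andP: e01 => -> ->. Qed.

Let disc_gt0 : 0 < lambda_disc g e.
Proof.
rewrite /lambda_disc sqrtr_gt0 -/m -/M; case/andP: m01 => m0 m1; case/andP: M01 => M0 M1.
by rewrite ltr_pwDl ?exprn_gt0 ?subr_gt0// !mulr_ge0 ?subr_ge0// ltW.
Qed.

Let disc_sqr : lambda_disc g e ^+ 2 = (1 - m) ^+ 2 + 4 * m * (1 - M).
Proof.
rewrite /lambda_disc sqr_sqrtr// -/m -/M; case/andP: m01 => m0 m1; case/andP: M01 => M0 M1.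
by rewrite addr_ge0 ?sqr_ge0// !mulr_ge0 ?subr_ge0// ltW.
Qed.

Let lam_sub : lambda_plus g e - lambda_minus g e = lambda_disc g e.
Proof. by rewrite /lambda_plus /lambda_minus; field. Qed.

Lemma rho_recurrence t :
  rho t.+2 g e = (1 - m) * rho t.+1 g e + m * (1 - M) * rho t g e.
Proof.
rewrite /rho lam_sub; have d0 := lt0r_neq0 disc_gt0.
have sm : lambda_plus g e + lambda_minus g e = 1 - m.
  by rewrite /lambda_plus /lambda_minus -/m; field.
have pr : lambda_plus g e * lambda_minus g e = - (m * (1 - M)).
  rewrite /lambda_plus /lambda_minus -/m.
  have -> : (1 - m + lambda_disc g e) / 2 * ((1 - m - lambda_disc g e) / 2) =
    ((1 - m) ^+ 2 - lambda_disc g e ^+ 2) / 4 by field.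
  by rewrite disc_sqr; field.
have pr' : m * (1 - M) = - (lambda_plus g e * lambda_minus g e) by rewrite pr opprK.
rewrite pr' -sm !exprS; field.
exact: d0.
Qed.

Lemma rho_osc_rate t : rho t g e = (osc_rate t g e).1.
Proof.
suff : rho t g e = (osc_rate t g e).1 /\ rho t.+1 g e = (osc_rate t.+1 g e).1.
  by case.
elim: t => [|t [ih1 ih2]].
  have d0 := lt0r_neq0 disc_gt0; rewrite /rho lam_sub /= !expr0 !expr1.
  have ld := lam_sub; split.
    by rewrite -ld in d0 *; field.
  by rewrite -ld in d0 *; field.
by split => //; rewrite osc_rate_recurrence rho_recurrence ih1 ih2.
Qed.

Lemma osc_rate_bounds t : 0 <= (osc_rate t g e).2 <= (osc_rate t g e).1.
Proof.
case/andP: g01 => g0 g1; case/andP: e01 => e0 e1.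
elim: t => [|t]; first by rewrite /= ler01 lexx.
rewrite osc_rateS; case: (osc_rate t g e) => u v /= /andP[v0 vu].
have u0 := le_trans v0 vu.
have [ge|eg] := leP (g - e) 0.
  rewrite mul0r add0r subr0 mulr_ge0 ?subr_ge0//=.
  have ge' : g <= e by rewrite -subr_le0.
  have h1 := mulr_ge0 (ltW g0) v0.
  have : (1 - e) * u <= (1 - g) * u by rewrite ler_wpM2r// lerB.
  by lra.
have h1 : 0 <= (g - e) * v by rewrite mulr_ge0// ltW.
have h2 : 0 <= (1 - e - (g - e)) * u by rewrite mulr_ge0//; lra.
have h3 : 0 <= e * v by rewrite mulr_ge0// ltW.
by apply/andP; split; lra.
Qed.

Lemma osc_rate_decr t : (osc_rate t.+1 g e).1 <= (osc_rate t g e).1.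
Proof.
have := osc_rate_bounds t; rewrite osc_rateS/=; case: (osc_rate t g e) => u v /= /andP[v0 vu].
case/andP: g01 => g0 g1.
have : g * v <= g * u by rewrite ler_wpM2l// ltW.
by lra.
Qed.

Lemma rho_ge0 t : 0 <= rho t g e.
Proof. by rewrite rho_osc_rate; case/andP: (osc_rate_bounds t) => /le_trans h /h. Qed.

(** In the recurrence, rho_(t+1) <= rho_t lets one replace both terms by rho_t, with
coefficient (1 - m) + m (1 - M) = 1 - m M, and m M = g e. *)
Lemma rho_even_le t : rho (2 * t) g e <= (1 - g * e) ^+ t.
Proof.
have mM : m * M = g * e.
  by rewrite /m /M; have [h|h] := leP g e; rewrite ?(max_l h) ?(max_r (ltW h))// mulrC.
have ge1 : 0 <= 1 - g * e.
  case/andP: g01 => g0 g1; case/andP: e01 => e0 e1.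
  by rewrite subr_ge0 mulr_ile1// ltW.
elim: t => [|t ih]; first by rewrite muln0 rho_osc_rate.
rewrite mulnS addnC addn2 rho_recurrence exprS.
apply: (@le_trans _ _ ((1 - g * e) * rho (2 * t) g e)); last by rewrite ler_wpM2l.
have := osc_rate_decr (2 * t); rewrite -!rho_osc_rate => dec.
case/andP: m01 => m0 m1.
have : (1 - m) * rho (2 * t).+1 g e <= (1 - m) * rho (2 * t) g e.
  by rewrite ler_wpM2l// subr_ge0 ltW.
rewrite -mM; set r0 := rho _ _ _; set r1 := rho _ _ _; lra.
Qed.

End rho.
End rate_recursion.

Section tv_bound.
Context {R : realType} {d : measure_display} {T : measurableType d}.
Variables (P : R.-pker T ~> T) (Pi : probability T R).
Hypothesis PiP : invariant_measure P Pi.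
Variables (C : set T) (mC : measurable C) (g e : R) (ms : {measure set T -> \bar R}).
Hypotheses (g01 : 0 < g < 1) (e01 : 0 < e <= 1).
Hypothesis PC : forall x, (g%:E <= P x C)%E.
Hypothesis msT : ms setT = e%:E.
Hypothesis minor : forall x, C x -> forall h : T -> \bar R,
  measurable_fun setT h -> (forall y, 0 <= h y)%E ->
  (\int[ms]_y h y <= \int[P x]_y h y)%E.

Definition iterate_fun (f : T -> R) (t : nat) (x : T) : R :=
  \int[kernel_iter P t x]_y f y.

Let PT x : P x setT = 1%:E. Proof. exact: prob_kernel. Qed.

Lemma measurable_iterate_fun (f : T -> R) t : measurable_fun setT f -> (forall x, 0 <= f x) ->
  measurable_fun setT (iterate_fun f t).
Proof.
move=> mf f0; apply: measurableT_comp => //.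
apply: measurable_kernel_integral; first exact/measurable_EFinP.
by move=> x; rewrite lee_fin.
Qed.

Lemma iterate_funE (f : T -> R) t x : measurable_fun setT f -> (forall x, 0 <= f x <= 1) ->
  (iterate_fun f t x)%:E = (\int[kernel_iter P t x]_y (f y)%:E)%E.
Proof.
move=> mf f01; rewrite /iterate_fun /Rintegral fineK//.
apply: integrable_fin_num => //.
exact: (integrable_bounded (kernel_iter_setT P t x) mf f01).
Qed.

Lemma iterate_funS (f : T -> R) t x : measurable_fun setT f -> (forall x, 0 <= f x <= 1) ->
  iterate_fun f t.+1 x = \int[P x]_y iterate_fun f t y.
Proof.
move=> mf f01; rewrite {1}/iterate_fun /Rintegral; congr fine.
rewrite integral_kernel_iterS; last 2 first.
- exact/measurable_EFinP.
- by move=> y; rewrite lee_fin; case/andP: (f01 y).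
by apply: eq_integral => y _; rewrite iterate_funE.
Qed.

(** The induction carries actual intervals [A, B] and [a, b] that contain the values of
P^t f on the space and on C. The step from a point of C uses the minorization: the integral
against ms is the same at both ends of the new interval, so it cancels in the length. *)
Lemma iterate_fun_range (f : T -> R) t : measurable_fun setT f -> (forall x, 0 <= f x <= 1) ->
  exists A B a b : R, [/\ A <= a, b <= B,
    forall x, A <= iterate_fun f t x <= B,
    forall x, C x -> a <= iterate_fun f t x <= b &
    B - A <= (osc_rate t g e).1 /\ b - a <= (osc_rate t g e).2].
Proof.
move=> mf f01; have f0 x : 0 <= f x by case/andP: (f01 x).
elim: t => [|t [A [B [a [b [Aa bB gAB gab [uAB vab]]]]]]].
  have i0 x : iterate_fun f 0 x = f x.
    apply: EFin_inj; rewrite iterate_funE//.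
    by rewrite (integral_kernel_iter0 P x (f := EFin \o f))//; exact/measurable_EFinP.
  exists 0, 1, 0, 1; split => //.
  - by move=> x; rewrite i0.
  - by move=> x _; rewrite i0.
  - by rewrite /= subr0.
pose h := iterate_fun f t.
have mh : measurable_fun setT h by exact: measurable_iterate_fun.
have ha x : C x -> a <= h x by move=> /gab /andP[].
have hb x : C x -> h x <= b by move=> /gab /andP[].
case/andP: g01 => g0 g1; case/andP: e01 => e0 e1.
have Pfin x : P x C \is a fin_num.
  rewrite ge0_fin_numE// (@le_lt_trans _ _ (P x setT))//; last by rewrite PT ltry.
  by apply: le_measure; rewrite ?inE.
have PC' x : g <= fine (P x C) by rewrite -lee_fin fineK.
(* A lower bound for the residual mass of C, after a step from C, once the common
   component is removed. *)
pose D := Num.max (g - e) 0.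
have D0 : 0 <= D by rewrite le_max lexx orbT.
have msC x : C x -> D <= fine (P x C) - fine (ms C).
  move=> Cx; have mfin : ms C \is a fin_num.
    rewrite ge0_fin_numE// (@le_lt_trans _ _ (ms setT))//; last by rewrite msT ltry.
    by apply: le_measure; rewrite ?inE.
  have c1 : fine (ms C) <= fine (P x C).
    rewrite fine_le//.
    have := minor Cx (h := fun y => (\1_C y)%:E).
    rewrite !integral_indic// !setIT; apply.
      by apply/measurable_EFinP; exact: measurable_indic.
    by move=> y; rewrite lee_fin.
  have c2 : fine (ms C) <= e.
    rewrite -lee_fin fineK// -msT; apply: le_measure; rewrite ?inE//.
  rewrite ge_max subr_ge0 c1 andbT; have := PC' x; lra.
pose B' := B + (b - B) * g.
pose A' := A + (a - A) * g.
pose b' := \int[ms]_x h x + B * (1 - e) + (b - B) * D.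
pose a' := \int[ms]_x h x + A * (1 - e) + (a - A) * D.
have bnd x : A' <= iterate_fun f t.+1 x <= B'.
  rewrite iterate_funS//; apply/andP; split.
    apply: le_trans (Rintegral_ge_step mC (PT x) mh gAB Aa ha).
    by rewrite mulr1 lerD2l ler_wpM2l ?subr_ge0.
  apply: (le_trans (Rintegral_le_step mC (PT x) mh gAB bB hb)).
  by rewrite mulr1 lerD2l ler_wnM2l ?subr_le0.
have bndC x : C x -> a' <= iterate_fun f t.+1 x <= b'.
  move=> Cx; rewrite iterate_funS//; apply/andP; split.
    apply: le_trans (Rintegral_ge_minor mC (PT x) msT (minor Cx) mh gAB Aa ha).
    by rewrite lerD2l ler_wpM2l ?subr_ge0 ?msC.
  apply: (le_trans (Rintegral_le_minor mC (PT x) msT (minor Cx) mh gAB bB hb)).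
  by rewrite lerD2l ler_wnM2l ?subr_le0 ?msC.
have U : B' - A' <= (osc_rate t.+1 g e).1.
  rewrite osc_rateS /=.
  have -> : B' - A' = g * (b - a) + (1 - g) * (B - A) by rewrite /B' /A'; ring.
  by rewrite lerD// ler_wpM2l// ?(ltW g0)// subr_ge0 ltW.
have V : b' - a' <= (osc_rate t.+1 g e).2.
  rewrite osc_rateS /= -/D.
  have -> : b' - a' = D * (b - a) + (1 - e - D) * (B - A) by rewrite /b' /a'; ring.
  have De : 0 <= 1 - e - D.
    by rewrite subr_ge0 ge_max; apply/andP; split; lra.
  by rewrite lerD// ler_wpM2l.
(* Intersecting with [A', B'] keeps the interval over C inside the interval over the space. *)
exists A', B', (Num.max a' A'), (Num.min b' B'); split => //.
- by rewrite le_max lexx orbT.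
- by rewrite ge_min lexx orbT.
- move=> x Cx; rewrite ge_max le_min.
  by have /andP[-> ->] := bndC x Cx; have /andP[-> ->] := bnd x.
- split => //; apply: le_trans V.
  by rewrite lerB// ?ge_min ?le_max lexx.
Qed.

(** By invariance the integral of f against Pi is that of P^t f, hence a point of the
interval that contains P^t f. *)
Lemma tv_dist_le_rho t x : (tv_dist (kernel_iter P t x) Pi <= (rho t g e)%:E)%E.
Proof.
apply: ge_ereal_sup => _ [f [mf f01] <-].
have [A [B [a [b [Aa bB gAB gab [uAB vab]]]]]] := iterate_fun_range t mf f01.
have f0 y : 0 <= f y by case/andP: (f01 y).
have mh := measurable_iterate_fun t mf f0.
have PiT : Pi setT = 1%:E by exact: probability_setT.
have iE : (\int[Pi]_y (f y)%:E = (\int[Pi]_y iterate_fun f t y)%:E)%E.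
  rewrite -(integral_invariant_iter PiP t); last 2 first.
  - exact/measurable_EFinP.
  - by move=> y; rewrite lee_fin.
  under eq_integral => y _ do rewrite -iterate_funE//.
  rewrite /Rintegral fineK//; apply: integrable_fin_num => //.
  exact: (integrable_bounded PiT mh gAB).
rewrite iE -iterate_funE// -EFinB/= lee_fin rho_osc_rate//.
have AI : A <= \int[Pi]_y iterate_fun f t y.
  have := Rintegral_ge_step measurable0 PiT mh gAB (lexx A) (fun x => False_ind _).
  by rewrite subrr mul0r addr0 mulr1.
have BI : \int[Pi]_y iterate_fun f t y <= B.
  have := Rintegral_le_step measurable0 PiT mh gAB (lexx B) (fun x => False_ind _).
  by rewrite subrr mul0r addr0 mulr1.
have /andP[xA xB] := gAB x.
by apply: le_trans uAB; rewrite ler_norml; apply/andP; split; lra.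
Qed.

End tv_bound.

(** * Weighted and Wasserstein distances *)

Section weighted.
Context {R : realType} {d : measure_display} {T : measurableType d}.
Variables (P : R.-pker T ~> T) (Pi : probability T R).
Hypothesis PiP : invariant_measure P Pi.
Variables (V : T -> R) (K : R).
Hypotheses (mV : measurable_fun setT V) (V0 : forall x, 0 <= V x) (K0 : 0 <= K).
Hypothesis PV : forall x, (\int[P x]_y (V y)%:E <= K%:E)%E.

Let W x := 1 + V x.
Let W0 x : 0 <= W x. Proof. by rewrite addr_ge0. Qed.
Let mW : measurable_fun setT W. Proof. exact: measurable_funD. Qed.
Let mWE : measurable_fun setT (EFin \o W). Proof. exact/measurable_EFinP. Qed.
Let K1 : 0 < 1 + K. Proof. by rewrite ltr_pwDl. Qed.

(** An affine change of variable maps [-M, M] to [0, 1]. *)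
Lemma tv_dist_bounded (mu nu : {measure set T -> \bar R}) (r M : R) (h : T -> R) :
  mu setT = 1%:E -> nu setT = 1%:E -> (tv_dist mu nu <= r%:E)%E -> 0 < M ->
  measurable_fun setT h -> (forall x, - M <= h x <= M) ->
  `|\int[mu]_x h x - \int[nu]_x h x| <= 2 * M * r.
Proof.
move=> mu1 nu1 tv M0 mh hM.
pose f x := (h x + M) / (2 * M).
have M2 : 0 < 2 * M by rewrite mulr_gt0.
have f01 x : 0 <= f x <= 1.
  have /andP[h1 h2] := hM x.
  by rewrite /f ler_pdivrMr// mul1r divr_ge0 ?(ltW M2)//=; lra.
have mf : measurable_fun setT f.
  by apply: measurable_funM => //; exact: measurable_funD.
have fE (m : {measure set T -> \bar R}) : m setT = 1%:E ->
    (\int[m]_x (f x)%:E = ((\int[m]_x h x + M) / (2 * M))%:E)%E.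
  move=> m1; have ih := integrable_bounded m1 mh hM.
  have -> : (\int[m]_x (f x)%:E = (\int[m]_x f x)%:E)%E.
    rewrite /Rintegral fineK//; apply: integrable_fin_num => //.
    exact: (integrable_bounded m1 mf f01).
  rewrite /f RintegralZr//; last first.
    apply: (integrable_bounded (A := 0) (B := 2 * M) m1).
      exact: measurable_funD.
    by move=> x; have /andP[h1 h2] := hM x; apply/andP; split; lra.
  rewrite RintegralD//; last first.
    by apply: (integrable_bounded (A := M) (B := M) m1) => // x; rewrite lexx.
  by rewrite Rintegral_cst// [m _]m1 mulr1.
have : (`|\int[mu]_x (f x)%:E - \int[nu]_x (f x)%:E| <= r%:E)%E.
  by apply: le_trans tv; apply: ereal_sup_ubound; exists f.
rewrite !fE// -EFinB/= lee_fin -mulrBl opprD addrACA subrr addr0.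
by rewrite normrM (gtr0_norm (x := _^-1)) ?invr_gt0// ler_pdivrMr// mulrC.
Qed.

Let kernel_fun (f : T -> R) (y : T) : R := \int[P y]_z f z.

Let PW x : (\int[P x]_y (W y)%:E <= (1 + K)%:E)%E.
Proof.
rewrite /W; under eq_integral => y _ do rewrite EFinD.
rewrite ge0_integralD//; last 2 first.
- by move=> y _; rewrite lee_fin.
- exact/measurable_EFinP.
by rewrite integral_cst// mul1e [P x _]prob_kernel EFinD leeD2l.
Qed.

(** The law nu is that of one P-step started from mu. For the signed f,
the identity is obtained by adding the integrable weight W, which makes everything nonnegative,
and subtracting it again. *)
Lemma integral_weighted_disintegration (mu nu : {measure set T -> \bar R}) (f : T -> R) :
  mu setT = 1%:E ->
  (forall h : T -> \bar R, measurable_fun setT h -> (forall x, 0 <= h x)%E ->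
    (\int[nu]_x h x = \int[mu]_x \int[P x]_y h y)%E) ->
  measurable_fun setT f -> (forall x, `|f x| <= W x) ->
  [/\ (\int[nu]_x (f x)%:E = (\int[mu]_x kernel_fun f x)%:E)%E,
      measurable_fun setT (kernel_fun f) &
      forall x, - (1 + K) <= kernel_fun f x <= 1 + K].
Proof.
move=> mu1 dis mf fW.
have K1oo : ((1 + K)%:E < +oo :> \bar R)%E by rewrite ltry.
have iP x := integrable_dominated mW W0 (le_lt_trans (PW x) K1oo) mf fW.
have WW x : `|W x| <= W x by rewrite ger0_norm.
have iPW x := integrable_dominated mW W0 (le_lt_trans (PW x) K1oo) mW WW.
have PfE x : (\int[P x]_y (f y)%:E = (kernel_fun f x)%:E)%E.
  by rewrite /kernel_fun /Rintegral fineK// integrable_fin_num.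
have PWE x : (\int[P x]_y (W y)%:E = (kernel_fun W x)%:E)%E.
  by rewrite /kernel_fun /Rintegral fineK// integrable_fin_num.
have bPf x : - (1 + K) <= kernel_fun f x <= 1 + K.
  rewrite -ler_norml -lee_fin (le_trans _ (PW x))// /kernel_fun.
  rewrite EFin_normr_Rintegral//; apply: (le_trans (le_abse_integral _ _ _)) => //.
    exact/measurable_EFinP.
  apply: ge0_le_integral => //.
  - by apply: measurableT_comp => //; exact/measurable_EFinP.
  - by move=> y _; rewrite lee_fin.
have bPW x : 0 <= kernel_fun W x <= 1 + K.
  by rewrite -!lee_fin -PWE PW andbT; apply: integral_ge0 => y _; rewrite lee_fin.
have mPW : measurable_fun setT (kernel_fun W).
  apply: measurableT_comp => //; apply: measurable_kernel_integral => //.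
(* This function is nonnegative, so that Tonelli applies. *)
pose fW2 x := f x + W x.
have fW20 x : 0 <= fW2 x by rewrite /fW2 -lerBlDr sub0r; have := fW x; rewrite ler_norml => /andP[].
have mfW2 : measurable_fun setT fW2 by exact: measurable_funD.
have PfWE x : kernel_fun fW2 x = kernel_fun f x + kernel_fun W x.
  by rewrite /kernel_fun RintegralD.
have mPfW : measurable_fun setT (kernel_fun fW2).
  apply: measurableT_comp => //; apply: measurable_kernel_integral.
    exact/measurable_EFinP.
  by move=> x; rewrite lee_fin.
have mPf : measurable_fun setT (kernel_fun f).
  rewrite (_ : kernel_fun f = (fun x => kernel_fun fW2 x - kernel_fun W x)).
    exact: measurable_funB.
  by apply/funext => x; rewrite PfWE addrK.
split => //.
have PfW2E x : (\int[P x]_y (fW2 y)%:E = (kernel_fun fW2 x)%:E)%E.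
  rewrite /kernel_fun /Rintegral fineK// integrable_fin_num//.
  exact: (integrableD measurableT (iP x) (iPW x)).
have nuW : (\int[nu]_x (W x)%:E = (\int[mu]_x kernel_fun W x)%:E)%E.
  rewrite dis//.
  under eq_integral => x _ do rewrite PWE.
  rewrite /Rintegral fineK//; apply: integrable_fin_num => //.
  exact: (integrable_bounded mu1 mPW bPW).
have nuf : (\int[nu]_x (fW2 x)%:E = (\int[mu]_x kernel_fun fW2 x)%:E)%E.
  rewrite dis//; last exact/measurable_EFinP.
  under eq_integral => x _ do rewrite PfW2E.
  rewrite /Rintegral fineK//; apply: integrable_fin_num => //.
  apply: (integrable_bounded mu1 mPfW (A := - (1 + K)) (B := (1 + K) + (1 + K))) => x.
  by rewrite PfWE; have /andP[? ?] := bPf x; have /andP[? ?] := bPW x; apply/andP; split; lra.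
have nuWoo : (\int[nu]_x (W x)%:E < +oo)%E by rewrite nuW ltry.
have inuf := integrable_dominated mW W0 nuWoo mf fW.
have inuW := integrable_dominated mW W0 nuWoo mW WW.
have : (\int[nu]_x (fW2 x)%:E = \int[nu]_x (f x)%:E + \int[nu]_x (W x)%:E)%E.
  by rewrite -integralD//; apply: eq_integral => x _; rewrite /fW2 EFinD.
rewrite nuf nuW.
have -> : \int[mu]_x kernel_fun fW2 x = \int[mu]_x kernel_fun f x + \int[mu]_x kernel_fun W x.
  rewrite -RintegralD//.
  - by under eq_Rintegral do rewrite PfWE.
  - exact: (integrable_bounded mu1 mPf bPf).
  - exact: (integrable_bounded mu1 mPW bPW).
move: (\int[nu]_x (f x)%:E)%E => [z| |]//.
by rewrite EFinD -!EFinD => -[] /addIr ->.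
Qed.

(** Conditioning on the state before the last step replaces f by P f, which is bounded by
1 + K; the total variation at time t does the rest. *)
Lemma weighted_dist_le t x (r : R) : (tv_dist (kernel_iter P t x) Pi <= r%:E)%E ->
  (weighted_dist W (kernel_iter P (t + 1) x) Pi <= (2 * (1 + K) * r)%:E)%E.
Proof.
move=> tv; apply: ge_ereal_sup => _ [f [mf fW] <-]; rewrite addn1.
have PiT : Pi setT = 1%:E by exact: probability_setT.
have [-> mPf bPf] := integral_weighted_disintegration (kernel_iter_setT P t x)
  (fun h mh h0 => integral_kernel_iterSr P t x mh h0) mf fW.
have [-> _ _] := integral_weighted_disintegration PiT
  (fun h mh h0 => esym (integral_invariant PiP mh h0)) mf fW.
rewrite -EFinB/= lee_fin.
exact: (tv_dist_bounded (kernel_iter_setT P t x) PiT tv K1 mPf bPf).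
Qed.

Lemma kernel_iter_weight_fin t x : (\int[kernel_iter P (t + 1) x]_y (W y)%:E < +oo)%E.
Proof.
have WW y : `|W y| <= W y by rewrite ger0_norm.
rewrite addn1; have [-> _ _] := integral_weighted_disintegration (kernel_iter_setT P t x)
  (fun h mh h0 => integral_kernel_iterSr P t x mh h0) mW WW.
by rewrite ltry.
Qed.

Lemma invariant_weight_fin : (\int[Pi]_y (W y)%:E < +oo)%E.
Proof.
have WW y : `|W y| <= W y by rewrite ger0_norm.
have PiT : Pi setT = 1%:E by exact: probability_setT.
have [-> _ _] := integral_weighted_disintegration PiT
  (fun h mh h0 => esym (integral_invariant PiP mh h0)) mW WW.
by rewrite ltry.
Qed.

End weighted.

Section mass_one.
Context d (T : measurableType d) (R : realType) (m : {measure set T -> \bar R}).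
Hypothesis m1 : m setT = 1%E.

(** A copy of m indexed by the proof of its total mass, to which the structure of
probability can be attached. *)
Definition mass_one of m setT = 1%E : set T -> \bar R := m.

HB.instance Definition _ := Measure.on (mass_one m1).

HB.instance Definition _ := Measure_isProbability.Build _ _ _ (mass_one m1) m1.

Definition probability_of_mass_one : probability T R := mass_one m1.

End mass_one.

Lemma adde_exchange (R : realType) (x y z : \bar R) :
  x \is a fin_num -> y \is a fin_num -> z \is a fin_num ->
  (y + z = x + z + (y - x))%E.
Proof.
by move: x y z => [x| |] [y| |] [z| |]// _ _ _; rewrite -!EFinD; congr EFin; ring.
Qed.

Section coupling_bound.
Context {R : realType} {d : measure_display} {T : measurableType d}.
Variables (mu nu : probability T R) (W : T -> R) (dist : T -> T -> R).
Hypotheses (mW : measurable_fun setT W) (W0 : forall x, (0 <= W x)%R).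
Hypotheses (mdist : measurable_fun setT (fun z : T * T => dist z.1 z.2)).
Hypotheses (dist0 : forall x y, (0 <= dist x y)%R) (distxx : forall x, dist x x = 0%R).
Hypothesis distW : forall x y, (dist x y <= W x + W y)%R.
Local Open Scope ereal_scope.
Hypotheses (muW : \int[mu]_x (W x)%:E < +oo) (nuW : \int[nu]_x (W x)%:E < +oo).

Let sigma : {charge set T -> \bar R} :=
  cadd (charge_of_finite_measure mu) (copp (charge_of_finite_measure nu)).

Let sigmaE A : sigma A = mu A - nu A.
Proof. by []. Qed.

(** With the Hahn decomposition of mu - nu, write mu = m0 + a and nu = m0 + b with
a and b carried by disjoint sets and of the same mass delta. The coupling keeps m0 on the diagonal
and moves a to b independently; its cost is at most the sum of the integrals of W against a and b,
and that sum is the difference of the integrals under mu and nu of the function equal to W on one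
Hahn set and to - W on the other. *)
Lemma wasserstein_le_weighted :
  wasserstein dist mu nu <= weighted_dist W mu nu.
Proof.
have [Pp [N HD]] := Hahn_decomposition sigma.
have [[mP _] [mN _] PN PN0] := HD.
pose a := jordan_pos HD; pose b := jordan_neg HD.
have muPN A : measurable A -> mu A = mu (A `&` Pp) + mu (A `&` N).
  move=> mA; rewrite -{1}(setIT A) -PN setIUr measureU//; try exact: measurableI.
  by rewrite setIACA setIid PN0 setI0.
have nuPN A : measurable A -> nu A = nu (A `&` Pp) + nu (A `&` N).
  move=> mA; rewrite -{1}(setIT A) -PN setIUr measureU//; try exact: measurableI.
  by rewrite setIACA setIid PN0 setI0.
have aE A : measurable A -> a A = mu (A `&` Pp) - nu (A `&` Pp).
  move=> mA; rewrite /a jordan_posE cjordan_posE /crestr0 mem_set//.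
have finmu A : measurable A -> mu A \is a fin_num by exact: fin_num_measure.
have finnu A : measurable A -> nu A \is a fin_num by exact: fin_num_measure.
have bE A : measurable A -> b A = nu (A `&` N) - mu (A `&` N).
  move=> mA; have mAN : measurable (A `&` N) by exact: measurableI.
  rewrite /b jordan_negE cjordan_negE /crestr0 mem_set// [crestr _ _ _]sigmaE.
  by rewrite fin_num_oppeB ?finnu ?finmu// addeC.
pose m0 : {measure set T -> \bar R} := measure_add (mrestr nu mP) (mrestr mu mN).
have m0E A : m0 A = nu (A `&` Pp) + mu (A `&` N) by exact: measure_addE.
have muE A : measurable A -> mu A = m0 A + a A.
  move=> mA; rewrite m0E aE// muPN//.
  by apply: adde_exchange; rewrite ?finnu ?finmu//; exact: measurableI.
have nuE A : measurable A -> nu A = m0 A + b A.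
  move=> mA; rewrite m0E bE// nuPN// addeC [X in _ = X + _]addeC.
  by apply: adde_exchange; rewrite ?finnu ?finmu//; exact: measurableI.
have aT : a Pp = a setT.
  by rewrite !aE// setIid setTI.
have aN : a N = 0.
  by rewrite aE// setIC PN0 !measure0 subee.
have bP : b Pp = 0.
  by rewrite bE// PN0 !measure0 subee.
have abT : a setT = b setT.
  have e1 := muE setT measurableT; have e2 := nuE setT measurableT.
  rewrite probability_setT in e1; rewrite probability_setT in e2.
  have m0T : m0 setT \is a fin_num.
    by rewrite m0E fin_numD finnu ?finmu// setTI.
  by rewrite -[LHS](addeK _ m0T) [X in X - _]addeC -e1 e2 [X in X - _]addeC addeK.
have mWE : measurable_fun setT (EFin \o W) by exact/measurable_EFinP.
have W0E x : 0 <= (EFin \o W) x by rewrite lee_fin.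
have Imu (h : T -> \bar R) : measurable_fun setT h -> (forall x, 0 <= h x) ->
    \int[mu]_x h x = \int[m0]_x h x + \int[a]_x h x.
  move=> mh h0; rewrite -ge0_integral_measure_add//.
  apply: eq_measure_integral => A mA _.
  by rewrite [RHS](measure_addE m0 a A); exact: muE.
have Inu (h : T -> \bar R) : measurable_fun setT h -> (forall x, 0 <= h x) ->
    \int[nu]_x h x = \int[m0]_x h x + \int[b]_x h x.
  move=> mh h0; rewrite -ge0_integral_measure_add//.
  apply: eq_measure_integral => A mA _.
  by rewrite [RHS](measure_addE m0 b A); exact: nuE.
pose WP x : R := (W x * \1_Pp x)%R; pose WN x : R := (W x * \1_N x)%R.
have WP0 x : 0 <= (EFin \o WP) x by rewrite lee_fin mulr_ge0.
have WN0 x : 0 <= (EFin \o WN) x by rewrite lee_fin mulr_ge0.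
have mWPr : measurable_fun setT WP by apply: measurable_funM => //; exact: measurable_indic.
have mWNr : measurable_fun setT WN by apply: measurable_funM => //; exact: measurable_indic.
have mWP : measurable_fun setT (EFin \o WP) by exact/measurable_EFinP.
have mWN : measurable_fun setT (EFin \o WN) by exact/measurable_EFinP.
have indE x : (\1_Pp x + \1_N x = 1 :> R)%R.
  rewrite !indicE; have [xP|xP] := boolP (x \in Pp).
    rewrite memNset ?addr0// => xN.
    by have : (Pp `&` N) x; [split => //; exact/set_mem|rewrite PN0].
  have : (Pp `|` N) x by rewrite PN.
  by case=> [/mem_set xP'|/mem_set ->]; [rewrite xP' in xP|rewrite add0r].
have WPb : \int[b]_x (WP x)%:E = 0.
  transitivity (\int[b]_(x in Pp) (W x)%:E).
    rewrite [RHS]integral_mkcond; apply: eq_integral => x _.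
    by rewrite epatch_indic.
  by apply: null_set_integral => //; exact: measurable_funTS.
have WNa : \int[a]_x (WN x)%:E = 0.
  transitivity (\int[a]_(x in N) (W x)%:E).
    rewrite [RHS]integral_mkcond; apply: eq_integral => x _.
    by rewrite epatch_indic.
  by apply: null_set_integral => //; exact: measurable_funTS.
have WE (m : {measure set T -> \bar R}) :
    \int[m]_x (W x)%:E = \int[m]_x (WP x)%:E + \int[m]_x (WN x)%:E.
  rewrite -ge0_integralD//; last 2 first.
  - by move=> x _; exact: WP0.
  - by move=> x _; exact: WN0.
  apply: eq_integral => x _.
  by rewrite -EFinD /WP /WN -mulrDr indE mulr1.
have low : \int[a]_x (W x)%:E + \int[b]_x (W x)%:E <= weighted_dist W mu nu.
  pose f x := (WP x - WN x)%R.
  have mf : measurable_fun setT f by exact: measurable_funB.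
  have fW x : (`|f x| <= W x)%R.
    have e := indE x; rewrite /f /WP /WN -mulrBr normrM ger0_norm// ler_piMr//.
    by move: e; rewrite !indicE; do 2 case: (_ \in _) => /=;
      rewrite ?subr0 ?sub0r ?normrN ?normr1 ?subrr ?normr0//.
  apply: (@le_trans _ _ `|\int[mu]_x (f x)%:E - \int[nu]_x (f x)%:E|); last first.
    by apply: ereal_sup_ubound; exists f.
  have fE (m : {measure set T -> \bar R}) : \int[m]_x (W x)%:E < +oo ->
     \int[m]_x (f x)%:E = \int[m]_x (WP x)%:E - \int[m]_x (WN x)%:E.
    move=> moo.
    have iP : m.-integrable setT (EFin \o WP).
      apply: (integrable_dominated mW W0 moo) => // x;
        rewrite ger0_norm; last by rewrite -lee_fin WP0.
      by rewrite /WP ler_piMr// indicE; case: (_ \in _).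
    have iN : m.-integrable setT (EFin \o WN).
      apply: (integrable_dominated mW W0 moo) => // x;
        rewrite ger0_norm; last by rewrite -lee_fin WN0.
      by rewrite /WN ler_piMr// indicE; case: (_ \in _).
    rewrite -(integralB _ iP iN)//.
  have fin (m : {measure set T -> \bar R}) : \int[m]_x (W x)%:E < +oo ->
      \int[m]_x (WP x)%:E \is a fin_num /\ \int[m]_x (WN x)%:E \is a fin_num.
    rewrite WE => moo.
    have i1 : 0 <= \int[m]_x (WP x)%:E by apply: integral_ge0 => x _; exact: WP0.
    have i2 : 0 <= \int[m]_x (WN x)%:E by apply: integral_ge0 => x _; exact: WN0.
    by rewrite !ge0_fin_numE//; split; apply: le_lt_trans moo; rewrite ?leeDl ?leeDr.
  have [mP1 mN1] := fin _ muW; have [nP1 nN1] := fin _ nuW.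
  rewrite !fE// (WE a) (WE b) WPb WNa adde0 add0e.
  move: mP1 mN1 nP1 nN1.
  rewrite (Imu _ mWP WP0) (Imu _ mWN WN0) (Inu _ mWP WP0) (Inu _ mWN WN0).
  rewrite WPb WNa !adde0.
  have i1 : 0 <= \int[a]_x (WP x)%:E by apply: integral_ge0 => x _; exact: WP0.
  have i2 : 0 <= \int[b]_x (WN x)%:E by apply: integral_ge0 => x _; exact: WN0.
  move: i1 i2; rewrite /comp.
  move: (\int[m0]_x (WP x)%:E) (\int[m0]_x (WN x)%:E) => [p0| |] [n0| |]//.
  move: (\int[a]_x (WP x)%:E) (\int[b]_x (WN x)%:E) => [pa| |] [nb| |]//.
  rewrite !lee_fin => pa0 nb0 _ _ _ _ /=.
  rewrite (_ : pa + nb = p0 + pa - n0 - (p0 - (n0 + nb)))%R; last by ring.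
  exact: ler_norm.
apply: le_trans low; rewrite /wasserstein.
have mdiag : measurable_fun setT (fun x : T => (x, x)) by exact: measurable_fun_pair.
pose delta := fine (a setT).
have afin : a setT \is a fin_num by exact: fin_num_measure.
have delta0 : (0 <= delta)%R by rewrite fine_ge0.
have aTE : a setT = delta%:E by rewrite fineK.
have bTE : b setT = delta%:E by rewrite -abT.
have c0 : (0 <= delta^-1)%R by rewrite invr_ge0.
(* If delta = 0 then a and b vanish, and the value 0 of delta^-1 is the right one. *)
pose G0 : {measure set (T * T)%type -> \bar R} :=
  measure_add (image_measure m0 mdiag) (mscale (NngNum c0) (a \x b)).
have dd A : measurable A -> (delta^-1)%:E * (a A * delta%:E) = a A /\
                            (delta^-1)%:E * (delta%:E * b A) = b A.
  move=> mA; have afA : a A \is a fin_num by exact: fin_num_measure.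
  have bfA : b A \is a fin_num by exact: fin_num_measure.
  (* The product a \x b has total mass delta^2; dividing by delta restores the marginals. *)
  have [d0|d0] := eqVneq delta 0%R.
    have aA : a A = 0.
      by apply/eqP; rewrite -measure_le0 -[leRHS]/(0%R%:E) -d0 -aTE le_measure ?inE.
    have bA : b A = 0.
      by apply/eqP; rewrite -measure_le0 -[leRHS]/(0%R%:E) -d0 -bTE le_measure ?inE.
    by rewrite aA bA !mul0e !mule0.
  rewrite -(fineK afA) -(fineK bfA) -!EFinM; split; congr EFin.
    by rewrite mulrCA mulVf// mulr1.
  by rewrite mulrA mulVf// mul1r.
have G0E A B : measurable A -> measurable B ->
    G0 (A `*` B) = m0 (A `&` B) + (delta^-1)%:E * (a A * b B).
  move=> mA mB; rewrite [LHS]measure_addE image_measureE /= /mscale/=.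
  by rewrite product_measure1E.
have cpl1 A : measurable A -> G0 (A `*` setT) = mu A.
  move=> mA; rewrite G0E// setIT bTE (dd A mA).1; exact/esym/muE.
have cpl2 A : measurable A -> G0 (setT `*` A) = nu A.
  move=> mA; rewrite G0E// setTI aTE (dd A mA).2; exact/esym/nuE.
have GT : G0 setT = 1.
  by rewrite -setXTT cpl1// probability_setT.
pose G : probability (T * T)%type R := probability_of_mass_one GT.
have GG0 (h : T * T -> \bar R) : \int[G]_z h z = \int[G0]_z h z by [].
apply: (@le_trans _ _ (\int[G]_z (dist z.1 z.2)%:E)).
  apply: ereal_inf_lbound; exists G => //= A mA.
  by split; [exact: cpl1|exact: cpl2].
have mdE : measurable_fun setT (fun z : T * T => (dist z.1 z.2)%:E).
  exact/measurable_EFinP.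
have dE0 (z : T * T) : 0 <= (dist z.1 z.2)%:E by rewrite lee_fin.
rewrite GG0 ge0_integral_measure_add// ge0_integral_image_measure//.
rewrite integral0_eq; last by move=> x _; rewrite /= distxx.
rewrite add0e ge0_integral_mscale//=.
have Wa : 0 <= \int[a]_x (W x)%:E by apply: integral_ge0 => x _; rewrite lee_fin.
have Wb : 0 <= \int[b]_x (W x)%:E by apply: integral_ge0 => x _; rewrite lee_fin.
have h : \int[a \x b]_z (dist z.1 z.2)%:E <=
   delta%:E * (\int[a]_x (W x)%:E + \int[b]_x (W x)%:E).
  rewrite fubini_tonelli1//.
  apply: (@le_trans _ _ (\int[a]_x ((W x)%:E * delta%:E + \int[b]_y (W y)%:E))).
    apply: ge0_le_integral => //.
    - by move=> x _; apply: integral_ge0 => y _; rewrite lee_fin.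
    - exact: measurable_fun_fubini_tonelli_F.
    - apply: emeasurable_funD => //; apply: emeasurable_funM => //.
    - move=> x _; rewrite -bTE -(integral_cst b measurableT (W x)%:E).
      rewrite -ge0_integralD//; last 2 first.
      - by move=> y _; rewrite lee_fin.
      - by move=> y _; rewrite lee_fin.
      apply: ge0_le_integral => //.
      - by apply: (measurableT_comp mdE); exact: measurable_pair1.
      - exact: emeasurable_funD.
      - by move=> y _; rewrite -EFinD lee_fin.
  rewrite ge0_integralD//; last 2 first.
  - by move=> x _; rewrite mule_ge0// lee_fin.
  - exact: emeasurable_funM.
  rewrite ge0_integralZr//; last by move=> x _; rewrite lee_fin.
  rewrite [X in _ + X](_ : _ = \int[b]_x (W x)%:E * delta%:E); last first.
    by rewrite -aTE integral_cst.
  by rewrite -ge0_muleDl// muleC.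
apply: (@le_trans _ _ ((delta^-1)%:E * (delta%:E * (\int[a]_x (W x)%:E + \int[b]_x (W x)%:E)))).
  by rewrite lee_wpmul2l// lee_fin.
have [d0|d0] := eqVneq delta 0%R.
  by rewrite d0 mul0e mule0 adde_ge0.
by rewrite muleA -EFinM mulVf// mul1e.
Qed.

End coupling_bound.

(** * Laws with independent coordinates *)

Section joint_law.
Context {R : realType} (n : nat).
Local Open Scope ereal_scope.

Definition box (A : 'I_n -> set R) : set 'cV[R]_n :=
  [set w | forall i, A i (w i ord0)].

Definition boxes : set (set 'cV[R]_n) :=
  [set B | exists2 A, (forall i, measurable (A i)) & B = box A].

Lemma measurable_box A : (forall i, measurable (A i)) -> measurable (box A).
Proof.
move=> mA; rewrite (_ : box A =
    \bigcap_(i in [set: 'I_n]) ((fun w : 'cV[R]_n => w i ord0) @^-1` A i)).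
  apply: fin_bigcap_measurable => // i _.
  by rewrite -[X in measurable X]setTI; apply: measurable_mx_coord.
by apply/seteqP; split=> [w Aw i _|w Aw i]; [exact: Aw|exact: (Aw i Logic.I)].
Qed.

Lemma boxes_generate B : measurable B -> <<s boxes >> B.
Proof.
move=> mB.
have mid : measurable_fun (setT : set (g_sigma_algebraType boxes))
    (fun w : g_sigma_algebraType boxes => (w : 'cV[R]_n)).
  apply: measurable_mxP => i j _ A mA; rewrite setTI (ord1 j).
  apply: sub_sigma_algebra; exists (fun k => if k == i then A else setT).
    by move=> k; case: ifP.
  apply/seteqP; split=> w /= => [Aw k|/(_ i)]; last by rewrite eqxx.
  by case: eqP => // ->.
by have := mid measurableT B mB; rewrite setTI.
Qed.

Lemma boxes_measure_unique (m1 m2 : {measure set 'cV[R]_n -> \bar R}) :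
  m1 setT < +oo -> (forall A, (forall i, measurable (A i)) -> m1 (box A) = m2 (box A)) ->
  forall B, measurable B -> m1 B = m2 B.
Proof.
move=> m1oo m12 B mB.
have bT : boxes setT.
  by exists (fun=> setT) => //; apply/seteqP; split=> w.
apply: (@g_sigma_algebra_measure_unique _ R _ boxes _ (fun=> setT)) => //.
- by move=> _ [A mA ->]; exact: measurable_box.
- exact: bigcup_const.
- move=> _ _ [A mA ->] [A' mA' ->]; exists (fun i => A i `&` A' i).
    by move=> i; exact: measurableI.
  apply/seteqP; split=> w /= => [[wA wA'] i|h]; first by split.
  by split=> i; have [] := h i.
- by move=> _ [A mA ->]; exact: m12.
- exact: boxes_generate.
Qed.

Variables (mu : 'I_n -> probability R R) (nu : probability 'cV[R]_n R).
Hypothesis munu : independent_joint mu nu.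

Lemma joint_finite_marginal (s : seq 'I_n) (A : 'I_n -> set R) : uniq s ->
  (forall k, measurable (A k)) ->
  nu (\bigcap_(k in [set` s]) ((fun w : 'cV[R]_n => w k ord0) @^-1` A k)) =
  \prod_(k <- s) mu k (A k).
Proof.
move=> us mA; pose A' i := if i \in s then A i else setT.
have mA' i : measurable (A' i) by rewrite /A'; case: ifP.
rewrite (_ : \bigcap_(_ in _) _ = box A').
  rewrite munu// (bigID (mem s))/= [X in _ * X]big1 ?mule1; last first.
    by move=> i si; rewrite /A' (negbTE si) probability_setT.
  rewrite [RHS]big_uniq//=; apply: eq_bigr => i si.
  by rewrite /A' si.
apply/seteqP; split=> w /= h i.
  by rewrite /A'; case: ifPn => // si; exact: h.
by move=> /= si; have := h i; rewrite /A' si.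
Qed.

Lemma joint_marginal i A : measurable A ->
  nu ((fun w : 'cV[R]_n => w i ord0) @^-1` A) = mu i A.
Proof.
move=> mA; have := @joint_finite_marginal [:: i] (fun=> A) isT (fun=> mA).
rewrite big_seq1 => <-; congr (nu _).
apply/seteqP; split=> w /= => [Aw k|h]; last by apply: h; exact: mem_head.
by rewrite /= inE => /eqP ->.
Qed.

Lemma joint_independent :
  independent_family nu (fun i (w : 'cV[R]_n) => w i ord0).
Proof.
move=> s A us mA; rewrite joint_finite_marginal//.
by apply: eq_bigr => k _; rewrite joint_marginal.
Qed.

Lemma joint_integral_marginal i (f : R -> R) :
  measurable_fun setT f -> (forall x, 0 <= f x)%R ->
  \int[nu]_w (f (w i ord0))%:E = \int[mu i]_x (f x)%:E.
Proof.
move=> mf f0.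
have mc : measurable_fun setT (fun w : 'cV[R]_n => w i ord0) by exact: measurable_mx_coord.
have mfe : measurable_fun setT (EFin \o f) by exact/measurable_EFinP.
have f0e x : 0 <= (EFin \o f) x by rewrite lee_fin.
rewrite -(ge0_integral_image_measure nu mc mfe f0e).
by apply: eq_measure_integral => A mA _; exact: joint_marginal.
Qed.

Lemma joint_integral_prod (f : 'I_n -> R -> R) :
  (forall i, measurable_fun setT (f i)) -> (forall i x, 0 <= f i x)%R ->
  (forall i, \int[mu i]_x (f i x)%:E < +oo) ->
  \int[nu]_w (\prod_i f i (w i ord0))%:E = \prod_i \int[mu i]_x (f i x)%:E.
Proof.
move=> mf f0 foo.
rewrite (@independent_integral_prod _ _ _ nu _ (fun i (w : 'cV[R]_n) => w i ord0)).
- by apply: eq_bigr => i _; rewrite joint_integral_marginal.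
- by move=> i; exact: measurable_mx_coord.
- exact: joint_independent.
- exact: index_enum_uniq.
- exact: mf.
- exact: f0.
- by move=> i; rewrite joint_integral_marginal.
Qed.

Lemma joint_ae_ge0 : (forall i, mu i [set x | (x < 0)%R] = 0) ->
  \forall w \ae nu, forall i, (0 <= (w : 'cV[R]_n) i ord0)%R.
Proof.
move=> mu0.
have mN := @measurable_negative R.
have : nu.-negligible (\big[setU/set0]_(i < n)
    ((fun w : 'cV[R]_n => w i ord0) @^-1` [set x : R | (x < 0)%R])).
  elim/big_ind : _ => [|A B|i _]; [exact: negligible_set0|exact: negligibleU|].
  apply/negligibleP.
    by rewrite -[X in measurable X]setTI; apply: measurable_mx_coord.
  exact: (etrans (joint_marginal i mN) (mu0 i)).
apply: negligibleS => w /= /existsNP[i /negP]; rewrite -ltNge => wi.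
by rewrite (bigD1 i)//=; left.
Qed.

End joint_law.

Section joint_tilt.
Context {R : realType} (n : nat).
Variables (mu mu' : 'I_n -> probability R R) (nu nu' : probability 'cV[R]_n R).
Hypotheses (munu : independent_joint mu nu) (munu' : independent_joint mu' nu').
Variable f : 'I_n -> R -> R.
Hypotheses (mf : forall i, measurable_fun setT (f i)) (f0 : forall i x, 0 <= f i x).
Hypothesis muf : forall i A, measurable A ->
  mu' i A = (\int[mu i]_(x in A) (f i x)%:E)%E.
Local Open Scope ereal_scope.

Definition joint_weight (w : 'cV[R]_n) : R := (\prod_i f i (w i ord0))%R.

Lemma measurable_joint_weight : measurable_fun setT joint_weight.
Proof.
apply: measurable_prod => i _.
exact: (measurableT_comp (mf i) (measurable_mx_coord i ord0)).
Qed.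

Lemma joint_weight_ge0 w : (0 <= joint_weight w)%R.
Proof. by apply: prodr_ge0. Qed.

(** Both sides are finite measures, equal on boxes by independence. *)
Lemma joint_tilt B : measurable B ->
  nu' B = \int[nu]_(w in B) (joint_weight w)%:E.
Proof.
pose m := density_measure nu measurable_joint_weight joint_weight_ge0.
move=> mB; suff : nu' B = m B by [].
apply: boxes_measure_unique mB => [|A mA].
  have n1 : nu' setT < +oo by rewrite probability_setT ltry.
  exact: n1.
transitivity (\prod_i mu' i (A i)); first exact: munu'.
transitivity (\int[nu]_w (\prod_i (f i (w i ord0) * \1_(A i) (w i ord0)))%:E).
  rewrite (joint_integral_prod munu (f := fun i x => f i x * \1_(A i) x)%R).
  - apply: eq_bigr => i _; rewrite muf// integral_mkcond.
    by apply: eq_integral => x _; rewrite epatch_indic.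
  - by move=> i; apply: measurable_funM => //; exact: measurable_indic.
  - by move=> i x; rewrite mulr_ge0.
  - move=> i; rewrite (@le_lt_trans _ _ (\int[mu i]_x (f i x)%:E))//; last first.
      by rewrite -muf// probability_setT ltry.
    apply: ge0_le_integral => //.
    + by move=> x _; rewrite lee_fin mulr_ge0.
    + by apply/measurable_EFinP; apply: measurable_funM => //; exact: measurable_indic.
    + by apply/measurable_EFinP.
    + by move=> x _; rewrite lee_fin ler_piMr// indicE; case: (_ \in _).
rewrite /m /= /density_measure [RHS]integral_mkcond; apply: eq_integral => w _.
rewrite epatch_indic/= -EFinM big_split/=; congr (_ * _)%:E%R.
rewrite indicE; have [/set_mem wA|wA] := boolP (w \in box A).
  by rewrite big1// => i _; rewrite indicE mem_set//; exact: wA.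
have : ~ box A w by move=> h; move/negP: wA; apply; exact/mem_set.
by move=> /existsNP[i nA]; rewrite (bigD1 i)//= indicE memNset// mul0r.
Qed.

End joint_tilt.

(** * The Polya-Gamma Gibbs kernel *)

Section gibbs.
Context {R : realType} {n p : nat}.
Variables (X : 'M[R]_(n, p)) (y : 'I_n -> bool) (m0 : 'cV[R]_p) (S0 : 'M[R]_p).
Hypothesis hS0 : sym_posdef S0.

(** The latent variables are nonnegative only almost surely; replacing them by their absolute
values makes the Gaussian step well defined and normalized everywhere. *)
Definition absv (w : 'cV[R]_n) : 'cV[R]_n := \col_i `|w i ord0|.

Lemma measurable_absv : measurable_fun setT absv.
Proof.
apply: measurable_mxP => i j; under eq_fun do rewrite mxE.
by apply: measurableT_comp => //; exact: measurable_mx_coord.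
Qed.

Lemma absv_id (w : 'cV[R]_n) : (forall i, 0 <= w i ord0) -> absv w = w.
Proof. by move=> w0; apply/matrixP => i j; rewrite mxE (ord1 j) ger0_norm. Qed.

Definition precision (w : 'cV[R]_n) : 'M[R]_p :=
  X^T *m diag_mx w^T *m X + invmx S0.

Lemma qform_likelihood (w : 'cV[R]_n) (b : 'cV[R]_p) :
  qform (X^T *m diag_mx w^T *m X) b = \sum_i w i ord0 * (X *m b) i ord0 ^+ 2.
Proof.
rewrite /qform !mulmxA -trmx_mul -mulmxA mxE; apply: eq_bigr => i _.
rewrite mul_mx_diag !mxE; ring.
Qed.

Lemma precision_posdef (w : 'cV[R]_n) : (forall i, 0 <= w i ord0) ->
  sym_posdef (precision w).
Proof.
move=> w0; apply: posdef_add; last exact: posdef_invmx.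
  by rewrite !trmx_mul trmxK tr_diag_mx mulmxA.
by move=> v; rewrite qform_likelihood sumr_ge0// => i _; rewrite mulr_ge0 ?sqr_ge0.
Qed.

(** The likelihood only adds information: this domination makes the drift
bound uniform in the latent variables. *)
Lemma precision_ge (w : 'cV[R]_n) v : (forall i, 0 <= w i ord0) ->
  qform (invmx S0) v <= qform (precision w) v.
Proof.
move=> w0; rewrite qform_addmx lerDr qform_likelihood sumr_ge0// => i _.
by rewrite mulr_ge0 ?sqr_ge0.
Qed.

Definition cond_pdf (w : 'cV[R]_n) (x : 'cV[R]_p) : R :=
  gaussian_pdf (m_omega X y m0 S0 w) (Sigma_omega X S0 w) x.

Lemma measurable_Sigma_omega : measurable_fun setT (Sigma_omega X S0).
Proof.
apply: measurable_invmx; apply: measurable_addmx; last exact: measurable_cst.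
apply: measurable_mulmx; last exact: measurable_cst.
apply: measurable_mulmx; first exact: measurable_cst.
by apply: measurable_diag_mx; apply: measurable_trmx; exact: measurable_id.
Qed.

Lemma measurable_cond_pdf :
  measurable_fun setT (fun z : 'cV[R]_n * 'cV[R]_p => cond_pdf z.1 z.2).
Proof.
have mS : measurable_fun setT (fun z : 'cV[R]_n * 'cV[R]_p => Sigma_omega X S0 z.1).
  exact: (measurableT_comp measurable_Sigma_omega measurable_fst).
apply: measurable_gaussian_pdf => //.
by apply: measurable_mulmx => //; exact: measurable_cst.
Qed.

Lemma cond_pdf_ge0 w x : 0 <= cond_pdf w x.
Proof. exact: gaussian_pdf_ge0. Qed.

Lemma Sigma_omega_posdef (w : 'cV[R]_n) : (forall i, 0 <= w i ord0) ->
  sym_posdef (Sigma_omega X S0 w).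
Proof. by move=> w0; apply: posdef_invmx; exact: precision_posdef. Qed.

Lemma cond_pdf_mass (w : 'cV[R]_n) : (forall i, 0 <= w i ord0) ->
  (\int[lebesgue_cV p]_x (cond_pdf w x)%:E = 1)%E.
Proof. by move=> w0; apply: gaussian_pdf_mass; exact: Sigma_omega_posdef. Qed.

Lemma cond_pdf_moment (w : 'cV[R]_n) : (forall i, 0 <= w i ord0) ->
  (\int[lebesgue_cV p]_x (l2norm x ^+ 2 * cond_pdf w x)%:E <=
   (opnorm S0 ^+ 2 * l2norm (X^T *m kappa y + invmx S0 *m m0) ^+ 2 + \tr S0)%:E)%E.
Proof.
move=> w0; have Qp := precision_posdef w0; have QS v := precision_ge v w0.
apply: (le_trans (gaussian_sqr_moment _ (Sigma_omega_posdef w0))).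
rewrite lee_fin; apply: lerD; last exact: (trace_precision_le hS0 Qp QS).
rewrite -exprMn ler_sqr ?nnegrE ?mulr_ge0 ?opnorm_ge0 ?l2norm_ge0//.
exact: (l2norm_precision_solve hS0 Qp QS).
Qed.

(** The density of the joint law of the latent variables at state beta with respect to their
law at state 0. *)
Definition pg_weight (beta : 'cV[R]_p) (w : 'cV[R]_n) : R :=
  \prod_i (cosh ((X *m beta) i ord0 / 2) *
           expR (- ((X *m beta) i ord0 ^+ 2 / 2 * w i ord0))).

Lemma pg_weight_ge0 beta w : 0 <= pg_weight beta w.
Proof. by apply: prodr_ge0 => i _; rewrite mulr_ge0 ?expR_ge0// ltW// cosh_gt0. Qed.

Lemma measurable_pg_weight2 :
  measurable_fun setT (fun z : 'cV[R]_p * 'cV[R]_n => pg_weight z.1 z.2).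
Proof.
apply: measurable_prod => i _.
have mX : measurable_fun setT (fun z : 'cV[R]_p * 'cV[R]_n => (X *m z.1) i ord0).
  apply: measurable_entry; apply: measurable_mulmx; first exact: measurable_cst.
  exact: measurable_fst.
have mc : measurable_fun setT (@cosh R).
  rewrite /cosh; apply: measurable_funM => //; apply: measurable_funD => //.
  by apply: measurableT_comp => //; exact: measurable_funN.
apply: measurable_funM.
  by apply: (measurableT_comp mc); exact: measurable_funM.
apply: measurableT_comp => //; apply: measurable_funN; apply: measurable_funM.
  by apply: measurable_funM => //; exact: measurable_funX.
by apply: measurable_entry; exact: measurable_snd.
Qed.

Lemma measurable_pg_weight beta : measurable_fun setT (pg_weight beta).
Proof.
have h : measurable_fun setT (fun w : 'cV[R]_n => (beta, w)).
  by apply: measurable_fun_pair => //; exact: measurable_cst.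
exact: (measurableT_comp measurable_pg_weight2 h).
Qed.

Local Open Scope ereal_scope.

Lemma measurable_gaussian_prob (A : set 'cV[R]_p) : measurable A ->
  measurable_fun setT
    (fun w => gaussian_prob (m_omega X y m0 S0 w) (Sigma_omega X S0 w) A).
Proof.
move=> mA.
have -> : (fun w => gaussian_prob (m_omega X y m0 S0 w) (Sigma_omega X S0 w) A) =
    (fun w => \int[lebesgue_cV p]_x (cond_pdf w x * \1_A x)%:E).
  apply/funext => w; rewrite /gaussian_prob integral_mkcond.
  by apply: eq_integral => x _; rewrite epatch_indic.
have mI : measurable_fun setT (\1_A : 'cV[R]_p -> R) by exact: measurable_indic.
have mf : measurable_fun setT
    (fun z : 'cV[R]_n * 'cV[R]_p => (cond_pdf z.1 z.2 * \1_A z.2)%:E).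
  apply/measurable_EFinP; apply: measurable_funM; first exact: measurable_cond_pdf.
  exact: (measurableT_comp mI measurable_snd).
apply: (@measurable_fun_fubini_tonelli_F _ _ _ _ _ (lebesgue_cV p) _ mf) => z.
by rewrite lee_fin mulr_ge0 ?cond_pdf_ge0.
Qed.

Variable P : R.-pker 'cV[R]_p ~> 'cV[R]_p.
Hypothesis hP : is_pg_kernel X y m0 S0 P.

Definition step_density (beta : 'cV[R]_p) (z : 'cV[R]_n * 'cV[R]_p) : R :=
  (pg_weight beta (absv z.1) * cond_pdf (absv z.1) z.2)%R.

Lemma step_density_ge0 beta z : (0 <= step_density beta z)%R.
Proof. by rewrite mulr_ge0 ?pg_weight_ge0 ?cond_pdf_ge0. Qed.

Lemma measurable_cond_pdf_abs :
  measurable_fun setT (fun z : 'cV[R]_n * 'cV[R]_p => cond_pdf (absv z.1) z.2).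
Proof.
have h : measurable_fun setT (fun z : 'cV[R]_n * 'cV[R]_p => (absv z.1, z.2)).
  apply: measurable_fun_pair => //.
  exact: (measurableT_comp measurable_absv measurable_fst).
exact: (measurableT_comp measurable_cond_pdf h).
Qed.

Lemma measurable_pg_weight_abs beta :
  measurable_fun setT (fun w : 'cV[R]_n => pg_weight beta (absv w)).
Proof. exact: (measurableT_comp (measurable_pg_weight beta) measurable_absv). Qed.

Lemma measurable_step_density beta : measurable_fun setT (step_density beta).
Proof.
apply: measurable_funM; last exact: measurable_cond_pdf_abs.
exact: (measurableT_comp (measurable_pg_weight_abs beta) measurable_fst).
Qed.

(** All transition laws are written over the single joint law nu0 of the latent variables
at the state 0, so that the state beta only enters through a weight. The Laplace transform in the
third clause expresses that this weight has integral 1 in each coordinate. *)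
Lemma pg_kernel_mixture : exists (mu0 : 'I_n -> probability R R)
    (nu0 : probability 'cV[R]_n R),
  [/\ independent_joint mu0 nu0,
      forall i, mu0 i [set x | (x < 0)%R] = 0,
      forall i (beta : 'cV[R]_p), \int[mu0 i]_x (expR (- ((X *m beta) i ord0 ^+ 2 / 2 * x)))%:E =
        ((cosh ((X *m beta) i ord0 / 2))^-1)%:E &
      forall (beta : 'cV[R]_p) (h : 'cV[R]_p -> \bar R), measurable_fun setT h ->
        (forall x, 0 <= h x) ->
        \int[P beta]_x h x =
        \int[nu0 \x lebesgue_cV p]_z (h z.2 * (step_density beta z)%:E)].
Proof.
have [mu0 [nu0 [pg0 ind0 _]]] := hP 0%R.
have {}pg0 i : is_polya_gamma 1 0 (mu0 i).
  by have := pg0 i; rewrite mulmx0 mxE.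
exists mu0, nu0.
have neg0 i : mu0 i [set x | (x < 0)%R] = 0 by exact: is_polya_gamma_ge0.
have ae0 := joint_ae_ge0 ind0 neg0.
split => //.
  move=> i beta; have [mu [nu [pg _ _]]] := hP beta.
  set c := (X *m beta) i ord0.
  have := is_polya_gamma_tilt (pg0 i) (pg i) measurableT.
  rewrite probability_setT -/c.
  under eq_integral => x _ do rewrite EFinM.
  have mE : measurable_fun setT (fun x : R => (expR (- (c ^+ 2 / 2 * x)))%:E).
    apply/measurable_EFinP; apply: measurableT_comp => //.
    by apply: measurable_funN; exact: measurable_funM.
  have E0 (x : R) : setT x -> 0 <= (expR (- (c ^+ 2 / 2 * x)))%:E.
    by rewrite lee_fin expR_ge0.
  have c0 := cosh_gt0 (c / 2).
  rewrite (ge0_integralZl (mu0 i) measurableT mE E0); last by rewrite lee_fin ltW.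
  case: (\int[mu0 i]_x _) => [z| |]//=.
  - rewrite -EFinM => -[] e; congr EFin.
    by apply: (mulfI (lt0r_neq0 c0)); rewrite -e mulfV ?lt0r_neq0.
  - by rewrite gt0_muley ?lte_fin.
  - by rewrite gt0_muleNy ?lte_fin.
move=> beta h mh h0.
have [mu [nu [pg ind PE]]] := hP beta.
pose f (i : 'I_n) (x : R) : R := (cosh ((X *m beta) i ord0 / 2) *
   expR (- ((X *m beta) i ord0 ^+ 2 / 2 * x)))%R.
have mf i : measurable_fun setT (f i).
  apply: measurable_funM => //; apply: measurableT_comp => //.
  by apply: measurable_funN; exact: measurable_funM.
have f0 i x : (0 <= f i x)%R by rewrite mulr_ge0 ?expR_ge0// ltW// cosh_gt0.
have muf i A : measurable A -> mu i A = \int[mu0 i]_(x in A) (f i x)%:E.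
  by move=> mA; exact: is_polya_gamma_tilt.
have nuE B : measurable B -> nu B = \int[nu0]_(w in B) (pg_weight beta w)%:E.
  by move=> mB; rewrite (joint_tilt ind0 ind mf f0 muf).
pose kap := image_measure (density_measure (nu0 \x lebesgue_cV p)
  (measurable_step_density beta) (step_density_ge0 beta))
  (measurable_snd : measurable_fun setT (@snd 'cV[R]_n 'cV[R]_p)).
have PK A : measurable A -> P beta A = kap A.
  move=> mA; rewrite PE//.
  rewrite (integral_density (measurable_pg_weight beta) (pg_weight_ge0 beta) nuE); last 2 first.
  - exact: measurable_gaussian_prob.
  - by move=> w; apply: integral_ge0 => x _; rewrite lee_fin gaussian_pdf_ge0.
  have mI : measurable_fun setT (\1_A : 'cV[R]_p -> R) by exact: measurable_indic.
  transitivity (\int[nu0 \x lebesgue_cV p]_z (step_density beta z * \1_A z.2)%:E); last first.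
    rewrite /kap image_measureE /= /density_measure [RHS]integral_mkcond.
    by apply: eq_integral => z _; rewrite epatch_indic/= -EFinM.
  have mF : measurable_fun setT
      (fun z : 'cV[R]_n * 'cV[R]_p => (step_density beta z * \1_A z.2)%:E).
    apply/measurable_EFinP; apply: measurable_funM; first exact: measurable_step_density.
    exact: (measurableT_comp mI measurable_snd).
  have F0 (z : 'cV[R]_n * 'cV[R]_p) : 0 <= (step_density beta z * \1_A z.2)%:E.
    by rewrite lee_fin mulr_ge0 ?step_density_ge0.
  rewrite fubini_tonelli1//; apply: ge0_ae_eq_integral => //.
  - apply: emeasurable_funM; first exact: measurable_gaussian_prob.
    by apply/measurable_EFinP; exact: measurable_pg_weight.
  - exact: (@measurable_fun_fubini_tonelli_F _ _ _ _ _ (lebesgue_cV p) _ mF F0).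
  - move=> w _; rewrite mule_ge0 ?lee_fin ?pg_weight_ge0//.
    by apply: integral_ge0 => x _; rewrite lee_fin gaussian_pdf_ge0.
  - by move=> w _; apply: integral_ge0 => x _; exact: F0.
  apply: filterS ae0 => w w0 _; rewrite /gaussian_prob /fubini_F/=.
  rewrite integral_mkcond muleC -ge0_integralZl//; last 3 first.
  - apply: (measurable_restrictT _ _).1 => //; apply/measurable_EFinP/measurable_funTS.
    by apply: measurable_gaussian_pdf => //; exact: measurable_cst.
  - by move=> x _; apply: erestrict_ge0 => z _; rewrite lee_fin gaussian_pdf_ge0.
  - by rewrite lee_fin pg_weight_ge0.
  apply: eq_integral => x _; rewrite /step_density/= absv_id// epatch_indic/=.
  by rewrite -!EFinM mulrA.
rewrite (@eq_measure_integral _ _ _ _ kap); last by move=> A mA _; exact: PK.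
rewrite ge0_integral_image_measure//.
rewrite (@integral_density _ _ _ (nu0 \x lebesgue_cV p) _ (step_density beta))//.
- exact: measurable_step_density.
- exact: step_density_ge0.
- exact: (measurableT_comp mh measurable_snd).
Qed.

End gibbs.

Section posterior.
Context {R : realType} {n p : nat}.
Variables (X : 'M[R]_(n, p)) (y : 'I_n -> bool) (m0 : 'cV[R]_p) (S0 : 'M[R]_p).
Hypothesis hS0 : sym_posdef S0.

(** The normalization 1 + exp c = 2 exp (c/2) cosh (c/2) of a logistic factor cancels the
cosh in the Polya-Gamma density; what is left is log-quadratic in c. *)
Lemma logistic_pg_factor (b : bool) (c w : R) :
  expR (b%:R * c) / (1 + expR c) * (cosh (c / 2) * expR (- (c ^+ 2 / 2 * w))) =
  2^-1 * expR ((b%:R - 2^-1) * c - w * c ^+ 2 / 2).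
Proof.
have -> : (b%:R - 2^-1) * c - w * c ^+ 2 / 2 = b%:R * c + (- (c / 2) + - (c ^+ 2 / 2 * w)).
  by field.
rewrite expRD [expR (- (c / 2) + _)]expRD.
have e0 := expR_gt0 (c / 2).
have ec : expR c = expR (c / 2) ^+ 2 by rewrite expr2 -expRD -splitr.
rewrite /cosh ec expRN; set u := expR (c / 2) in e0 *.
have h : 1 + u ^+ 2 != 0 by rewrite gt_eqF// ltr_pwDl// sqr_ge0.
by field; rewrite h gt_eqF.
Qed.

Lemma likelihood_pg_weight (beta : 'cV[R]_p) (w : 'cV[R]_n) :
  likelihood X y beta * pg_weight X beta w =
  2^-1 ^+ n * expR (((X^T *m kappa y)^T *m beta) ord0 ord0 -
                    qform (X^T *m diag_mx w^T *m X) beta / 2).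
Proof.
rewrite -big_split/= (eq_bigr _ (fun i _ => logistic_pg_factor _ _ _)).
rewrite big_split/= prodr_const card_ord -expR_sum; congr (_ * expR _).
rewrite qform_likelihood trmx_mul trmxK -mulmxA [X in _ = X - _]mxE mulr_suml -sumrB.
by apply: eq_bigr => i _; rewrite !mxE.
Qed.

(** Both sides are exponentials of quadratic functions of beta with linear part
X^T kappa + S0^-1 m0 and quadratic part given by the precision matrix. *)
Lemma posterior_conjugacy (w : 'cV[R]_n) : (forall i, 0 <= w i ord0) ->
  exists2 C : R, 0 <= C & forall beta : 'cV[R]_p,
    likelihood X y beta * gaussian_pdf m0 S0 beta * pg_weight X beta w =
    C * cond_pdf X y m0 S0 w beta.
Proof.
move=> w0; have pS := Sigma_omega_posdef X hS0 w0.
have pQ := precision_posdef X hS0 w0.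
have QE : invmx (Sigma_omega X S0 w) = precision X S0 w by rewrite /Sigma_omega invmxK.
have mE : precision X S0 w *m m_omega X y m0 S0 w = X^T *m kappa y + invmx S0 *m m0.
  by rewrite /m_omega -QE mulmxA mulVmx ?mul1mx// posdef_unit.
set c0 := cond_pdf X y m0 S0 w 0.
have c0p : 0 < c0 by exact: gaussian_pdf_gt0.
exists (2^-1 ^+ n * gaussian_pdf m0 S0 0 / c0).
  by rewrite divr_ge0 ?(ltW c0p)// mulr_ge0 ?gaussian_pdf_ge0// exprn_ge0// invr_ge0.
move=> beta; rewrite mulrAC likelihood_pg_weight (gaussian_pdf_exponential m0 beta hS0).
rewrite /cond_pdf (gaussian_pdf_exponential _ beta pS) -/(cond_pdf _ _ _ _ _ _) -/c0.
rewrite QE mE -[RHS]mulrA [c0^-1 * _]mulrA mulVf ?gt_eqF// mul1r.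
rewrite mulrACA -expRD; congr (_ * expR _).
rewrite /precision qform_addmx linearD/= mulmxDl [in RHS]mxE; lra.
Qed.
End posterior.

Section mixture.
Context {R : realType} {n p : nat}.
Variables (X : 'M[R]_(n, p)) (y : 'I_n -> bool) (m0 : 'cV[R]_p) (S0 : 'M[R]_p).
Hypothesis hS0 : sym_posdef S0.
Variable P : R.-pker 'cV[R]_p ~> 'cV[R]_p.
Variable nu0 : probability 'cV[R]_n R.
Local Open Scope ereal_scope.
Hypothesis mixP : forall (beta : 'cV[R]_p) (h : 'cV[R]_p -> \bar R),
  measurable_fun setT h -> (forall x, 0 <= h x) ->
  \int[P beta]_x h x =
  \int[nu0 \x lebesgue_cV p]_z (h z.2 * (step_density X y m0 S0 beta z)%:E).

Let pgw beta w := pg_weight X beta (absv w).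
Let cond w x := cond_pdf X y m0 S0 (absv w) x.

Let absv_ge0 (w : 'cV[R]_n) i : (0 <= absv w i ord0)%R.
Proof. by rewrite mxE. Qed.

Let cond_ge0 w x : (0 <= cond w x)%R.
Proof. exact: cond_pdf_ge0. Qed.

Let pgw_ge0 beta w : (0 <= pgw beta w)%R.
Proof. exact: pg_weight_ge0. Qed.

Let mcond : measurable_fun setT (fun z : 'cV[R]_n * 'cV[R]_p => cond z.1 z.2).
Proof. exact: measurable_cond_pdf_abs. Qed.

Let mcondw w : measurable_fun setT (cond w).
Proof.
have h : measurable_fun setT (fun x : 'cV[R]_p => (w, x)).
  by apply: measurable_fun_pair => //; exact: measurable_cst.
exact: (measurableT_comp mcond h).
Qed.

Let cond_mean (h : 'cV[R]_p -> \bar R) w :=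
  \int[lebesgue_cV p]_x (h x * (cond w x)%:E).

Let measurable_cond_mean h : measurable_fun setT h -> (forall x, 0 <= h x) ->
  measurable_fun setT (cond_mean h).
Proof.
move=> mh h0.
have mf : measurable_fun setT
    (fun z : 'cV[R]_n * 'cV[R]_p => h z.2 * (cond z.1 z.2)%:E).
  apply: emeasurable_funM; last exact/measurable_EFinP.
  exact: (measurableT_comp mh measurable_snd).
apply: (@measurable_fun_fubini_tonelli_F _ _ _ _ _ (lebesgue_cV p) _ mf) => z.
by rewrite mule_ge0 ?lee_fin.
Qed.

Let cond_mean_ge0 h w : (forall x, 0 <= h x) -> 0 <= cond_mean h w.
Proof. by move=> h0; apply: integral_ge0 => x _; rewrite mule_ge0 ?lee_fin. Qed.

Lemma pg_kernel_integral beta h : measurable_fun setT h -> (forall x, 0 <= h x) ->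
  \int[P beta]_x h x = \int[nu0]_w ((pgw beta w)%:E * cond_mean h w).
Proof.
move=> mh h0; rewrite mixP//.
have mf : measurable_fun setT (fun z : 'cV[R]_n * 'cV[R]_p =>
    h z.2 * (step_density X y m0 S0 beta z)%:E).
  apply: emeasurable_funM; first exact: (measurableT_comp mh measurable_snd).
  by apply/measurable_EFinP; exact: measurable_step_density.
have f0 (z : 'cV[R]_n * 'cV[R]_p) : 0 <= h z.2 * (step_density X y m0 S0 beta z)%:E.
  by rewrite mule_ge0 ?lee_fin ?step_density_ge0.
rewrite fubini_tonelli1//; apply: eq_integral => w _; rewrite /fubini_F.
rewrite -(ge0_integralZl (lebesgue_cV p) measurableT); last 3 first.
- by apply: emeasurable_funM => //; apply/measurable_EFinP; exact: mcondw.
- by move=> x _; rewrite mule_ge0 ?lee_fin.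
- by rewrite lee_fin.
by apply: eq_integral => x _; rewrite /step_density/= EFinM muleCA.
Qed.

Lemma pg_weight_mass beta : \int[nu0]_w (pgw beta w)%:E = 1.
Proof.
have := @pg_kernel_integral beta (cst 1) (measurable_cst _) (fun=> lee01).
rewrite integral_cst// mul1e.
have -> : P beta setT = 1 by exact: prob_kernel.
move=> ->; apply: eq_integral => w _; rewrite /cond_mean.
under eq_integral => x _ do rewrite mul1e.
have -> : \int[lebesgue_cV p]_x (cond w x)%:E = 1 by exact: cond_pdf_mass.
by rewrite mule1.
Qed.

(** The conditional second moment is at most K for all values of the latent variables,
and their weight has mass 1. *)
Lemma pg_kernel_drift beta :
  \int[P beta]_x (l2norm x ^+ 2)%:E <=
  (opnorm S0 ^+ 2 * l2norm (X^T *m kappa y + invmx S0 *m m0)%R ^+ 2 + \tr S0)%:E.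
Proof.
set K := (_ + _)%R.
have mV : measurable_fun setT (fun x : 'cV[R]_p => (l2norm x ^+ 2)%:E).
  by apply/measurable_EFinP; apply: measurable_funX; exact: measurable_l2norm.
have V0 (x : 'cV[R]_p) : 0 <= (l2norm x ^+ 2)%:E by rewrite lee_fin sqr_ge0.
rewrite pg_kernel_integral//.
have mp : measurable_fun setT (fun w => (pgw beta w)%:E).
  by apply/measurable_EFinP; exact: measurable_pg_weight_abs.
apply: (@le_trans _ _ (\int[nu0]_w ((pgw beta w)%:E * K%:E))).
  apply: ge0_le_integral => //.
  - by move=> w _; rewrite mule_ge0 ?lee_fin// cond_mean_ge0.
  - by apply: emeasurable_funM => //; exact: measurable_cond_mean.
  - by apply: emeasurable_funM => //; exact: measurable_cst.
  - move=> w _; rewrite lee_wpmul2l ?lee_fin//; exact: cond_pdf_moment.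
have K0 : (0 <= K)%R.
  rewrite -lee_fin; apply: le_trans (cond_pdf_moment X y m0 hS0 (@absv_ge0 0%R)).
  apply: integral_ge0 => x _; rewrite lee_fin.
  exact: mulr_ge0 (sqr_ge0 _) (cond_pdf_ge0 _ _ _ _ _ _).
rewrite ge0_integralZr//; last by move=> w _; rewrite lee_fin.
by rewrite pg_weight_mass mul1e.
Qed.

Variable Pi : probability 'cV[R]_p R.
Hypothesis hPi : is_posterior X y m0 S0 Pi.

(** For fixed w the joint weight of x and w is F w times the Gaussian density at x, where F
is the marginal weight of w. Hence drawing a fresh x from the Gaussian leaves the joint weight
unchanged, and summing out w gives back the posterior. *)
Lemma pg_kernel_invariant : invariant_measure P Pi.
Proof.
have [Z Z0 PiE] := hPi => A mA.
pose post x : R := (likelihood X y x * gaussian_pdf m0 S0 x / Z)%R.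
have lik0 x : (0 <= likelihood X y x)%R.
  by apply: prodr_ge0 => i _; rewrite divr_ge0 ?expR_ge0// addr_ge0 ?expR_ge0.
have post0 x : (0 <= post x)%R.
  by rewrite divr_ge0 ?(ltW Z0)// mulr_ge0 ?gaussian_pdf_ge0.
have mX i : measurable_fun setT (fun x : 'cV[R]_p => (X *m x) i ord0).
  apply: measurable_entry; apply: measurable_mulmx; first exact: measurable_cst.
  exact: measurable_id.
have mpost : measurable_fun setT post.
  apply: measurable_funM => //; apply: measurable_funM; last first.
    exact: measurable_gaussian_pdfx.
  apply: measurable_prod => i _; apply: measurable_funM.
    by apply: measurableT_comp => //; exact: measurable_funM.
  apply: (measurableT_comp (@measurable_inv R)); apply: measurable_funD => //.
  exact: measurableT_comp.
have mIA : measurable_fun setT (\1_A : 'cV[R]_p -> R) by exact: measurable_indic.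
pose h x : \bar R := (\1_A x)%:E.
have mh : measurable_fun setT h by exact/measurable_EFinP.
have h0 x : 0 <= h x by rewrite lee_fin.
pose F w := \int[lebesgue_cV p]_x (post x * pgw x w)%:E.
have mpp : measurable_fun setT
    (fun z : 'cV[R]_p * 'cV[R]_n => (post z.1 * pgw z.1 z.2)%R).
  apply: measurable_funM; first exact: (measurableT_comp mpost measurable_fst).
  have g : measurable_fun setT (fun z : 'cV[R]_p * 'cV[R]_n => (z.1, absv z.2)).
    apply: measurable_fun_pair => //.
    by apply: (measurableT_comp (@measurable_absv R n) measurable_snd).
  exact: (measurableT_comp (measurable_pg_weight2 X) g).
(* The posterior density times the weight, as a function of x, is a multiple of the Gaussian
   density, and integrating identifies the factor. *)
have FE w x : (post x * pgw x w)%:E = F w * (cond w x)%:E.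
  have [C C0 CE] := posterior_conjugacy X y m0 hS0 (@absv_ge0 w).
  have e z : (post z * pgw z w = C / Z * cond w z)%R.
    by rewrite /post [LHS]mulrAC [(C / Z)%R]mulrC -[RHS]mulrA -CE mulrC.
  have -> : F w = (C / Z)%:E.
    rewrite /F; under eq_integral => z _ do rewrite e EFinM.
    have mc : measurable_fun setT (fun z => (cond w z)%:E).
      by apply/measurable_EFinP; exact: mcondw.
    have c0 z : setT z -> 0 <= (cond w z)%:E by move=> _; exact: cond_ge0.
    rewrite (ge0_integralZl (lebesgue_cV p) measurableT mc c0); last first.
      by rewrite lee_fin divr_ge0// ltW.
    have -> : \int[lebesgue_cV p]_x (cond w x)%:E = 1 by exact: cond_pdf_mass.
    by rewrite mule1.
  by rewrite e EFinM.
have mpgw x : measurable_fun setT (fun w => (pgw x w)%:E).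
  by apply/measurable_EFinP; exact: measurable_pg_weight_abs.
have mG := measurable_cond_mean mh h0.
have G0 w := cond_mean_ge0 w h0.
have PA x : P x A = \int[nu0]_w ((pgw x w)%:E * cond_mean h w).
  rewrite -pg_kernel_integral//.
  by rewrite /h integral_indic// setIT.
rewrite (integral_density mpost post0 PiE (measurable_kernel P A mA)); last by move=> x.
transitivity (\int[lebesgue_cV p]_x \int[nu0]_w ((post x * pgw x w)%:E * cond_mean h w)).
  apply: eq_integral => x _; rewrite PA muleC -ge0_integralZl//; last 3 first.
  - exact: emeasurable_funM.
  - by move=> w _; rewrite mule_ge0 ?lee_fin.
  - by rewrite lee_fin.
  by apply: eq_integral => w _; rewrite EFinM muleA.
have mf1 : measurable_fun setT (fun z : 'cV[R]_p * 'cV[R]_n =>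
    (post z.1 * pgw z.1 z.2)%:E * cond_mean h z.2).
  apply: emeasurable_funM; first exact/measurable_EFinP.
  exact: (measurableT_comp mG measurable_snd).
rewrite (@fubini_tonelli _ _ _ _ _ (lebesgue_cV p) nu0
  (fun z : 'cV[R]_p * 'cV[R]_n => (post z.1 * pgw z.1 z.2)%:E * cond_mean h z.2))//=; last first.
  move=> z; apply: mule_ge0; last exact: G0.
  by rewrite lee_fin; exact: mulr_ge0 (post0 _) (pgw_ge0 _ _).
transitivity (\int[nu0]_w \int[lebesgue_cV p]_x (h x * (post x * pgw x w)%:E)).
  apply: eq_integral => w _.
  have F0 : 0 <= F w by apply: integral_ge0 => x _; rewrite lee_fin mulr_ge0.
  rewrite ge0_integralZr//; last 2 first.
  - apply/measurable_EFinP.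
    have g : measurable_fun setT (fun x : 'cV[R]_p => (x, w)).
      by apply: measurable_fun_pair => //; exact: measurable_cst.
    exact: (measurableT_comp mpp g).
  - by move=> x _; rewrite lee_fin mulr_ge0.
  rewrite -/(F w) -ge0_integralZl//; last 2 first.
  - by apply: emeasurable_funM => //; apply/measurable_EFinP; exact: mcondw.
  - by move=> x _; rewrite mule_ge0 ?lee_fin.
  by apply: eq_integral => x _; rewrite FE muleCA.
have mf2 : measurable_fun setT (fun z : 'cV[R]_p * 'cV[R]_n =>
    h z.1 * (post z.1 * pgw z.1 z.2)%:E).
  apply: emeasurable_funM; last exact/measurable_EFinP.
  exact: (measurableT_comp mh measurable_fst).
rewrite -(@fubini_tonelli _ _ _ _ _ (lebesgue_cV p) nu0
  (fun z : 'cV[R]_p * 'cV[R]_n => h z.1 * (post z.1 * pgw z.1 z.2)%:E))//=; last first.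
  move=> z; apply: mule_ge0; first exact: h0.
  by rewrite lee_fin; exact: mulr_ge0 (post0 _) (pgw_ge0 _ _).
rewrite PiE// [RHS]integral_mkcond; apply: eq_integral => x _.
rewrite epatch_indic/= -EFinM mulrC EFinM -[X in _ = _ * X]mule1 -(pg_weight_mass x).
have p0 w : setT w -> 0 <= (pgw x w)%:E by move=> _; exact: pgw_ge0.
rewrite -(ge0_integralZl nu0 measurableT (mpgw x) p0); last exact: post0.
have mpx : measurable_fun setT (fun w => (post x)%:E * (pgw x w)%:E).
  by apply: emeasurable_funM => //; exact: measurable_cst.
rewrite -(ge0_integralZl nu0 measurableT mpx); last 2 first.
- by move=> w _; rewrite mule_ge0 ?lee_fin.
- exact: h0.
by apply: eq_integral => w _; rewrite EFinM.
Qed.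

End mixture.

(** * Drift, minorization and the ergodicity bounds *)

Section sublevel.
Context {R : realType} {d : measure_display} {T : measurableType d}.
Variables (m : {measure set T -> \bar R}) (V : T -> R).
Hypotheses (m1 : m setT = 1%E) (mV : measurable_fun setT V) (V0 : forall x, 0 <= V x).
Local Open Scope ereal_scope.

Lemma measurable_sublevel (M : R) : measurable [set x | (V x <= M)%R].
Proof.
rewrite (_ : mkset _ = V @^-1` `]-oo, M]%classic).
  by rewrite -[X in measurable X]setTI; apply: mV.
by apply/seteqP; split=> x /=; rewrite in_itv/=.
Qed.

(** For K = 0 the bound r * K is 0 as well and Markov's inequality is void; then V vanishes
almost everywhere. *)
Lemma markov_sublevel (K r : R) : (0 <= K)%R -> (1 < r)%R ->
  \int[m]_x (V x)%:E <= K%:E -> (1 - 1 / r)%:E <= m [set x | (V x <= r * K)%R].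
Proof.
move=> K0 r1 VK; have r0 : (0 < r)%R by exact: lt_trans r1.
set C := [set x | _]; pose B := ~` C.
have mC : measurable C by exact: measurable_sublevel.
have mB : measurable B by exact: measurableC.
have CB : m C + m B = 1.
  by rewrite -measureU// ?setICr// setUv.
have mEV : measurable_fun setT (fun x => (V x)%:E) by exact/measurable_EFinP.
have mBr : m B <= (1 / r)%:E.
  move: K0; rewrite le_eqVlt => /predU1P[K0|K0].
    have V00 : \int[m]_x `|(V x)%:E| = 0.
      have -> : \int[m]_x `|(V x)%:E| = \int[m]_x (V x)%:E.
        by apply: eq_integral => x _; rewrite gee0_abs ?lee_fin.
      apply/eqP; rewrite eq_le; apply/andP; split; first by rewrite (le_trans VK)// -K0.
      by apply: integral_ge0 => x _; rewrite lee_fin.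
    have [/(_ V00) ae0 _] :=
      @ae_eq_integral_abs _ _ _ m _ measurableT (fun x => (V x)%:E) mEV.
    have -> : m B = 0.
      apply/negligibleP => //; apply: negligibleS ae0 => x /= Bx h; apply: Bx.
      by rewrite /C/= -K0 mulr0; have [->] := h Logic.I.
    by rewrite lee_fin divr_ge0// ltW.
  have M0 : (0 < r * K)%R by rewrite mulr_gt0.
  have mI : measurable_fun setT (fun x => (\1_B x)%:E : \bar R).
    by apply/measurable_EFinP; exact: measurable_indic.
  have I0 x : setT x -> 0 <= (\1_B x)%:E :> \bar R by rewrite lee_fin.
  have : (r * K)%:E * m B <= K%:E.
    apply: le_trans VK; have -> : m B = \int[m]_x (\1_B x)%:E.
      by rewrite integral_indic// setIT.
    rewrite -(ge0_integralZl m measurableT mI I0) ?lee_fin ?(ltW M0)//.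
    apply: ge0_le_integral => //.
    - by move=> x _; rewrite mule_ge0 ?lee_fin// ltW.
    - by apply: emeasurable_funM => //; exact: measurable_cst.
    - move=> x _; rewrite -EFinM lee_fin indicE.
      have [/set_mem/negP Bx|_] := boolP (x \in B); last by rewrite mulr0.
      by rewrite mulr1 ltW// ltNge.
  have Bf : m B \is a fin_num.
    rewrite ge0_fin_numE// (le_lt_trans _ (ltry 1))// -CB leeDr//.
  rewrite -(fineK Bf) -EFinM !lee_fin => h.
  rewrite -(ler_pM2l M0) (le_trans h)// mul1r mulrAC mulfV ?mul1r//.
  exact: lt0r_neq0.
have : (1 - 1 / r)%:E <= 1 - m B by rewrite EFinB leeB.
have Bf : m B \is a fin_num.
  by rewrite ge0_fin_numE// (le_lt_trans mBr)// ltry.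
by rewrite -CB addeK.
Qed.

End sublevel.

Section minorization.
Context {R : realType} {n p : nat}.
Variables (X : 'M[R]_(n, p)) (y : 'I_n -> bool) (m0 : 'cV[R]_p) (S0 : 'M[R]_p).
Hypothesis hS0 : sym_posdef S0.
Variable P : R.-pker 'cV[R]_p ~> 'cV[R]_p.
Hypothesis hP : is_pg_kernel X y m0 S0 P.
Variable M : R.
Hypothesis M0 : 0 <= M.

Let C i : R := l2norm (row i X)^T * Num.sqrt M.

Let covariate (i : 'I_n) (beta : 'cV[R]_p) :
  (X *m beta) i ord0 = ((row i X)^T^T *m beta) ord0 ord0.
Proof. by rewrite trmxK -row_mul [in RHS]mxE. Qed.

Lemma covariate_bound i (beta : 'cV[R]_p) : l2norm beta ^+ 2 <= M ->
  (X *m beta) i ord0 ^+ 2 <= C i ^+ 2.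
Proof.
move=> bM; rewrite covariate -[leLHS]real_normK ?num_real// ler_sqr ?nnegrE//; last first.
  by rewrite mulr_ge0 ?l2norm_ge0 ?sqrtr_ge0.
apply: (le_trans (l2norm_cauchy_schwarz _ _)).
rewrite ler_wpM2l ?l2norm_ge0// -[leLHS]ger0_norm ?l2norm_ge0//.
by rewrite -sqrtr_sqr ler_wsqrtr.
Qed.

(** It lets the integral of each factor of the lower bound be read off as a Laplace
transform at an actual state. *)
Lemma covariate_bound_attained i : exists beta : 'cV[R]_p, (X *m beta) i ord0 = C i.
Proof.
(* If the covariate is 0 then so is C i, and the factor sqrt M / 0 = 0 is harmless. *)
exists ((Num.sqrt M / l2norm (row i X)^T) *: (row i X)^T).
rewrite covariate -scalemxAr mxE -sqr_l2normE /C.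
have [->|x0] := eqVneq (l2norm (row i X)^T) 0; first by rewrite expr0n mulr0 mul0r.
by rewrite expr2 mulrA divfK// mulrC.
Qed.

(** The lower bound, uniform over the ball, of the weight of the latent variables. *)
Definition pg_floor (w : 'cV[R]_n) : R := \prod_i expR (- (C i ^+ 2 / 2 * w i ord0)).

Lemma pg_floor_le (beta : 'cV[R]_p) (w : 'cV[R]_n) : l2norm beta ^+ 2 <= M ->
  (forall i, 0 <= w i ord0) -> pg_floor w <= pg_weight X beta w.
Proof.
move=> bM w0; apply: ler_prod => i _; rewrite expR_ge0/=.
rewrite -[leLHS]mul1r ler_pM ?expR_ge0 ?cosh_ge1// ler_expR lerN2 ler_wpM2r//.
by rewrite ler_wpM2r ?covariate_bound.
Qed.

Local Open Scope ereal_scope.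

Lemma pg_kernel_minorization : exists ms : {measure set 'cV[R]_p -> \bar R},
  ms setT = (\prod_i (cosh (C i / 2))^-1)%:E /\
  forall beta : 'cV[R]_p, (l2norm beta ^+ 2 <= M)%R ->
  forall h : 'cV[R]_p -> \bar R, measurable_fun setT h -> (forall x, 0 <= h x) ->
  \int[ms]_x h x <= \int[P beta]_x h x.
Proof.
have [mu0 [nu0 [ind neg0 lap mixP]]] := pg_kernel_mixture hP.
pose f (i : 'I_n) (x : R) : R := expR (- (C i ^+ 2 / 2 * x)).
have mf i : measurable_fun setT (f i).
  apply: measurableT_comp => //.
  by apply: measurable_funN; exact: measurable_funM.
have f0 i x : (0 <= f i x)%R by exact: expR_ge0.
have intf i : \int[mu0 i]_x (f i x)%:E = ((cosh (C i / 2))^-1)%:E.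
  by have [beta bC] := covariate_bound_attained i; have := lap i beta; rewrite bC.
have mfl : measurable_fun setT (fun w : 'cV[R]_n => pg_floor (absv w)).
  have mfl0 : measurable_fun setT pg_floor.
    apply: measurable_prod => i _.
    exact: (measurableT_comp (mf i) (measurable_mx_coord i ord0)).
  exact: (measurableT_comp mfl0 (@measurable_absv R n)).
have fl0 w : (0 <= pg_floor w)%R by apply: prodr_ge0 => i _; exact: expR_ge0.
pose g (z : 'cV[R]_n * 'cV[R]_p) : R :=
  (pg_floor (absv z.1) * cond_pdf X y m0 S0 (absv z.1) z.2)%R.
have mg : measurable_fun setT g.
  apply: measurable_funM; last exact: measurable_cond_pdf_abs.
  exact: (measurableT_comp mfl measurable_fst).
have g0 z : (0 <= g z)%R by rewrite mulr_ge0 ?cond_pdf_ge0.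
have a0 (w : 'cV[R]_n) i : (0 <= absv w i ord0)%R by rewrite mxE.
pose dg := density_measure (nu0 \x lebesgue_cV p) mg g0.
pose ms := image_measure dg
  (measurable_snd : measurable_fun setT (@snd 'cV[R]_n 'cV[R]_p)).
have msE h : measurable_fun setT h -> (forall x, 0 <= h x) ->
    \int[ms]_x h x = \int[nu0 \x lebesgue_cV p]_z (h z.2 * (g z)%:E).
  move=> mh h0; rewrite ge0_integral_image_measure//.
  rewrite (@integral_density _ _ _ (nu0 \x lebesgue_cV p) _ g)//.
  exact: (measurableT_comp mh measurable_snd).
exists ms; split.
  have -> : ms setT = \int[ms]_x cst 1 x by rewrite integral_cst// mul1e.
  rewrite msE//.
  under eq_integral => z _ do rewrite /= mul1e.
  have mge : measurable_fun setT (EFin \o g) by exact/measurable_EFinP.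
  have ge0 z : 0 <= (EFin \o g) z by rewrite lee_fin.
  rewrite (fubini_tonelli1 (EFin \o g) mge ge0).
  transitivity (\int[nu0]_w (\prod_i f i (w i ord0))%:E).
    apply: ge0_ae_eq_integral => //.
    - exact: (@measurable_fun_fubini_tonelli_F _ _ _ _ _ (lebesgue_cV p) _ mge ge0).
    - apply/measurable_EFinP; apply: measurable_prod => i _.
      exact: (measurableT_comp (mf i) (measurable_mx_coord i ord0)).
    - by move=> w _; apply: integral_ge0 => x _; exact: ge0.
    - by move=> w _; rewrite lee_fin prodr_ge0.
    apply: filterS (joint_ae_ge0 ind neg0) => w w0 _.
    rewrite /fubini_F /= /g/= absv_id//.
    under eq_integral => x _ do rewrite EFinM.
    have mc : measurable_fun setT (fun x => (cond_pdf X y m0 S0 w x)%:E).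
      by apply/measurable_EFinP; exact: measurable_gaussian_pdfx.
    have c0 (x : 'cV[R]_p) : setT x -> 0 <= (cond_pdf X y m0 S0 w x)%:E.
      by move=> _; exact: cond_pdf_ge0.
    rewrite (ge0_integralZl (lebesgue_cV p) measurableT mc c0); last exact: fl0.
    by rewrite cond_pdf_mass// mule1.
  rewrite (joint_integral_prod ind mf f0).
    by rewrite -prodEFin; apply: eq_bigr => i _; exact: intf.
  by move=> i; rewrite intf ltry.
move=> beta bM h mh h0; rewrite msE// mixP//.
have mh2 : measurable_fun setT (fun z : 'cV[R]_n * 'cV[R]_p => h z.2).
  exact: (measurableT_comp mh measurable_snd).
apply: ge0_le_integral => //.
- by move=> z _; rewrite mule_ge0 ?lee_fin.
- by apply: emeasurable_funM => //; exact/measurable_EFinP.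
- apply: emeasurable_funM => //; apply/measurable_EFinP; exact: measurable_step_density.
- move=> z _; apply: lee_wpmul2l => //; rewrite lee_fin.
  by apply: ler_wpM2r; [exact: cond_pdf_ge0|exact: pg_floor_le].
Qed.

End minorization.

Theorem theorem4p1 (R : realType) (n p : nat)
    (X : 'M[R]_(n, p)) (y : 'I_n -> bool) (m0 : 'cV[R]_p) (S0 : 'M[R]_p)
    (hS0 : sym_posdef S0)
    (Pi : probability 'cV[R]_p R) (hPi : is_posterior X y m0 S0 Pi)
    (P : R.-pker 'cV[R]_p ~> 'cV[R]_p) (hP : is_pg_kernel X y m0 S0 P) :
  let V := fun beta : 'cV[R]_p => l2norm beta ^+ 2 in
  let K := opnorm S0 ^+ 2 * l2norm (X^T *m kappa y + invmx S0 *m m0) ^+ 2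
           + \tr S0 in
  hyper_uniformly_ergodic P Pi V /\
  forall r : R, 1 < r ->
    let gamma_r := 1 - 1 / r in
    let eps_r :=
      \prod_(i < n) (cosh (l2norm (row i X)^T * Num.sqrt (r * K) / 2))^-1 in
    forall (beta : 'cV[R]_p) (t : nat), (1 <= t)%N ->
      [/\ (tv_dist (kernel_iter P t beta) Pi <= (rho t gamma_r eps_r)%:E)%E,
          (weighted_dist (fun z => 1 + V z)%R
             (kernel_iter P (t + 1) beta) Pi
             <= (2 * (1 + K) * rho t gamma_r eps_r)%:E)%E &
          (wasserstein (fun u v : 'cV[R]_p => l2norm (u - v)%R)
             (kernel_iter P (t + 1) beta) Pi
             <= (2 * (1 + K) * rho t gamma_r eps_r)%:E)%E].
Proof.
move=> V K.
have [mu0 [nu0 [ind neg0 lap mixP]]] := pg_kernel_mixture hP.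
have PiP : invariant_measure P Pi by exact: (pg_kernel_invariant hS0 mixP hPi).
have mV : measurable_fun setT V by apply: measurable_funX; exact: measurable_l2norm.
have V0 x : 0 <= V x by exact: sqr_ge0.
have PV x : (\int[P x]_z (V z)%:E <= K%:E)%E by exact: (pg_kernel_drift hS0 mixP x).
have K0 : 0 <= K.
  rewrite -lee_fin; apply: le_trans (PV 0).
  by apply: integral_ge0 => z _; rewrite lee_fin.
pose eps (r : R) := \prod_(i < n) (cosh (l2norm (row i X)^T * Num.sqrt (r * K) / 2))^-1.
have g01 (r : R) : 1 < r -> 0 < 1 - 1 / r < 1.
  move=> r1; have r0 : 0 < r by exact: lt_trans r1.
  by rewrite div1r subr_gt0 invf_plt ?posrE// invr1 r1/= ltrBlDr ltrDl invr_gt0.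
have e01 (r : R) : 0 < eps r <= 1.
  rewrite prodr_gt0/=; last by move=> i _; rewrite invr_gt0 cosh_gt0.
  apply: prodr_ile1 => i _; rewrite invr_ge0 (ltW (cosh_gt0 _))/=.
  by rewrite invf_ple ?posrE ?cosh_gt0// invr1 cosh_ge1.
have tv (r : R) t x : 1 < r ->
    (tv_dist (kernel_iter P t x) Pi <= (rho t (1 - 1 / r) (eps r))%:E)%E.
  move=> r1; have rK : 0 <= r * K by rewrite mulr_ge0// ltW// (lt_trans _ r1).
  have [ms [msT minor]] := pg_kernel_minorization hS0 hP (r * K).
  apply: (@tv_dist_le_rho _ _ _ P Pi PiP [set x | V x <= r * K] _ _ _ ms) => //.
  - exact: measurable_sublevel.
  - exact: g01.
  - by move=> z; apply: markov_sublevel => //; exact: prob_kernel.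
have weighted (r : R) t x : 1 < r ->
    (weighted_dist (fun z => 1 + V z)%R (kernel_iter P (t + 1) x) Pi
       <= (2 * (1 + K) * rho t (1 - 1 / r) (eps r))%:E)%E.
  by move=> r1; apply: (weighted_dist_le PiP mV V0 K0 PV); exact: tv.
split.
  split=> //; have r2 : (1 : R) < 2 by rewrite ltr1n.
  have /andP[e0 e1] := e01 2; have /andP[h0 h1] := g01 _ r2.
  (* The second constant must be positive, and K is 0 when p = 0. *)
  exists ((1 - 1 / 2) * eps 2), (K + 1); split.
  - rewrite mulr_gt0//=; apply: (@le_lt_trans _ _ (1 - 1 / 2)) => //.
    by rewrite ler_piMr// ltW.
  - by rewrite ltr_wpDl.
  move=> x t _; have even := rho_even_le (g01 _ r2) (e01 2) t; split.
    by apply: (le_trans (tv 2 _ x r2)); rewrite lee_fin.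
  apply: (le_trans (weighted 2 _ x r2)); rewrite lee_fin.
  apply: ler_pM => //; first by rewrite mulr_ge0// addr_ge0.
    by apply: rho_ge0; [exact: g01|exact: e01].
  by rewrite ler_wpM2l// lerD2l lerDl.
move=> r r1 gamma_r eps_r x t _; split; [exact: tv|exact: weighted|].
apply: le_trans (weighted r t x r1).
have W0 z : 0 <= 1 + V z by rewrite addr_ge0.
have mdist : measurable_fun setT
    (fun z : 'cV[R]_p * 'cV[R]_p => l2norm (z.1 - z.2)).
  have h : measurable_fun setT (fun z : 'cV[R]_p * 'cV[R]_p => z.1 - z.2).
    by apply: measurable_submx; [exact: measurable_fst|exact: measurable_snd].
  exact: (measurableT_comp (@measurable_l2norm R p) h).
have lin (z : 'cV[R]_p) : l2norm z <= 1 + V z.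
  rewrite /V; set a := l2norm z; have := sqr_ge0 (a - 1); have := sqr_ge0 a; nra.
have mass := kernel_iter_setT P (t + 1) x.
apply: (@wasserstein_le_weighted _ _ _ (probability_of_mass_one mass) Pi
  (fun z => 1 + V z) (fun u v => l2norm (u - v))) => //.
- exact: measurable_funD.
- by move=> u v; exact: l2norm_ge0.
- by move=> u; rewrite subrr; apply/eqP; rewrite l2norm_eq0.
- by move=> u v; rewrite (le_trans (ler_l2normB _ _))// lerD.
- exact: (kernel_iter_weight_fin mV V0 PV).
- exact: (invariant_weight_fin PiP mV V0 PV).
Qed.
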